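(* (a) Let $X$ be a Banach function space on $I=[0,\infty)$. (i) If $C$ is bounded on $X$, then $X\hookrightarrow CX$; if, additionally, the dilation operator $\sigma_{1/a}$ is bounded on $X$ for some $a>1$, then $CX=CCX$. (ii) If $C^*$ is bounded on $X$, then $X\hookrightarrow C^*X$; if, additionally, the dilation operator $\sigma_{1/a}$ is bounded on $X$ for some $0<a<1$, then $C^*X=C^*C^*X$. (iii) If both operators $C$ and $C^*$ are bounded on $X$, then $CX=C^*X$. (b) Let $X$ be a Banach function space on $I=[0,1]$. (iv) If $C$ is bounded on $X$, then $X\overset{A}{\hookrightarrow}CX$ and $C^*X\overset{A}{\hookrightarrow}CX$ with $A=\|C\|_{X\to X}$. The last embedding is strict even if $X=L^p[0,1]$ with $1<p<\infty$. (v) If $C^*$ is bounded on $X$, then $X\hookrightarrow C^*X$. If, additionally, the dilation operator $\sigma_{1/a}$ is bounded on $X$ for some $0<a<1$, then $C^*X=C^*C^*X$. (vi) If $C^*$ is bounded on $X$ and $L^\infty\hookrightarrow X$, then $CX\cap L^1\hookrightarrow C^*X$. If, additionally, $C$ is bounded on $X$ and $X\hookrightarrow L^1$, then $C^*X=CX\cap L^1$ and $(C^*X)'=\widetilde{X'}$. (vii) If both operators $C$ and $C^*$ are bounded on $X$, and $X$ is a symmetric space, then $C^*X=CX\cap L^1=C\widetilde{X}$. (c) Let $X$ be a Banach sequence space. (viii) If $C_d$ is bounded on $X$, then $X\hookrightarrow C_dX$; if, additionally, the dilation operator $\sigma_{1/2}$ is bounded on $X$, then $C_dX=C_dC_dX$.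 (ix) If $C_d^*$ is bounded on $X$, then $X\hookrightarrow C_d^*X$; if, additionally, the dilation operator $\sigma_2$ is bounded on $X$, then $C_d^*X=C_d^*C_d^*X$. (x) If the operators $C_d$, $C_d^*$ and the unilateral shift $S$ with its dual $S^*$ are bounded on $X$, then $C_dX=C_d^*X$.
   Context: Let $I$ be $[0,1]$ or $[0,\infty)$ with Lebesgue measure $m$, or $\mathbb{N}$ with counting measure $m$; $L^0=L^0(I)$ is the set of equivalence classes of real-valued measurable functions on $I$. A Banach ideal space $X$ on $I$ is a Banach space $X\subset L^0(I)$ such that $f,g\in L^0$, $|f|\le|g|$ a.e., $g\in X$ imply $f\in X$ and $\|f\|_X\le\|g\|_X$; it is assumed to contain some $f$ with $f(x)>0$ for each $x\in I$. It is called a Banach function space if $I=[0,1]$ or $[0,\infty)$, and a Banach sequence space if $I=\mathbb{N}$. A symmetric space is a Banach function space $X$ such that if $f\in X$ and $g\in L^0$ is equimeasurable with $f$ (i.e. $m(\{|f|>\lambda\})=m(\{|g|>\lambda\})$ for all $\lambda\ge0$), then $g\in X$ and $\|g\|_X=\|f\|_X$. $X\overset{A}{\hookrightarrow}Y$ means $X\subset Y$ with $\|f\|_Y\le A\|f\|_X$ for all $f\in X$; $X\hookrightarrow Y$ means this holds for some $A>0$; $X=Y$ means the spaces coincide as sets with equivalent norms. $X\cap Y$ has norm $\max(\|f\|_X,\|f\|_Y)$. The Köthe dual $X'$ is the space of $f\in L^0$ with $\|f\|_{X'}=\sup\{\int_I|fg|\,dm:\|g\|_X\le1\}<\infty$.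 For functions on $I=[0,1]$ or $[0,\infty)$: $Cf(x)=\frac1x\int_0^xf(t)\,dt$ ($0<x\in I$), $C^*f(x)=\int_{I\cap[x,\infty)}\frac{f(t)}{t}\,dt$, $\widetilde f(x)=\operatorname{ess\,sup}_{t\in I,\,t\ge x}|f(t)|$, and for $\tau>0$ the dilation operator is $\sigma_\tau f(x)=f(x/\tau)$ if $x/\tau\in I$ and $0$ otherwise. For sequences: $(C_da)_n=\frac1n\sum_{k=1}^na_k$, $(C_d^*a)_n=\sum_{k=n}^\infty\frac{a_k}{k}$, $(\sigma_2a)_n=a_{[(n+1)/2]}$ (that is, $\sigma_2a=(a_1,a_1,a_2,a_2,\dots)$), $(\sigma_{1/2}a)_n=\frac12(a_{2n-1}+a_{2n})$, $S(x_1,x_2,\dots)=(0,x_1,x_2,\dots)$, and $S^*(x_1,x_2,x_3,\dots)=(x_2,x_3,\dots)$. The abstract Cesàro, Copson and Tandori spaces are $CX=\{f\in L^0:C|f|\in X\}$ with $\|f\|_{CX}=\|C|f|\|_X$, $C^*X=\{f\in L^0:C^*|f|\in X\}$ with $\|f\|_{C^*X}=\|C^*|f|\|_X$, $\widetilde X=\{f\in L^0:\widetilde f\in X\}$ with $\|f\|_{\widetilde X}=\|\widetilde f\|_X$; in the sequence case $C_dX$, $C_d^*X$ are defined analogously with $C_d$, $C_d^*$. Also $CCX=C(CX)$, $C^*C^*X=C^*(C^*X)$, and similarly for $C_dC_dX$, $C_d^*C_d^*X$. An operator $T$ is bounded on $X$ if it is bounded as an operator $X\to X$. *)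

(* Defs.v *)
From HB Require Import structures.
From mathcomp Require Import all_boot all_order all_algebra.
From mathcomp Require Import all_classical all_reals all_analysis.
From mathcomp Require Import ess_sup_inf.
Import Order.TTheory GRing.Theory Num.Theory.
Import numFieldNormedType.Exports.

Set Implicit Arguments.
Unset Strict Implicit.
Unset Printing Implicit Defensive.

Local Open Scope classical_set_scope.
Local Open Scope ring_scope.

(** A set of functions with a norm, no axioms assumed.  An element of [L^0(D)]
    is represented by any total function [T -> R] that is measurable on [D];
    representatives that agree almost everywhere on [D] are not identified,
    but axiom [bis_ideal] below makes membership and norm depend only on the
    class.  The norm is meaningful only on members. *)
Record fspace d (T : measurableType d) (R : realType)
    (mu : {measure set T -> \bar R}) (D : set T) := FSpace {
  mem_fspace :> (T -> R) -> Prop ;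
  fnorm : (T -> R) -> R }.
Arguments FSpace {d T R mu D} _ _.
Arguments fnorm {d T R mu D} _ _.

Section spaces.
Context d (T : measurableType d) (R : realType).
Context (mu : {measure set T -> \bar R}) (D : set T).
Implicit Types X Y : fspace mu D.

Record banach_ideal_space X : Prop := {
  bis_measurable : forall f, X f -> measurable_fun D f ;
  bis_add : forall f g, X f -> X g ->
    X (f \+ g) /\ fnorm X (f \+ g) <= fnorm X f + fnorm X g ;
  bis_scale : forall (c : R) f, X f ->
    X (fun x => c * f x) /\ fnorm X (fun x => c * f x) = `|c| * fnorm X f ;
  bis_norm_eq0 : forall f, X f -> fnorm X f = 0 ->
    \forall x \ae mu, D x -> f x = 0 ;
  bis_complete : forall u : nat -> T -> R, (forall n, X (u n)) ->
    (forall e : R, 0 < e -> exists N, forall m n, (N <= m)%N -> (N <= n)%N ->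
       fnorm X (u m \- u n) < e) ->
    exists2 f, X f & (fun n => fnorm X (u n \- f)) @ \oo --> (0 : R) ;
  bis_ideal : forall f g : T -> R, measurable_fun D f ->
    (\forall x \ae mu, D x -> `|f x| <= `|g x|) -> X g ->
    X f /\ fnorm X f <= fnorm X g ;
  bis_weight : exists2 f, X f & forall x, D x -> 0 < f x }.

Definition embeds_with (A : R) X Y : Prop :=
  forall f, X f -> Y f /\ fnorm Y f <= A * fnorm X f.

Definition embeds X Y : Prop := exists2 A : R, 0 < A & embeds_with A X Y.

Definition strictly_embeds_with (A : R) X Y : Prop :=
  embeds_with A X Y /\ exists2 f, Y f & ~ X f.

Definition space_eq X Y : Prop :=
  (forall f, X f <-> Y f) /\
  exists A B : R, [/\ 0 < A, 0 < B & forall f, X f ->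
    A * fnorm X f <= fnorm Y f <= B * fnorm X f].

Definition inter_space X Y : fspace mu D :=
  FSpace (fun f => X f /\ Y f) (fun f => Num.max (fnorm X f) (fnorm Y f)).

Definition kothe_dual_norm X (f : T -> R) : \bar R :=
  ereal_sup [set (\int[mu]_(x in D) `|f x * g x|%:E)%E
            | g in [set g | X g /\ fnorm X g <= 1]].

Definition kothe_dual X : fspace mu D :=
  FSpace (fun f => measurable_fun D f /\ (kothe_dual_norm X f < +oo)%E)
         (fun f => fine (kothe_dual_norm X f)).

(** [L^p(D)], [1 <= p <= +oo], through the zero extension outside [D]. *)
Definition Lp_space (p : \bar R) : fspace mu D :=
  FSpace (fun f => f \_ D \in Lfun mu p)
         (fun f => fine ('N[mu]_p[EFin \o (f \_ D)])).

(** An operator is given by its pointwise formula, with values in the extended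
    reals.  An extended real-valued function belongs to [X] when it is finite
    almost everywhere on [D] and the resulting real function is in [X].  As a
    Lebesgue integral is finite only for an integrable integrand, this includes
    the requirement that the integrals defining [P f] make sense. *)
Definition emem X (F : T -> \bar R) : Prop :=
  (\forall x \ae mu, D x -> F x \is a fin_num) /\ X (fine \o F).

Definition bounded_on X (P : (T -> R) -> T -> \bar R) : Prop :=
  exists A : R, forall f, X f ->
    emem X (P f) /\ fnorm X (fine \o P f) <= A * fnorm X f.

Definition opnorm X (P : (T -> R) -> T -> \bar R) : R :=
  sup [set fnorm X (fine \o P f) | f in [set f | X f /\ fnorm X f <= 1]].

Definition op_space (P : (T -> R) -> T -> \bar R) X : fspace mu D :=
  FSpace (fun f => measurable_fun D f /\ emem X (P (fun x => `|f x|)))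
         (fun f => fnorm X (fine \o P (fun x => `|f x|))).

End spaces.

Definition half_line (R : realType) : set R := `[0, +oo[.
Definition unit_interval (R : realType) : set R := `[0, 1].
Arguments half_line R : clear implicits.
Arguments unit_interval R : clear implicits.

Section function_spaces.
Context (R : realType).
Local Notation leb := (@lebesgue_measure R).

Definition cesaro_op (f : R -> R) (x : R) : \bar R :=
  ((x^-1)%:E * \int[leb]_(t in `[0%R, x]) (f t)%:E)%E.

Definition copson_op (I : set R) (f : R -> R) (x : R) : \bar R :=
  (\int[leb]_(t in I `&` `[x, +oo[) (f t / t)%:E)%E.

(** The restriction to [I `&` [x, +oo[] extends by zero; as the function is
    nonnegative this does not change the essential supremum over that set,
    except when the set is null, where the value is 0 instead of [-oo]. *)
Definition tilde_op (I : set R) (f : R -> R) (x : R) : \bar R :=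
  ess_sup leb (EFin \o ((fun t => `|f t|) \_ (I `&` `[x, +oo[))).

Definition dilation_op (I : set R) (tau : R) (f : R -> R) (x : R) : \bar R :=
  ((f \_ I) (x / tau))%:E.

Context (I : set R).
Implicit Types X : fspace leb I.

Definition cesaro_space X : fspace leb I :=
  op_space (T := measurableTypeR R) cesaro_op X.
Definition copson_space X : fspace leb I :=
  op_space (T := measurableTypeR R) (copson_op I) X.
Definition tandori_space X : fspace leb I :=
  FSpace (T := measurableTypeR R)
         (fun f => measurable_fun (T := measurableTypeR R) I f /\
                   emem X (tilde_op I f))
         (fun f => fnorm X (fine \o tilde_op I f)).

Definition equimeasurable (f g : R -> R) : Prop :=
  forall lambda : R, 0 <= lambda ->
    leb [set x | I x /\ lambda < `|f x|] = leb [set x | I x /\ lambda < `|g x|].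

Definition symmetric_space X : Prop :=
  banach_ideal_space X /\
  forall f g : R -> R, X f -> measurable_fun (T := measurableTypeR R) I g ->
    equimeasurable f g ->
    X g /\ fnorm X g = fnorm X f.

End function_spaces.

(** The sequence [(a_1, a_2, ...)] is represented by [a : nat -> R] with
    [a k = a_(k+1)]. *)
Section sequence_spaces.
Context (R : realType).
Local Notation count := (@counting nat R).

Definition cesarod_op (a : nat -> R) (n : nat) : \bar R :=
  (n.+1%:R^-1 * \sum_(k < n.+1) a k)%:E.

(** For a signed sequence whose series oscillates the limit is a default value.
    This does not affect [bounded_on]: an ideal space contains the absolute
    values of its members, so finiteness there gives absolute convergence. *)
Definition copsond_op (a : nat -> R) (n : nat) : \bar R :=
  (\sum_(n <= k <oo) (a k / k.+1%:R)%:E)%E.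

Definition sigma2_op (a : nat -> R) (n : nat) : \bar R := (a n./2)%:E.

Definition sigma_half_op (a : nat -> R) (n : nat) : \bar R :=
  ((a n.*2 + a n.*2.+1) / 2)%:E.

Definition shift_op (a : nat -> R) (n : nat) : \bar R :=
  (if n is k.+1 then a k else 0)%:E.

Definition backshift_op (a : nat -> R) (n : nat) : \bar R := (a n.+1)%:E.

Definition cesarod_space (X : fspace count setT) : fspace count setT :=
  op_space cesarod_op X.
Definition copsond_space (X : fspace count setT) : fspace count setT :=
  op_space copsond_op X.

End sequence_spaces.

(* Main.v *)
Require Import Defs.
From mathcomp Require Import all_boot all_order all_algebra.
From mathcomp Require Import all_classical all_reals all_analysis.
From mathcomp Require Import measurable_realfun ess_sup_inf.
From mathcomp Require Import ring lra zify.
Import Order.TTheory GRing.Theory Num.Theory.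
Import numFieldNormedType.Exports.
(** The theorem is a collection of consequences of a few pointwise
    inequalities between the averages [C] and [C*] of a nonnegative function,
    each obtained by computing an iterated kernel with Tonelli's theorem.

    - [C g <= C (C* g)], because [C* g] has at least as much mass on [[0, x]]
      as [g] ([cav_le_cav_cop]).
    - [C* g <= 4 C* (C g)] up to the part of [g] sitting at points [s] with
      [2 s] outside the interval: on [[s, 2 s]] the kernel [t^-2] is at least
      [1 / (4 s^2)] ([cop_le_cop_cav]).
    - [C g (x)] is at most a constant times [C (C g) (a x)] for [a > 1], and
      [C* g (x)] at most a constant times [C* (C* g) (a x)] for [a < 1],
      because the integral of [g] over [[0, x]] increases and [C* g] decreases
      ([cav_dilate], [cop_dilate]).
    - [C g (t) <= C g (x) + C* g (x)] for [t >= x] ([cav_le_cavD_cop]).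

    In an ideal space a domination by a bounded operator gives an embedding
    ([embeds_op_space]), so the first three inequalities yield all comparisons
    of [X], [CX], [C*X], [CCX] and [C*C*X].  On the half-line the second one has
    no exceptional points.  On [[0, 1]] these points lie in [[1/2, 1]], where
    [1 / s <= 2], and contribute at most twice the [L^1] norm; this is where
    the intersection with [L^1] comes from.  In the other direction [C* |f|]
    controls the [L^1] norm, which is the value of [C |f|] at 1.

    For the Koethe dual of [C*X], one embedding holds because [f~] is
    decreasing, hence below its averages, so that pairing [f~] with [C* g]
    instead of [g] increases the integral ([integral_antitone_copson]).  For
    the other one, let [theta] be a little less than [f~]; every [t] then sees
    to its right a set of positive measure where [|f|] exceeds [theta t].
    Spreading the mass [g t dt] uniformly over that set produces a function
    [u] with [int |f| u >= int theta g].  As mass only moves to the right,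
    [C* u <= C g + C* g], so [u] is in [C*X] with norm controlled by that of
    [g] ([copson_transport], [kothe_truncated]).

    A symmetric space on [[0, 1]] contains the constants, since finitely many
    intervals with the length of a set on which the weight is bounded below
    cover [[0, 1]].  Then the fourth inequality at [t = 1] bounds the [L^1]
    norm, and the same inequality for all [t >= x] bounds the essential tail
    supremum of [C |f|].

    In [L^p], Hardy's inequality gives the boundedness of [C], and
    [t (1 - t)^(-1 - e)] with [e = 1 / (2 p)] separates [C L^p] from [C* L^p]:
    its integral diverges at 1, while its averages only grow like
    [(1 - x)^(-e)].

    For sequences the same inequalities hold with sums.  The comparison of
    [C_d*] with [C_d* C_d] comes from summation by parts, the boundary term
    being absorbed by the terms of the next dyadic block. *)

Set Implicit Arguments.
Unset Strict Implicit.
Unset Printing Implicit Defensive.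
Local Open Scope classical_set_scope.
Local Open Scope ring_scope.

(** * Ideal spaces and embeddings *)
Section ideal_spaces.
Context d (T : measurableType d) (R : realType).
Context (mu : {measure set T -> \bar R}) (D : set T).
Implicit Types (X Y Z : fspace mu D) (F G H : T -> \bar R).
Implicit Types P Q B : (T -> R) -> T -> \bar R.

(** The axioms through which pointwise comparisons act on norms.  For [L^p]
    they amount to Minkowski's inequality and monotonicity of the integral. *)
Record normed_ideal X : Prop := {
  ni_measurable : forall f, X f -> measurable_fun D f ;
  ni_add : forall f g, X f -> X g ->
    X (f \+ g) /\ fnorm X (f \+ g) <= fnorm X f + fnorm X g ;
  ni_scale : forall (c : R) f, X f ->
    X (fun x => c * f x) /\ fnorm X (fun x => c * f x) = `|c| * fnorm X f ;
  ni_ideal : forall f g : T -> R, measurable_fun D f ->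
    (\forall x \ae mu, D x -> `|f x| <= `|g x|) -> X g ->
    X f /\ fnorm X f <= fnorm X g }.

Lemma banach_normed_ideal X : banach_ideal_space X -> normed_ideal X.
Proof. by case=> *; split. Qed.

Lemma space_eqI Y Z : embeds Y Z -> embeds Z Y -> space_eq Y Z.
Proof.
move=> [A A0 YZ] [B B0 ZY]; split=> [f|].
  by split=> [/YZ[]|/ZY[]].
exists B^-1, A; split=> // [|f Yf]; first by rewrite invr_gt0.
have [Zf ->] := YZ _ Yf; have [_ le] := ZY _ Zf.
by rewrite andbT mulrC ler_pdivrMr// mulrC.
Qed.

Lemma embeds_withW (A : R) Y Z : (forall f, Y f -> 0 <= fnorm Y f) ->
  embeds_with A Y Z -> embeds Y Z.
Proof.
move=> Y0 YZ; exists (`|A| + 1) => [|f Yf]; first by rewrite ltr_wpDl.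
have [Zf le] := YZ _ Yf; split=> //; apply: le_trans le _.
by rewrite ler_wpM2r ?Y0// (le_trans (ler_norm A))// lerDl.
Qed.

Section normed_ideal_theory.
Variables (X : fspace mu D) (nX : normed_ideal X).

Let ae0 (f : T -> R) : \forall x \ae mu, D x -> `|0 * f x| <= `|f x|.
Proof. by apply: nearW => x _; rewrite mul0r normr0. Qed.

Lemma fnorm_ge0 f : X f -> 0 <= fnorm X f.
Proof.
move=> Xf; have [X0 eq0] := ni_scale nX 0 Xf.
have [_] := ni_ideal nX (ni_measurable nX X0) (ae0 f) Xf.
by rewrite eq0 normr0 mul0r.
Qed.

Lemma mem_abs f : X f -> X (fun x => `|f x|) /\
  fnorm X (fun x => `|f x|) = fnorm X f.
Proof.
move=> Xf; have mf := ni_measurable nX Xf.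
have mnf : measurable_fun D (fun x => `|f x|) by exact: measurableT_comp.
have [Xnf le1] : X (fun x => `|f x|) /\ fnorm X (fun x => `|f x|) <= fnorm X f.
  by apply: ni_ideal => //; apply: nearW => x _; rewrite normr_id.
split=> //; apply/eqP; rewrite eq_le le1/=.
by apply: (proj2 (ni_ideal nX mf _ Xnf)); apply: nearW => x _; rewrite normr_id.
Qed.

(** Domination also yields finiteness almost everywhere, which is how [emem]
    is established for values of an operator. *)
Lemma emem_dom F h : measurable_fun D F -> X h ->
  (\forall x \ae mu, D x -> (0 <= F x <= (h x)%:E)%E) ->
  emem X F /\ fnorm X (fine \o F) <= fnorm X h.
Proof.
move=> mF Xh Fh; have finF : \forall x \ae mu, D x -> F x \is a fin_num.
  apply: filterS Fh => x Fx /Fx/andP[F0 Fle].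
  by rewrite ge0_fin_numE// (le_lt_trans Fle) ?ltry.
suff [] : X (fine \o F) /\ fnorm X (fine \o F) <= fnorm X h by [].
apply: ni_ideal => //; first exact: measurableT_comp.
apply: filterS2 Fh finF => x Fx fx Dx; have /andP[F0 Fle] := Fx Dx.
rewrite /= ger0_norm ?fine_ge0//; apply: le_trans (ler_norm _).
by rewrite -lee_fin fineK// fx.
Qed.

Lemma emem_domZ F G (K : R) : 0 <= K -> measurable_fun D F -> emem X G ->
  (\forall x \ae mu, D x -> (0 <= F x <= K%:E * G x)%E) ->
  emem X F /\ fnorm X (fine \o F) <= K * fnorm X (fine \o G).
Proof.
move=> K0 mF [finG XG] FG; have [XKG <-] : X (fun x => K * (fine \o G) x) /\
    fnorm X (fun x => K * (fine \o G) x) = K * fnorm X (fine \o G).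
  by have := ni_scale nX K XG; rewrite ger0_norm.
apply: emem_dom => //; apply: filterS2 FG finG => x FGx fGx Dx.
by rewrite EFinM /= fineK ?FGx ?fGx.
Qed.

Lemma emem_domD F G H : measurable_fun D F -> emem X G -> emem X H ->
  (\forall x \ae mu, D x -> (0 <= F x <= G x + H x)%E) ->
  emem X F /\ fnorm X (fine \o F) <= fnorm X (fine \o G) + fnorm X (fine \o H).
Proof.
move=> mF [finG XG] [finH XH] FGH; have [XGH le] := ni_add nX XG XH.
have [|eF leF] := emem_dom mF XGH; last by split=> //; exact: le_trans leF le.
apply: filterS3 FGH finG finH => x Fx fG fH Dx.
by rewrite EFinD /= !fineK ?Fx ?fG ?fH.
Qed.

(** Boundedness on nonnegative functions, those to which the operator spaces
    apply an operator. *)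
Definition nonneg_bound (A : R) X P : Prop := forall f, (forall x, 0 <= f x) ->
  X f -> emem X (P f) /\ fnorm X (fine \o P f) <= A * fnorm X f.

Lemma bounded_nonneg P : bounded_on X P -> exists2 A, 0 < A & nonneg_bound A X P.
Proof.
move=> [A bP]; exists (`|A| + 1) => [|f f0 Xf]; first by rewrite ltr_wpDl.
have [eP le] := bP _ Xf; split=> //; apply: le_trans le _.
by rewrite ler_wpM2r ?fnorm_ge0// (le_trans (ler_norm A))// lerDl.
Qed.

Lemma emem_bounded P (A : R) G : nonneg_bound A X P -> emem X G ->
  emem X (P (fun x => `|fine (G x)|)) /\
  fnorm X (fine \o P (fun x => `|fine (G x)|)) <= A * fnorm X (fine \o G).
Proof. by move=> bP [_ /mem_abs[/bP[//|? le] eq]]; rewrite -eq. Qed.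

Lemma bounded_embeds P (A : R) : nonneg_bound A X P ->
  embeds_with A X (op_space P X).
Proof.
move=> bP f Xf; have [Xnf <-] := mem_abs Xf; have [//|e le] := bP _ _ Xnf.
by split=> //; split=> //; exact: ni_measurable Xf.
Qed.

(** Turns a pointwise inequality into an embedding: [G f] carries the norm of
    [f] in [Y], and [Q |f|] is dominated by the bounded operator [B] applied
    to it. *)
Lemma embeds_op_space Y (G : (T -> R) -> T -> \bar R) Q B (K A : R) :
  0 <= K -> nonneg_bound A X B ->
  (forall f, Y f -> emem X (G f) /\ fnorm X (fine \o G f) = fnorm Y f) ->
  (forall f, Y f -> [/\ measurable_fun D f,
    measurable_fun D (Q (fun x => `|f x|)) &
    \forall x \ae mu, D x -> (0 <= Q (fun x => `|f x|%R) x <=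
       K%:E * B (fun y => `|fine (G f y)|%R) x)%E]) ->
  embeds_with (K * A) Y (op_space Q X).
Proof.
move=> K0 bB YG YQ f Yf; have [mf mQ le] := YQ _ Yf; have [eG <-] := YG _ Yf.
have [eB leB] := emem_bounded bB eG.
have [eQ leQ] := emem_domZ K0 mQ eB le.
by split; [split|rewrite (le_trans leQ)// -mulrA ler_wpM2l].
Qed.

Lemma op_space_embeds_iter P (A : R) : nonneg_bound A X P ->
  embeds_with A (op_space P X) (op_space P (op_space P X)).
Proof.
move=> bP f [mf eP]; have [e le] := emem_bounded bP eP.
have [finP XP] := eP.
by split=> //; split=> //; split=> //; split=> //; exact: ni_measurable XP.
Qed.

(** The supremum defining [opnorm] is only over the unit ball, so homogeneity is
    what extends the bound to all functions. *)
Lemma opnorm_bound P :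
  (forall (c : R) (f : T -> R), 0 < c -> (forall x, 0 <= f x) -> X f ->
     forall x, D x -> P (fun y => c * f y) x = (c%:E * P f x)%E) ->
  bounded_on X P -> nonneg_bound (opnorm X P) X P.
Proof.
move=> PZ [A bP] f f0 Xf; have [eP leP] := bP _ Xf; split=> //.
have nf0 := fnorm_ge0 Xf.
(* A function of norm 0 cannot be normalized; its image has norm 0 as well. *)
have [nf|nf] := eqVneq (fnorm X f) 0.
  by move: leP; rewrite nf !mulr0.
have {}nf0 : 0 < fnorm X f by rewrite lt0r nf.
set c := (fnorm X f)^-1; have c0 : 0 < c by rewrite invr_gt0.
have [Xcf ncf] := ni_scale nX c Xf.
have ncf1 : fnorm X (fun x => c * f x) = 1.
  by rewrite ncf gtr0_norm// mulVf// gt_eqF.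
have [[finPc XPc] _] := bP _ Xcf.
have le : c * fnorm X (fine \o P f) <= fnorm X (fine \o P (fun x => c * f x)).
  case: eP => [finP XP]; have := ni_scale nX c XP.
  rewrite gtr0_norm// => -[Xc <-].
  apply: (proj2 (ni_ideal nX (ni_measurable nX Xc) _ XPc)).
  apply: filterS finP => x fP Dx /=; rewrite PZ//.
  by rewrite -[P f x]fineK ?fP.
rewrite -ler_pdivrMr// mulrC -/c (le_trans le)//; apply: ub_le_sup; last first.
  by exists (fun x => c * f x) => //; split=> //; rewrite ncf1.
exists `|A| => _ [g [Xg ng] <-]; have [_ leg] := bP _ Xg.
rewrite (le_trans leg)// (le_trans (ler_wpM2r _ (ler_norm A))) ?fnorm_ge0//.
by rewrite -[leRHS]mulr1 ler_wpM2l.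
Qed.

End normed_ideal_theory.
End ideal_spaces.

(** * Integral kernels on the line *)
Section tonelli.
Context (R : realType).
Local Notation leb := (@lebesgue_measure R).
Local Notation RT := (measurableTypeR R).
Implicit Types (b : R -> R -> bool) (h : R -> R -> \bar R) (g : R -> \bar R).

Local Open Scope ereal_scope.

Lemma measurable_kernel b h :
  measurable_fun [set: RT * RT] (fun p => b p.1 p.2) ->
  measurable_fun [set: RT * RT] (fun p => h p.1 p.2) ->
  measurable_fun [set: RT * RT] (fun p => if b p.1 p.2 then h p.1 p.2 else 0).
Proof. by move=> mb mh; exact: measurable_fun_ifT. Qed.

Lemma measurable_kernel_col b h y :
  measurable_fun [set: RT * RT] (fun p => b p.1 p.2) ->
  measurable_fun [set: RT * RT] (fun p => h p.1 p.2) ->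
  measurable_fun [set: RT] (fun x => if b x y then h x y else 0).
Proof.
move=> mb mh; have H := measurable_kernel mb mh.
exact: (measurableT_comp H (@pair2_measurable _ _ RT RT y)).
Qed.

Lemma measurable_kernel_row b h x :
  measurable_fun [set: RT * RT] (fun p => b p.1 p.2) ->
  measurable_fun [set: RT * RT] (fun p => h p.1 p.2) ->
  measurable_fun [set: RT] (fun y => if b x y then h x y else 0).
Proof.
move=> mb mh; have H := measurable_kernel mb mh.
exact: (measurableT_comp H (@pair1_measurable _ _ RT RT x)).
Qed.

Lemma measurable_int_kernel b h :
  measurable_fun [set: RT * RT] (fun p => b p.1 p.2) ->
  measurable_fun [set: RT * RT] (fun p => h p.1 p.2) ->
  (forall x y, 0 <= h x y) ->
  measurable_fun [set: RT] (fun x => \int[leb]_y (if b x y then h x y else 0)).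
Proof.
move=> mb mh h0.
apply: (@measurable_fun_fubini_tonelli_F _ _ RT RT R leb
  (fun p => if b p.1 p.2 then h p.1 p.2 else 0)).
  exact: measurable_kernel.
by move=> [x y] /=; case: ifP.
Qed.

Lemma tonelli_kernel b h :
  measurable_fun [set: RT * RT] (fun p => b p.1 p.2) ->
  measurable_fun [set: RT * RT] (fun p => h p.1 p.2) ->
  (forall x y, 0 <= h x y) ->
  \int[leb]_x \int[leb]_y (if b x y then h x y else 0) =
  \int[leb]_y \int[leb]_x (if b x y then h x y else 0).
Proof.
move=> mb mh h0.
apply: (@fubini_tonelli _ _ RT RT R leb leb
  (fun p => if b p.1 p.2 then h p.1 p.2 else 0)).
  exact: measurable_kernel.
by move=> [x y] /=; case: ifP.
Qed.

Lemma measurable_mem (A : set R) : measurable (A : set RT) ->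
  measurable_fun [set: RT] (fun t => t \in A).
Proof.
move=> mA; apply: (@measurable_fun_bool _ _ _ _ true).
rewrite [X in measurable X](_ : _ = A); first exact: mA.
apply/seteqP; split=> t /=; first by move=> [_ /set_mem].
by move=> At; split=> //; exact: mem_set.
Qed.

Lemma integral_if g (A : set R) :
  \int[leb]_(x in A) g x = \int[leb]_x (if x \in A then g x else 0).
Proof. by rewrite integral_mkcond. Qed.

Lemma ae_neq (a : R) : \forall x \ae leb, x != a.
Proof.
exists [set a]; split; [exact: measurable_set1|exact: lebesgue_measure_set1|].
by move=> x /= /negP; rewrite negbK => /eqP.
Qed.

Lemma ae_imp (P Q : R -> Prop) : (forall x, P x -> Q x) ->
  (\forall x \ae leb, P x) -> \forall x \ae leb, Q x.
Proof. exact: (@filterS _ _ (ae_filter_ringOfSetsType leb)). Qed.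

Lemma ae_imp2 (P Q S : R -> Prop) : (forall x, P x -> Q x -> S x) ->
  (\forall x \ae leb, P x) -> (\forall x \ae leb, Q x) -> \forall x \ae leb, S x.
Proof. exact: (@filterS2 _ _ (ae_filter_ringOfSetsType leb)). Qed.

Lemma ae_imp3 (P Q S U : R -> Prop) : (forall x, P x -> Q x -> S x -> U x) ->
  (\forall x \ae leb, P x) -> (\forall x \ae leb, Q x) ->
  (\forall x \ae leb, S x) -> \forall x \ae leb, U x.
Proof. exact: (@filterS3 _ _ (ae_filter_ringOfSetsType leb)). Qed.

Lemma integral_cst_itv (a c : R) (k : \bar R) : (a <= c)%R ->
  \int[leb]_(t in `[a, c]) k = k * (c - a)%:E.
Proof.
move=> ac; have := @integral_cst _ RT R leb `[a, c] (measurable_itv _) k.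
move=> ->; congr (_ * _); rewrite [LHS](@lebesgue_measure_itv R `[a, c])/= lte_fin.
by case: ltgtP ac => // -> _; rewrite subrr.
Qed.

Lemma ae_exists (P : R -> Prop) (a c : R) : (a < c)%R ->
  (\forall x \ae leb, P x) -> exists2 x, (a < x < c)%R & P x.
Proof.
move=> ac [N [mN N0 sub]]; apply: contrapT => nex.
suff : leb `]a, c[%classic <= leb N.
  rewrite N0 [X in X <= _](@lebesgue_measure_itv R `]a, c[)/= lte_fin ac.
  by rewrite -EFinB lee_fin leNgt subr_gt0 ac.
apply: le_measure; rewrite ?inE//.
move=> x /=; rewrite in_itv/= => xac; apply: sub => Px; apply: nex.
by exists x.
Qed.
End tonelli.

(** * Pointwise inequalities between the averages *)
Section cesaro_copson.
Context (R : realType).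
Local Notation leb := (@lebesgue_measure R).
Local Notation RT := (measurableTypeR R).

Lemma measurable_inv : measurable_fun [set: RT] (fun x : R => x^-1).
Proof.
have -> : (fun x : R => x^-1) = (fun x => if x == 0 then 0 else x^-1).
  by apply/funext => x; case: eqP => [->|//]; rewrite invr0.
apply: measurable_fun_if => //.
  exact: measurable_fun_eqr.
rewrite setTI; apply: (@open_continuous_measurable_fun R [set x : R | (x == 0) = false]).
  rewrite [X in open X](_ : _ = ~` [set 0]); last first.
    by apply/seteqP; split=> x /=; [move=> /eqP | move=> /eqP /negPf].
  by rewrite openC; exact/accessible_closed_set1/hausdorff_accessible/Rhausdorff.
by move=> x; rewrite inE /= => /negbT x0; apply: inv_continuous.
Qed.

Variable D : set R.
Hypothesis mD : measurable D.
Hypothesis D_ge0 : forall x, D x -> 0 <= x.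
Hypothesis D_down : forall x y, D y -> 0 <= x -> x <= y -> D x.
Implicit Types (g : R -> \bar R) (x y t s : R).

Local Open Scope ereal_scope.

(** [cav] and [cop] are [C] and [C*] on extended real-valued functions, so that
    they can be iterated before anything is known to be finite. *)
Definition cav g x := (x^-1)%:E * \int[leb]_(t in `[0%R, x]) g t.

Definition cop g x := \int[leb]_(t in D `&` `[x, +oo[) (g t * (t^-1)%:E).

Lemma itv_subD x : D x -> `[0%R, x]%classic `<=` D.
Proof. by move=> Dx t /=; rewrite in_itv/= => /andP[t0 tx]; exact: D_down Dx _ _. Qed.

Section nonneg.
Variable g : R -> \bar R.
Hypothesis mg : measurable_fun (D : set RT) g.
Hypothesis g0 : forall x, D x -> 0 <= g x.

Let g' := g \_ D.

Let mg' : measurable_fun [set: RT] g'.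
Proof. exact/(measurable_restrictT _ _).1. Qed.

Let g'0 x : 0 <= g' x.
Proof. by rewrite /g' patchE; case: ifPn => // /set_mem/g0. Qed.

Lemma measurable_ordb (a b : RT * RT -> R) :
  measurable_fun setT a -> measurable_fun setT b ->
  measurable_fun [set: RT * RT] (fun p => (a p <= b p)%R).
Proof. exact: measurable_fun_ler. Qed.

Let msnd : measurable_fun [set: RT * RT] (fun p => g' p.2).
Proof. exact: (measurableT_comp mg' (@measurable_snd _ _ RT RT)). Qed.

Let msndV : measurable_fun [set: RT * RT] (fun p => g' p.2 * (p.2^-1)%:E).
Proof.
apply: emeasurable_funM => //; apply/measurable_EFinP.
exact: (measurableT_comp measurable_inv (@measurable_snd _ _ RT RT)).
Qed.

Let g'V0 t : 0 <= g' t * (t^-1)%:E.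
Proof.
rewrite /g' patchE; case: ifPn => [/set_mem Dt|]; last by rewrite mul0e.
by rewrite mule_ge0 ?g0// lee_fin invr_ge0 D_ge0.
Qed.

Lemma int_head x : D x ->
  \int[leb]_(t in `[0%R, x]) g t = \int[leb]_t (if (t <= x)%R then g' t else 0).
Proof.
move=> Dx; rewrite integral_if; apply: eq_integral => t _.
rewrite /g' patchE mem_setE in_itv/=.
have [Dt|nDt] := boolP (t \in D); first by rewrite (D_ge0 (set_mem Dt)).
by case: andP => [[t0 tx]|]; [move: nDt; rewrite (mem_set (D_down Dx t0 tx))|case: ifP].
Qed.

Lemma copE x :
  cop g x = \int[leb]_t (if (x <= t)%R then g' t * (t^-1)%:E else 0).
Proof.
rewrite /cop integral_if; apply: eq_integral => t _.
rewrite /g' patchE in_setI.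
have -> : (t \in `[x, +oo[%classic) = (x <= t)%R.
  by apply/idP/idP; rewrite inE/= in_itv/= andbT.
by case: (t \in D) => //=; rewrite mul0e if_same.
Qed.

Lemma cav_ge0 x : D x -> 0 <= cav g x.
Proof.
move=> Dx; rewrite mule_ge0 ?lee_fin ?invr_ge0 ?D_ge0//.
by apply: integral_ge0 => t /(itv_subD Dx)/g0.
Qed.

Lemma cop_ge0 x : 0 <= cop g x.
Proof.
by apply: integral_ge0 => t [Dt _]; rewrite mule_ge0 ?g0// lee_fin invr_ge0 D_ge0.
Qed.

Lemma measurable_int_head :
  measurable_fun (D : set RT) (fun x => \int[leb]_(t in `[0%R, x]) g t).
Proof.
apply: (eq_measurable_fun (fun x => \int[leb]_t (if (t <= x)%R then g' t else 0))).
  by move=> x /set_mem Dx; rewrite int_head.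
apply: measurable_funTS.
apply: (measurable_int_kernel (b := fun x t => (t <= x)%R) (h := fun x t => g' t)) => //.
exact: measurable_ordb.
Qed.

Lemma measurable_cav : measurable_fun (D : set RT) (cav g).
Proof.
apply: emeasurable_funM => //; last exact: measurable_int_head.
by apply/measurable_EFinP; apply: measurable_funTS measurable_inv.
Qed.

Lemma measurable_cop (E : set R) : measurable E -> measurable_fun (E : set RT) (cop g).
Proof.
move=> mE; rewrite (funext copE); apply: measurable_funTS.
apply: (measurable_int_kernel (b := fun x t => (x <= t)%R)
   (h := fun x t => g' t * (t^-1)%:E)) => //.
exact: measurable_ordb.
Qed.

(** By Tonelli, the integral of [cop g] over [[0, x]] weights [g s / s] by the
    length of [[0, min s x]], which is [s] when [s <= x]. *)
Lemma cav_le_cav_cop x : D x -> cav g x <= cav (cop g) x.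
Proof.
move=> Dx; rewrite lee_wpmul2l ?lee_fin ?invr_ge0 ?D_ge0//.
rewrite int_head//.
have -> : \int[leb]_(t in `[0%R, x]) cop g t =
   \int[leb]_t \int[leb]_s (if (0 <= t <= x)%R && (t <= s)%R
                           then g' s * (s^-1)%:E else 0).
  rewrite integral_if; apply: eq_integral => t _; rewrite mem_setE in_itv/=.
  by case: ifP => tx; rewrite ?copE//= integral0.
rewrite (tonelli_kernel (b := fun t s => (0 <= t <= x)%R && (t <= s)%R)
  (h := fun t s => g' s * (s^-1)%:E))//; last first.
  by apply: measurable_and; [apply: measurable_and|]; exact: measurable_ordb.
apply: ae_ge0_le_integral => //.
- by move=> t _; case: ifP.
- by apply: measurable_fun_ifT => //; exact: measurable_fun_ler.
- by move=> s _; apply: integral_ge0 => t _; case: ifP.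
- apply: (measurable_int_kernel (b := fun s t => (0 <= t <= x)%R && (t <= s)%R)
    (h := fun s t => g' s * (s^-1)%:E)) => //.
    by apply: measurable_and; [apply: measurable_and|]; exact: measurable_ordb.
  apply: emeasurable_funM.
    exact: (measurableT_comp mg' (@measurable_fst _ _ RT RT)).
  apply/measurable_EFinP.
  exact: (measurableT_comp measurable_inv (@measurable_fst _ _ RT RT)).
apply: (ae_imp _ (ae_neq 0%R)) => s s0 _; case: ifPn => sx; last first.
  by apply: integral_ge0 => t _; case: ifP.
rewrite /g' patchE; case: ifPn => [/set_mem Ds|_]; last first.
  by apply: integral_ge0 => t _; case: ifP => //; rewrite mul0e.
have {}s0 : (0 < s)%R by rewrite lt0r s0 D_ge0.
rewrite [leRHS](_ : _ = \int[leb]_(t in `[0%R, s]) cst (g s * (s^-1)%:E) t).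
  rewrite integral_cst_itv ?(ltW s0)// subr0.
  by rewrite -muleA -EFinM mulVf ?gt_eqF// mule1.
rewrite [RHS]integral_if; apply: eq_integral => t _; rewrite mem_setE in_itv/=.
by case: (leP t s) => ts; rewrite ?andbF ?andbT// (le_trans ts sx) andbT.
Qed.

Lemma cop_anti x t : (t <= x)%R -> cop g x <= cop g t.
Proof.
move=> tx; rewrite !copE; apply: ge0_le_integral => //.
- by move=> s _; case: ifP.
- by apply: measurable_fun_ifT => //; [exact: measurable_fun_ler|];
    exact: emeasurable_funM mg' ((measurable_EFinP _ _).2 measurable_inv).
- by apply: measurable_fun_ifT => //; [exact: measurable_fun_ler|];
    exact: emeasurable_funM mg' ((measurable_EFinP _ _).2 measurable_inv).
- by move=> s _; case: ifPn => [xs|_]; [rewrite (le_trans tx xs)|case: ifP].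
Qed.

Lemma int_head_le x y : D y -> (x <= y)%R ->
  \int[leb]_(t in `[0%R, x]) g t <= \int[leb]_(t in `[0%R, y]) g t.
Proof.
move=> Dy xy; apply: ge0_subset_integral => //.
- exact: measurable_funS mD (itv_subD Dy) mg.
- by move=> t /(itv_subD Dy)/g0.
- by move=> t /=; rewrite !in_itv/= => /andP[-> tx]; rewrite (le_trans tx xy).
Qed.

Lemma int_head_ge0 x : D x -> 0 <= \int[leb]_(t in `[0%R, x]) g t.
Proof. by move=> Dx; apply: integral_ge0 => t /(itv_subD Dx)/g0. Qed.

Lemma cav_lty x y : D y -> (0 <= x <= y)%R -> cav g y < +oo -> cav g x < +oo.
Proof.
move=> Dy /andP[x0 xy]; rewrite /cav.
have [->|xn0] := eqVneq x 0%R; first by rewrite invr0 mul0e.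
have {}x0 : (0 < x)%R by rewrite lt0r xn0.
have y0 : (0 < y)%R := lt_le_trans x0 xy.
move=> yfin; have : \int[leb]_(t in `[0%R, y]) g t < +oo.
  rewrite ltey; apply: contraTneq yfin => ->.
  by rewrite gt0_muley ?ltxx// lte_fin invr_gt0.
move/(le_lt_trans (int_head_le Dy xy)) => xfin.
by rewrite lte_mul_pinfty// lee_fin invr_ge0 ltW.
Qed.

(** On [[x, a x]] the average [cav g t] is at least [1 / (a x)] times the
    integral [I] of [g] over [[0, x]]; averaging over [[0, a x]] this bound,
    valid on a subset of length [(a - 1) x], gives
    [(a - 1) x I / (a x)^2 = (a - 1) / a^2 * (I / x)]. *)
Lemma cav_dilate (a : R) x : (1 < a)%R -> D (a * x)%R -> (0 < x)%R ->
  ((a - 1) / a ^+ 2)%:E * cav g x <= cav (cav g) (a * x).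
Proof.
move=> a1 Dax x0; have a0 : (0 < a)%R := lt_trans ltr01 a1.
have ax0 : (0 < a * x)%R by rewrite mulr_gt0.
have xax : (x <= a * x)%R by rewrite ler_peMl// ltW.
have Dx : D x by apply: D_down Dax _ xax; exact: ltW.
set I := \int[leb]_(t in `[0%R, x]) g t.
rewrite [leLHS](_ : _ = ((a * x)^-1)%:E *
    \int[leb]_(t in `[x, (a * x)%R]) cst (((a * x)^-1)%:E * I) t); last first.
  rewrite integral_cst_itv// /cav -/I (muleC _ (a * x - x)%:E) !muleA -!EFinM.
  by congr (_%:E * _); field; rewrite !gt_eqF.
rewrite lee_wpmul2l ?lee_fin ?invr_ge0 ?(ltW ax0)//.
have sub : `[x, (a * x)%R]%classic `<=` `[0%R, (a * x)%R]%classic.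
  by move=> t /=; rewrite !in_itv/= => /andP[xt ->]; rewrite (le_trans (ltW x0) xt).
have mcav : measurable_fun (`[0%R, (a * x)%R]%classic : set RT) (cav g).
  exact: measurable_funS mD (itv_subD Dax) measurable_cav.
apply: (@le_trans _ _ (\int[leb]_(t in `[x, (a * x)%R]) cav g t)); last first.
  by apply: ge0_subset_integral => // t /(itv_subD Dax); exact: cav_ge0.
apply: ge0_le_integral => //.
- by move=> t _; rewrite mule_ge0 ?lee_fin ?invr_ge0 ?(ltW ax0)// int_head_ge0.
- exact: measurable_funS sub mcav.
move=> t /= xt; have Dt := itv_subD Dax (sub _ xt).
move: xt; rewrite in_itv/= => /andP[xt tax].
apply: lee_pmul; rewrite ?int_head_ge0 ?lee_fin ?invr_ge0 ?(ltW ax0)//.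
  by rewrite lef_pV2// posrE (lt_le_trans x0).
exact: int_head_le.
Qed.

(** On [[a x, x]], of length [(1 - a) x], both [cop g t] and [1 / t] are at least
    their values at [x]. *)
Lemma cop_dilate (a : R) x : (0 < a < 1)%R -> D x -> (0 < x)%R ->
  (1 - a)%:E * cop g x <= cop (cop g) (a * x).
Proof.
move=> /andP[a0 a1] Dx x0; have axx : (a * x <= x)%R by rewrite ger_pMl// ltW.
have ax0 : (0 < a * x)%R by rewrite mulr_gt0.
have sub : `[(a * x)%R, x]%classic `<=` D `&` `[(a * x)%R, +oo[%classic.
  move=> t /=; rewrite in_itv/= => /andP[axt tx].
  by rewrite in_itv/= axt; split=> //; apply: D_down Dx _ tx; rewrite (le_trans (ltW ax0)).
have mDI : measurable (D `&` `[(a * x)%R, +oo[) by exact: measurableI.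
have mcop : measurable_fun (D `&` `[(a * x)%R, +oo[ : set RT)
    (fun t => cop g t * (t^-1)%:E).
  apply: emeasurable_funM; first exact: measurable_cop.
  by apply/measurable_EFinP; apply: measurable_funTS measurable_inv.
have c0 t : (D `&` `[(a * x)%R, +oo[) t -> 0 <= cop g t * (t^-1)%:E.
  by move=> [Dt _]; rewrite mule_ge0 ?cop_ge0// lee_fin invr_ge0 D_ge0.
apply: (@le_trans _ _ (\int[leb]_(t in `[(a * x)%R, x]) (cop g t * (t^-1)%:E)));
  last exact: ge0_subset_integral.
rewrite [leLHS](_ : _ =
    \int[leb]_(t in `[(a * x)%R, x]) cst (cop g x * (x^-1)%:E) t); last first.
  rewrite integral_cst_itv// muleC -muleA -EFinM; congr (_ * _%:E).
  by field; rewrite gt_eqF.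
apply: ge0_le_integral => //.
- by move=> t _; rewrite mule_ge0 ?cop_ge0// lee_fin invr_ge0 ltW.
- exact: measurable_funS sub mcop.
move=> t /=; rewrite in_itv/= => /andP[axt tx].
have t0 := lt_le_trans ax0 axt.
by apply: lee_pmul; rewrite ?cop_ge0 ?cop_anti// lee_fin ?invr_ge0 ?(ltW x0)// lef_pV2.
Qed.

(** In the average over [[0, t]], the mass at [s <= x] has weight
    [1 / t <= 1 / x] and the mass at [s] in [[x, t]] has weight
    [1 / t <= 1 / s]. *)
Lemma cav_le_cavD_cop x t : D t -> (0 < x <= t)%R -> cav g t <= cav g x + cop g x.
Proof.
move=> Dt /andP[x0 xt]; have Dx : D x by apply: D_down Dt _ xt; exact: ltW.
have t0 : (0 < t)%R := lt_le_trans x0 xt.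
have mle y : measurable_fun [set: RT] (fun s => if (s <= y)%R then g' s else 0).
  by apply: measurable_fun_ifT => //; exact: measurable_fun_ler.
have mge : measurable_fun [set: RT]
    (fun s => if (x <= s)%R then g' s * (s^-1)%:E else 0).
  by apply: measurable_fun_ifT => //; [exact: measurable_fun_ler|];
    exact: emeasurable_funM mg' ((measurable_EFinP _ _).2 measurable_inv).
rewrite /cav !int_head// copE.
have Z y c : (0 <= c)%R -> c%:E * \int[leb]_s (if (s <= y)%R then g' s else 0) =
    \int[leb]_s (c%:E * (if (s <= y)%R then g' s else 0)).
  move=> c0; apply/esym/ge0_integralZl => //; try by move=> s _; case: ifP.
rewrite !Z ?invr_ge0 ?(ltW t0) ?(ltW x0)//.
have mZ y c : measurable_fun [set: RT]
    (fun s => c%:E * (if (s <= y)%R then g' s else 0)).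
  exact: measurable_funeM.
have Z0 y c s : (0 <= c)%R -> 0 <= c%:E * (if (s <= y)%R then g' s else 0).
  by move=> c0; rewrite mule_ge0//; case: ifP.
rewrite -(@ge0_integralD _ RT R leb setT measurableT _ _)//; last 2 first.
- by move=> s _; rewrite Z0 ?invr_ge0 ?(ltW x0).
- by move=> s _; case: ifP.
apply: ge0_le_integral => //.
- by move=> s _; rewrite mule_ge0 ?lee_fin ?invr_ge0 ?(ltW t0)//; case: ifP.
- exact: emeasurable_funD.
move=> s _; have [sx|xs] := leP s x.
  rewrite (le_trans sx xt) -[leLHS]adde0; apply: leeD; last by case: ifP.
  by rewrite lee_wpmul2r// lee_fin lef_pV2.
rewrite (ltW xs) mule0 add0e; case: ifPn => [st|_]; last by rewrite mule0.
by rewrite muleC lee_wpmul2l// lee_fin lef_pV2// posrE (lt_trans x0).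
Qed.

(** By Tonelli, [cop (cav g) x] weights [g s], for [s >= x], by the integral of
    [t^-2] over the [t >= s] in [D].  If [2 s] is in [D], the part
    [[s, 2 s]] contributes at least [s / (2 s)^2 = 1 / (4 s)]; the remaining [s],
    near the right end of [D], make up the last integral. *)
Lemma cop_le_cop_cav x : cop g x <= 4%:E * cop (cav g) x +
  \int[leb]_s (if (x <= s)%R && ((2 * s)%R \notin D) then g' s * (s^-1)%:E else 0).
Proof.
pose b t s := [&& (x <= t)%R, (s <= t)%R & t \in D].
pose h t s := g' s * (t^-1 ^+ 2)%:E.
have mDb := measurable_mem mD.
have mb : measurable_fun [set: RT * RT] (fun p => b p.1 p.2).
  apply: measurable_and; first exact: measurable_ordb.
  apply: measurable_and; first exact: measurable_ordb.
  exact: (measurableT_comp mDb (@measurable_fst _ _ RT RT)).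
have mh : measurable_fun [set: RT * RT] (fun p => h p.1 p.2).
  apply: emeasurable_funM => //; apply/measurable_EFinP; apply: measurable_funX.
  exact: (measurableT_comp measurable_inv (@measurable_fst _ _ RT RT)).
have h0 t s : 0 <= h t s by rewrite mule_ge0// lee_fin sqr_ge0.
have E : cop (cav g) x = \int[leb]_s \int[leb]_t (if b t s then h t s else 0).
  rewrite -(tonelli_kernel mb mh h0) /cop integral_if.
  apply: eq_integral => t _; rewrite in_setI.
  have -> : (t \in `[x, +oo[%classic) = (x <= t)%R.
    by apply/idP/idP; rewrite inE/= in_itv/= andbT.
  rewrite andbC /b; case: (leP x t) => //= xt; last by rewrite integral0.
  have [/set_mem Dt|_] := boolP (t \in D); last first.
    by under eq_integral do rewrite andbF; rewrite integral0.
  rewrite /cav int_head// muleAC -EFinM -expr2 -ge0_integralZl//; last 3 first.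
  - by apply: measurable_fun_ifT => //; exact: measurable_fun_ler.
  - by move=> s _; case: ifP.
  - by rewrite lee_fin sqr_ge0.
  apply: eq_integral => s _; rewrite andbT; case: ifP => _; last by rewrite mule0.
  by rewrite muleC.
have mC c : measurable_fun [set: RT] c ->
    measurable_fun [set: RT] (fun s => if c s && (x <= s)%R then g' s * (s^-1)%:E else 0).
  move=> mc; apply: measurable_fun_ifT => //.
    by apply: measurable_and => //; exact: measurable_fun_ler.
  exact: emeasurable_funM mg' ((measurable_EFinP _ _).2 measurable_inv).
have m2 : measurable_fun [set: RT] (fun s => (2 * s)%R \in D).
  apply: (measurableT_comp mDb).
  exact: measurable_funM.
pose far s := if ((2 * s)%R \notin D) && (x <= s)%R then g' s * (s^-1)%:E else 0.
pose near s := if ((2 * s)%R \in D) && (x <= s)%R then g' s * (s^-1)%:E else 0.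
have -> : \int[leb]_s (if (x <= s)%R && ((2 * s)%R \notin D)
                       then g' s * (s^-1)%:E else 0) = \int[leb]_s far s.
  by apply: eq_integral => s _; rewrite andbC.
have near0 s : 0 <= near s by rewrite /near; case: ifP.
have far0 s : 0 <= far s by rewrite /far; case: ifP.
have mnear : measurable_fun [set: RT] near by exact: mC.
have mfar : measurable_fun [set: RT] far by apply: mC; exact: measurable_neg.
have -> : cop g x = \int[leb]_s near s + \int[leb]_s far s.
  rewrite copE -(@ge0_integralD _ RT R leb setT)//.
  apply: eq_integral => s _; rewrite /near /far.
  by case: (_ \in D) => /=; rewrite ?adde0 ?add0e.
pose F s := \int[leb]_t (if b t s then h t s else 0).
have mF : measurable_fun [set: RT] F.
  apply: (measurable_int_kernel (b := fun s t => b t s) (h := fun s t => h t s)) => //.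
    exact: (measurableT_comp mb (@measurable_swap _ _ RT RT)).
  exact: (measurableT_comp mh (@measurable_swap _ _ RT RT)).
have mFs s : measurable_fun [set: RT] (fun t => if b t s then h t s else 0).
  exact: measurable_kernel_col.
have F0 s : 0 <= F s by apply: integral_ge0 => t _; case: ifP.
rewrite leeD2r// E -/F.
have -> : 4%:E * \int[leb]_s F s = \int[leb]_s (4%:E * F s).
  by apply/esym/ge0_integralZl.
apply: ae_ge0_le_integral => //.
- by move=> s _; rewrite mule_ge0.
- exact: measurable_funeM.
apply: (ae_imp _ (ae_neq 0%R)) => s s0 _.
rewrite /near; case: ifPn => [/andP[/set_mem D2s xs]|_]; last by rewrite mule_ge0.
have {}s0 : (0 < s)%R.
  by rewrite lt0r s0/= -(@pmulr_rge0 _ 2)// D_ge0.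
have s2s : (s <= 2 * s)%R by rewrite ler_peMl ?ltW// ltr1n.
have Ds : D s by apply: D_down D2s _ s2s; exact: ltW.
have -> : g' s = g s by rewrite /g' patchE mem_set.
rewrite [leLHS](_ : _ = 4%:E *
    \int[leb]_(t in `[s, (2 * s)%R]) cst (g s * (((2 * s)^-1) ^+ 2)%:E) t); last first.
  rewrite integral_cst_itv// muleC -!muleA (muleC (g s)) -!EFinM muleA -EFinM.
  by congr (_%:E * _); field; rewrite gt_eqF.
rewrite lee_wpmul2l// integral_if; apply: ge0_le_integral => //.
- by move=> t _; case: ifP => // _; rewrite mule_ge0 ?g0// lee_fin sqr_ge0.
- apply/(measurable_restrictT _ _).1 => //.
move=> t _; rewrite mem_setE in_itv/=; case: ifPn => [/andP[st ts]|_]; last by case: ifP.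
have Dt : D t by apply: D_down D2s _ ts; exact: le_trans (ltW s0) st.
rewrite /b (le_trans xs st) st mem_set//= /h /g' patchE mem_set//.
rewrite lee_wpmul2l ?g0// lee_fin lerXn2r ?nnegrE ?invr_ge0 ?mulr_ge0 ?(ltW s0)//.
  by rewrite (le_trans (ltW s0)).
by rewrite lef_pV2// posrE ?mulr_gt0// (lt_le_trans s0).
Qed.

End nonneg.

Section monotone.
Variables g1 g2 : R -> \bar R.
Hypotheses (mg1 : measurable_fun (D : set RT) g1) (mg2 : measurable_fun (D : set RT) g2).
Hypotheses (g10 : forall x, D x -> 0 <= g1 x) (g20 : forall x, D x -> 0 <= g2 x).
Hypothesis le12 : \forall x \ae leb, D x -> g1 x <= g2 x.

Lemma cav_ae_le x : D x -> cav g1 x <= cav g2 x.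
Proof.
move=> Dx; rewrite lee_wpmul2l ?lee_fin ?invr_ge0 ?D_ge0//.
have sub := itv_subD Dx.
apply: ae_ge0_le_integral => //.
- by move=> t /sub/g10.
- exact: measurable_funS mD sub mg1.
- by move=> t /sub/g20.
- exact: measurable_funS mD sub mg2.
by apply: (ae_imp _ le12) => t le /sub.
Qed.

Lemma cop_ae_le x : cop g1 x <= cop g2 x.
Proof.
have sub : D `&` `[x, +oo[%classic `<=` D by move=> t [].
have mDx : measurable (D `&` `[x, +oo[) by exact: measurableI.
have mV : measurable_fun (D `&` `[x, +oo[ : set RT) (fun t => (t^-1)%:E).
  by apply/measurable_EFinP; apply: measurable_funTS measurable_inv.
have V0 t : D t -> 0 <= (t^-1)%:E by move=> Dt; rewrite lee_fin invr_ge0 D_ge0.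
apply: ae_ge0_le_integral => //.
- by move=> t [Dt _]; rewrite mule_ge0 ?g10 ?V0.
- by apply: emeasurable_funM => //; exact: measurable_funS mD sub mg1.
- by move=> t [Dt _]; rewrite mule_ge0 ?g20 ?V0.
- by apply: emeasurable_funM => //; exact: measurable_funS mD sub mg2.
by apply: (ae_imp _ le12) => t le [Dt _]; rewrite lee_wpmul2r ?V0 ?le.
Qed.

End monotone.

(** Iterated spaces apply an operator to [|fine (F x)|]; passing to it from [F]
    loses nothing when [F] is finite almost everywhere. *)
Section fine.
Variable F : R -> \bar R.
Hypotheses (mF : measurable_fun (D : set RT) F) (F0 : forall x, D x -> 0 <= F x).
Hypothesis finF : \forall x \ae leb, D x -> F x \is a fin_num.
Let F' x := `|fine (F x)|%:E.

Let mF' : measurable_fun (D : set RT) F'.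
Proof. by apply/measurable_EFinP; do 2 apply: measurableT_comp => //. Qed.

Let le : \forall x \ae leb, D x -> F x <= F' x.
Proof.
by apply: (ae_imp _ finF) => x fx Dx; rewrite /F' -{1}[F x]fineK ?fx// lee_fin ler_norm.
Qed.

Lemma cav_fine x : D x -> cav F x <= cav F' x.
Proof. by apply: cav_ae_le => // t _; rewrite lee_fin. Qed.

Lemma cop_fine x : cop F x <= cop F' x.
Proof. by apply: cop_ae_le => // t _; rewrite lee_fin. Qed.

End fine.
End cesaro_copson.

(** * Cesaro and Copson spaces on an interval *)
Section spaces_on_D.
Context (R : realType).
Local Notation leb := (@lebesgue_measure R).
Local Notation RT := (measurableTypeR R).
Variable D : set R.
Hypothesis mD : measurable D.
Hypothesis D_ge0 : forall x, D x -> 0 <= x.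
Hypothesis D_down : forall x y, D y -> 0 <= x -> x <= y -> D x.
Local Notation C := (@cesaro_op R).
Local Notation Cs := (copson_op D).

Section operators.
Variable f : R -> R.
Hypotheses (mf : measurable_fun (D : set RT) f) (f0 : forall x, 0 <= f x).

Let mEf : measurable_fun (D : set RT) (EFin \o f).
Proof. exact/measurable_EFinP. Qed.

Let Ef0 x : D x -> (0 <= (EFin \o f) x)%E.
Proof. by rewrite lee_fin. Qed.

Lemma measurable_cesaro : measurable_fun (D : set RT) (C f).
Proof. exact: (measurable_cav mD D_ge0 D_down mEf Ef0). Qed.

Lemma measurable_copson : measurable_fun (D : set RT) (Cs f).
Proof. exact: (measurable_cop mD D_ge0 mEf Ef0). Qed.

Lemma cesaro_ge0 x : D x -> (0 <= C f x)%E.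
Proof. exact: (cav_ge0 D_ge0 D_down Ef0). Qed.

Lemma copson_ge0 x : (0 <= Cs f x)%E.
Proof. exact: (cop_ge0 D_ge0 Ef0). Qed.

Section finite_copson.
Hypothesis finCs : \forall x \ae leb, D x -> Cs f x \is a fin_num.

Lemma cesaro_le_cesaro_copson x : D x ->
  (C f x <= C (fun y => `|fine (Cs f y)|%R) x)%E.
Proof.
move=> Dx; apply: le_trans (cav_le_cav_cop mD D_ge0 D_down mEf Ef0 Dx) _.
by apply: (cav_fine mD D_ge0 D_down measurable_copson) => // t _; exact: copson_ge0.
Qed.

Lemma copson_dilate (a : R) x : 0 < a < 1 -> D x -> 0 < x ->
  ((1 - a)%:E * Cs f x <= Cs (fun y => `|fine (Cs f y)|%R) (a * x)%R)%E.
Proof.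
move=> a01 Dx x0.
apply: le_trans (cop_dilate mD D_ge0 D_down mEf Ef0 a01 Dx x0) _.
by apply: (cop_fine mD D_ge0 measurable_copson) => // t _; exact: copson_ge0.
Qed.
End finite_copson.

Section finite_cesaro.
Hypothesis finC : \forall x \ae leb, D x -> C f x \is a fin_num.

Lemma cesaro_dilate (a : R) x : 1 < a -> D (a * x)%R -> 0 < x ->
  (((a - 1) / a ^+ 2)%:E * C f x <= C (fun y => `|fine (C f y)|%R) (a * x)%R)%E.
Proof.
move=> a1 Dax x0.
apply: le_trans (cav_dilate mD D_ge0 D_down mEf Ef0 a1 Dax x0) _.
apply: (cav_fine mD D_ge0 D_down measurable_cesaro) => //.
by move=> t; exact: cesaro_ge0.
Qed.

Lemma copson_le_copson_cesaro x :
  (Cs f x <= 4%:E * Cs (fun y => `|fine (C f y)|%R) x +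
    \int[leb]_s (if (x <= s)%R && ((2 * s)%R \notin D)
       then ((EFin \o f) \_ D) s * (s^-1)%:E else 0))%E.
Proof.
apply: le_trans (cop_le_cop_cav mD D_ge0 D_down mEf Ef0 x) _.
rewrite leeD2r// lee_wpmul2l//.
apply: (cop_fine mD D_ge0 measurable_cesaro) => // t; exact: cesaro_ge0.
Qed.
End finite_cesaro.

Lemma copson_lty_anti x t : (t <= x)%R -> (Cs f t < +oo -> Cs f x < +oo)%E.
Proof. by move=> tx; apply: le_lt_trans (cop_anti mD D_ge0 mEf Ef0 tx). Qed.

Lemma cesaro_lty x y : D y -> 0 <= x <= y -> (C f y < +oo -> C f x < +oo)%E.
Proof. exact: (cav_lty mD D_down mEf Ef0). Qed.

End operators.

Variable X : fspace leb D.
Hypothesis nX : normed_ideal (X : @fspace _ RT R leb D).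

Lemma copson_embeds_cesaro (A : R) : nonneg_bound A X C ->
  embeds_with A (copson_space X) (cesaro_space X).
Proof.
move=> bC; rewrite -[A]mul1r.
apply: (@embeds_op_space _ RT R leb D X nX (copson_space X)
  (fun f => Cs (fun x => `|f x|)) C C 1 A) => //.
  by move=> f [].
move=> f [mf [fin _]]; have mnf : measurable_fun (D : set RT) (fun x => `|f x|).
  exact: measurableT_comp.
split=> //; first exact: measurable_cesaro.
apply: nearW => x Dx; rewrite cesaro_ge0// mul1e.
exact: cesaro_le_cesaro_copson.
Qed.

Lemma copson_iter (a : R) : 0 < a < 1 -> bounded_on X Cs ->
  bounded_on X (dilation_op D a^-1) ->
  space_eq (copson_space X) (copson_space (copson_space X)).
Proof.
move=> a01 /bounded_nonneg-/(_ nX)[A A0 bCs] /bounded_nonneg-/(_ nX)[B B0 bS].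
apply: space_eqI; first by exists A => //; exact: (op_space_embeds_iter nX).
have /andP[a0 a1] := a01.
exists ((1 - a)^-1 * B); first by rewrite mulr_gt0// invr_gt0 subr_gt0.
apply: (@embeds_op_space _ RT R leb D X nX (copson_space (copson_space X))
  (fun f => Cs (fun y => `|fine (Cs (fun x => `|f x|) y)|)) Cs
  (dilation_op D a^-1) (1 - a)^-1 B) => //.
- by rewrite invr_ge0 subr_ge0 ltW.
- by move=> f [_ [_ []]].
move=> f [mf [fin [mF [finF XF]]]].
have mnf : measurable_fun (D : set RT) (fun x => `|f x|) by exact: measurableT_comp.
split=> //; first exact: measurable_copson.
apply: (ae_imp _ (ae_neq 0)) => x x0 Dx; rewrite copson_ge0//=.
have {}x0 : 0 < x by rewrite lt0r x0 D_ge0.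
have ax0 : 0 < a * x by rewrite mulr_gt0.
have axx : a * x <= x by rewrite ger_pMl// ltW.
have Dax : D (a * x) by apply: D_down Dx _ axx; exact: ltW.
rewrite -(@lee_pmul2l _ (1 - a)%:E)// ?lte_fin ?subr_gt0//.
have a1n0 : 1 - a != 0 by rewrite subr_eq0 gt_eqF.
rewrite muleA -EFinM mulfV// mul1r.
apply: le_trans (copson_dilate mnf _ fin a01 Dx x0) _ => //.
set G := Cs _.
have Gax : (G (a * x)%R < +oo)%E.
    (* Finiteness almost everywhere gives a point to the left of [a x] at which
     the decreasing function [G] is finite. *)
have [y /andP[y0 yax] finy] := ae_exists ax0 finF.
  have Dy : D y by apply: D_down Dax _ _; exact: ltW.
  apply: (@copson_lty_anti _ _ _ _ y (ltW yax)) => //.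
    by apply: measurableT_comp => //; exact: mF.
  by move: (finy Dy); rewrite ge0_fin_numE// copson_ge0//; exact: measurableT_comp.
rewrite /dilation_op invrK (mulrC x) patchE mem_set// -/G.
rewrite -{1}[G (a * x)]fineK ?lee_fin ?ler_norm// ge0_fin_numE//.
by apply: copson_ge0.
Qed.

End spaces_on_D.

(** * The half-line *)
Section half_line.
Context (R : realType).
Local Notation leb := (@lebesgue_measure R).
Local Notation RT := (measurableTypeR R).
Local Notation D := (half_line R).
Local Notation C := (@cesaro_op R).
Local Notation Cs := (copson_op D).

Lemma half_lineE (x : R) : D x <-> 0 <= x.
Proof. by rewrite /half_line /= in_itv/= andbT. Qed.

Lemma measurable_half_line : measurable (D : set RT).
Proof. exact: measurable_itv. Qed.

Lemma half_line_ge0 (x : R) : D x -> 0 <= x.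
Proof. by rewrite half_lineE. Qed.

Lemma half_line_down (x y : R) : D y -> 0 <= x -> x <= y -> D x.
Proof. by rewrite !half_lineE. Qed.

Let mD := measurable_half_line.
Let D_ge0 := half_line_ge0.
Let D_down := half_line_down.

Variable X : fspace leb D.
Hypothesis nX : normed_ideal (X : @fspace _ RT R leb D).

Lemma cesaro_iter (a : R) : 1 < a -> bounded_on X C ->
  bounded_on X (dilation_op D a^-1) ->
  space_eq (cesaro_space X) (cesaro_space (cesaro_space X)).
Proof.
move=> a1 /bounded_nonneg-/(_ nX)[A A0 bC] /bounded_nonneg-/(_ nX)[B B0 bS].
apply: space_eqI; first by exists A => //; exact: (op_space_embeds_iter nX).
have a0 : 0 < a := lt_trans ltr01 a1.
set K := (a - 1) / a ^+ 2; have K0 : 0 < K.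
  by rewrite divr_gt0 ?subr_gt0// exprn_gt0.
exists (K^-1 * B); first by rewrite mulr_gt0// invr_gt0.
apply: (@embeds_op_space _ RT R leb D X nX (cesaro_space (cesaro_space X))
  (fun f => C (fun y => `|fine (C (fun x => `|f x|) y)|)) C
  (dilation_op D a^-1) K^-1 B) => //.
- by rewrite invr_ge0 ltW.
- by move=> f [_ [_ []]].
move=> f [mf [fin [mF [finF XF]]]].
have mnf : measurable_fun (D : set RT) (fun x => `|f x|) by exact: measurableT_comp.
split=> //; first exact: (measurable_cesaro mD D_ge0 D_down).
apply: (ae_imp _ (ae_neq 0)) => x x0 Dx; rewrite (cesaro_ge0 D_ge0 D_down)//=.
have {}x0 : 0 < x by rewrite lt0r x0 D_ge0.
have ax0 : 0 < a * x by rewrite mulr_gt0.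
have Dax : D (a * x) by rewrite half_lineE ltW.
rewrite -(@lee_pmul2l _ K%:E)// [leRHS]muleA -EFinM mulfV ?mul1r ?gt_eqF//.
apply: le_trans (cesaro_dilate mD D_ge0 D_down mnf _ fin a1 Dax x0) _ => //.
set G := C _.
have G0 t : D t -> (0 <= G t)%E by move=> Dt; exact: (cesaro_ge0 D_ge0 D_down).
have Gax : (G (a * x)%R < +oo)%E.
  (* An average finite at a point is finite at all points to its left. *)
have [|y /andP[axy _] finy] := @ae_exists R _ (a * x) (a * x + 1) _ finF.
    by rewrite ltrDl.
  have Dy : D y by rewrite half_lineE (le_trans (ltW ax0) (ltW axy)).
  apply: (cesaro_lty mD D_down _ _ Dy) => //.
  - exact: measurableT_comp.
  - by rewrite (ltW ax0) ltW.
  - by move: (finy Dy); rewrite ge0_fin_numE// G0.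
rewrite /dilation_op invrK (mulrC x) patchE mem_set// -/G.
by rewrite -{1}[G (a * x)]fineK ?lee_fin ?ler_norm// ge0_fin_numE ?G0.
Qed.

Lemma cesaro_eq_copson : bounded_on X C -> bounded_on X Cs ->
  space_eq (cesaro_space X) (copson_space X).
Proof.
move=> /bounded_nonneg-/(_ nX)[A A0 bC] /bounded_nonneg-/(_ nX)[B B0 bCs].
apply: space_eqI; last first.
  by exists A => //; exact: (copson_embeds_cesaro mD D_ge0 D_down nX bC).
exists (4 * B); first by rewrite mulr_gt0.
apply: (@embeds_op_space _ RT R leb D X nX (cesaro_space X)
  (fun f => C (fun x => `|f x|)) Cs Cs 4 B) => //.
  by move=> f [].
move=> f [mf [fin _]].
have mnf : measurable_fun (D : set RT) (fun x => `|f x|) by exact: measurableT_comp.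
split=> //; first exact: (measurable_copson mD D_ge0).
apply: nearW => x Dx; rewrite (copson_ge0 D_ge0)//=.
apply: le_trans (copson_le_copson_cesaro mD D_ge0 D_down mnf _ fin x) _ => //.
rewrite [X in (_ + X)%E](_ : _ = 0%E) ?adde0//.
apply: integral0_eq => s _; case: ifP => // /andP[_]; rewrite patchE.
case: ifPn; last by rewrite mul0e.
move=> /set_mem Ds /negP[]; apply/mem_set.
by rewrite half_lineE mulr_ge0// D_ge0.
Qed.

End half_line.

(** * The unit interval *)
Section unit_interval.
Context (R : realType).
Local Notation leb := (@lebesgue_measure R).
Local Notation RT := (measurableTypeR R).
Local Notation D := (unit_interval R).
Local Notation C := (@cesaro_op R).
Local Notation Cs := (copson_op D).
Local Notation L1 := (Lp_space leb D 1%:E).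

Lemma unit_intervalE (x : R) : D x <-> 0 <= x <= 1.
Proof. by rewrite /unit_interval /= in_itv/=. Qed.

Lemma measurable_unit_interval : measurable (D : set RT).
Proof. exact: measurable_itv. Qed.

Lemma unit_interval_ge0 (x : R) : D x -> 0 <= x.
Proof. by rewrite unit_intervalE => /andP[]. Qed.

Lemma unit_interval_down (x y : R) : D y -> 0 <= x -> x <= y -> D x.
Proof. by rewrite !unit_intervalE => /andP[_ y1] -> /le_trans->. Qed.

Let mD := measurable_unit_interval.
Let D_ge0 := unit_interval_ge0.
Let D_down := unit_interval_down.

Local Notation int1 f := (\int[leb]_(t in D) `|(f t)%:E|)%E.

Lemma L1_normE (f : R -> R) : 'N[leb]_1[EFin \o (f \_ D)]%E = int1 f.
Proof.
rewrite Lnorm1 [RHS]integral_if; apply: eq_integral => x _ /=.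
by rewrite patchE; case: ifP => // _; rewrite normr0.
Qed.

Lemma L1P (f : R -> R) : measurable_fun (D : set RT) f ->
  (L1 f <-> (int1 f < +oo)%E).
Proof.
move=> mf; rewrite -L1_normE.
have mf' : measurable_fun [set: RT] (f \_ D) by exact/(measurable_restrictT _ _).1.
split=> [/andP[_ /set_mem]//|fin].
by apply/andP; split; apply/mem_set.
Qed.

Lemma L1_measurable (f : R -> R) : L1 f -> measurable_fun (D : set RT) f.
Proof.
by move=> /andP[/set_mem mf _]; exact/(measurable_restrictT _ _).2.
Qed.

Lemma fnorm_L1 (f : R -> R) : L1 f -> (fnorm L1 f)%:E = int1 f.
Proof.
move=> Lf; rewrite -L1_normE /= fineK// ge0_fin_numE ?Lnorm_ge0//.
rewrite L1_normE; apply/(L1P _).1 => //; exact: L1_measurable.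
Qed.

End unit_interval.

Section unit_interval_spaces.
Context (R : realType).
Local Notation leb := (@lebesgue_measure R).
Local Notation RT := (measurableTypeR R).
Local Notation D := (unit_interval R).
Local Notation C := (@cesaro_op R).
Local Notation Cs := (copson_op D).
Local Notation L1 := (Lp_space leb D 1%:E).
Local Notation int1 f := (\int[leb]_(t in D) `|(f t)%:E|)%E.
Let mD := @measurable_unit_interval R.
Let D_ge0 := @unit_interval_ge0 R.
Let D_down := @unit_interval_down R.
Let D1 : D 1. Proof. by rewrite unit_intervalE ler01 lexx. Qed.

Lemma cesaro_at1 (f : R -> R) : C (fun x => `|f x|) 1 = int1 f.
Proof. by rewrite /cesaro_op invr1 mul1e. Qed.

Variable X : fspace leb D.
Hypothesis nX : normed_ideal (X : @fspace _ RT R leb D).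

Lemma embeds_L1 : embeds X L1 -> exists2 B : R, 0 < B &
  forall f, X f -> (int1 f <= (B * fnorm X f)%:E)%E.
Proof.
move=> [B B0 XL]; exists B => // f /XL[Lf le].
by rewrite -fnorm_L1// lee_fin.
Qed.

(** The far part in [cop_le_cop_cav] consists of [s > 1/2], where [1 / s <= 2];
    it is at most twice the [L^1] norm, a constant function of [x]. *)
Lemma cesaro_L1_embeds_copson : X (cst 1) -> bounded_on X Cs ->
  embeds (inter_space (cesaro_space X) L1) (copson_space X).
Proof.
move=> X1 /bounded_nonneg-/(_ nX)[A A0 bCs].
have n1 := fnorm_ge0 nX X1.
apply: (@embeds_withW _ _ _ _ _ (4 * A + 2 * fnorm X (cst 1))).
  move=> f [[_ [_ Xf]] _] /=; rewrite le_max; apply/orP; left.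
  exact: (fnorm_ge0 nX Xf).
move=> f [[mf eC] Lf]; have [fin XC] := eC.
have mnf : measurable_fun (D : set RT) (fun x => `|f x|) by exact: measurableT_comp.
have [[finB XB] leB] := emem_bounded nX bCs eC.
set G := Cs (fun y => `|fine (C (fun x => `|f x|) y)|) in finB XB leB.
have [X4 n4] := ni_scale nX 4 XB.
have [Xc nc] := ni_scale nX (2 * fnorm L1 f) X1.
have [Xh nh] := ni_add nX X4 Xc.
have Lf0 : 0 <= fnorm L1 f by rewrite -lee_fin fnorm_L1// integral_ge0.
have mCs := measurable_copson mD D_ge0 mnf (fun x => normr_ge0 (f x)).
have [|eCs le] := emem_dom nX mCs Xh.
  apply: (ae_imp _ finB) => x fG Dx; rewrite (copson_ge0 D_ge0)//=.
  apply: le_trans (copson_le_copson_cesaro mD D_ge0 D_down mnf _ fin x) _ => //.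
  rewrite [leRHS](_ : _ = 4%:E * G x + 2%:E * int1 f)%E; last first.
    by rewrite -fnorm_L1// -[G x]fineK ?fG// mulr1.
  apply: leeD => //.
  have -> : (2%:E * int1 f = \int[leb]_s (2%:E * ((fun t => `|(f t)%:E|) \_ D) s))%E.
    rewrite integral_mkcond; apply/esym/ge0_integralZl => //.
      apply/(measurable_restrictT _ _).1 => //.
      by apply/measurable_EFinP/measurableT_comp.
    by move=> s _; rewrite patchE; case: ifP.
  apply: ge0_le_integral => //.
  - move=> s _; case: ifP => // _; rewrite patchE; case: ifPn; rewrite ?mul0e//.
    move=> /set_mem Ds; apply: mule_ge0; first by rewrite /= lee_fin.
    by rewrite lee_fin invr_ge0; exact: D_ge0.
  - apply: measurable_fun_ifT => //.
      apply: measurable_and; first exact: measurable_fun_ler.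
      apply: measurable_neg; apply: (measurableT_comp (measurable_mem mD)).
      exact: measurable_funM.
    apply: emeasurable_funM; last by apply/measurable_EFinP; exact: measurable_inv.
    apply/(measurable_restrictT _ _).1 => //.
    by apply/measurable_EFinP.
  - apply: measurable_funeM; apply/(measurable_restrictT _ _).1 => //.
    by apply/measurable_EFinP/measurableT_comp.
  move=> s _; rewrite !patchE; case: (boolP (s \in D)) => [/set_mem Ds|_]; last first.
    by rewrite !mul0e if_same mule0.
  case: ifPn => [/andP[xs /negP nD]|_]; last by apply: mule_ge0; rewrite /= lee_fin.
  rewrite muleC; apply: lee_wpmul2r; first by rewrite /= lee_fin.
  rewrite lee_fin.
  have s2 : 1 < 2 * s.
    rewrite ltNge; apply/negP => s21; apply/nD/mem_set.
    by rewrite unit_intervalE s21 mulr_ge0// D_ge0.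
  have s0 : 0 < s by rewrite -(@pmulr_rgt0 _ 2)// (lt_trans ltr01).
  by rewrite -[leLHS]mul1r ler_pdivrMr// ltW.
split; first by split.
apply: le_trans le _; apply: le_trans nh _; rewrite n4 nc !ger0_norm ?mulr_ge0//=.
rewrite [leRHS]mulrDl; apply: lerD.
  rewrite -mulrA ler_wpM2l// (le_trans leB)// ler_wpM2l ?(ltW A0)//.
  by rewrite le_max lexx.
by rewrite mulrAC ler_wpM2l ?mulr_ge0// le_max lexx orbT.
Qed.

(** The [L^1] norm of [f] is [C |f|] at 1, hence at most [C (C* |f|)] at 1, which is
    the [L^1] norm of [C* |f|], an element of [X]. *)
Lemma copson_embeds_cesaro_L1 (B : R) : 0 < B ->
  (forall f, X f -> (int1 f <= (B * fnorm X f)%:E)%E) -> bounded_on X C ->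
  embeds (copson_space X) (inter_space (cesaro_space X) L1).
Proof.
move=> B0 XL1 /bounded_nonneg-/(_ nX)[A A0 bC].
apply: (@embeds_withW _ _ _ _ _ (A + B)) => [f [mf [_ Xf]]|f Cf].
  exact: fnorm_ge0 Xf.
have [CXf le] := copson_embeds_cesaro mD D_ge0 D_down nX bC Cf.
have [mf [fin XCs]] := Cf.
have mnf : measurable_fun (D : set RT) (fun x => `|f x|) by exact: measurableT_comp.
have leL : (int1 f <= (B * fnorm (copson_space X) f)%:E)%E.
  rewrite -cesaro_at1.
  apply: le_trans (cesaro_le_cesaro_copson mD D_ge0 D_down mnf _ fin D1) _ => //.
  by rewrite (cesaro_at1 (fine \o Cs (fun x => `|f x|))) XL1.
have Lf : L1 f by apply/(L1P mf); rewrite (le_lt_trans leL) ?ltry.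
have n0 : 0 <= fnorm (copson_space X) f := fnorm_ge0 nX XCs.
split=> //=; rewrite ge_max; apply/andP; split.
  by rewrite (le_trans le)// ler_wpM2r// lerDl ltW.
rewrite -lee_fin fnorm_L1// (le_trans leL)// lee_fin.
by rewrite ler_wpM2r// lerDr ltW.
Qed.

End unit_interval_spaces.

(** * The essential tail supremum *)
Section essential_tail_supremum.
Context (R : realType).
Local Notation leb := (@lebesgue_measure R).
Local Notation RT := (measurableTypeR R).
Variables (D : set R) (f : R -> R).
Local Notation F := (tilde_op D f).

Lemma lebesgue_measureT_gt0 : (0 < leb [set: RT])%E.
Proof.
apply: (@lt_le_trans _ _ (leb `]0, 1[%classic)).
  by rewrite [ltRHS](@lebesgue_measure_itv R `]0, 1[)/= lte01 oppr0 adde0.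
by apply: le_measure; rewrite ?inE//.
Qed.

Lemma ae_rat (P : rat -> R -> Prop) : (forall q, \forall x \ae leb, P q x) ->
  \forall x \ae leb, forall q, P q x.
Proof.
move=> H; have : \forall x \ae leb, forall n : nat,
    if unpickle n is Some q then P q x else True.
  by apply: ae_foralln => n; case: unpickle => [q|]; [exact: H|exact: nearW].
by apply: ae_imp => x Hx q; have := Hx (pickle q); rewrite pickleK.
Qed.

Lemma tilde_le x (c : \bar R) : (0 <= c)%E ->
  (\forall t \ae leb, D t -> x <= t -> (`|(f t)%:E| <= c)%E) -> (F x <= c)%E.
Proof.
move=> c0 fc; apply/ess_supP; apply: (ae_imp _ fc) => t le /=.
rewrite patchE; case: ifPn => [/set_mem[Dt]|_] //=.
by rewrite in_itv/= andbT => /(le Dt).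
Qed.

Lemma le_tilde x : \forall t \ae leb, D t -> x <= t -> (`|(f t)%:E| <= F x)%E.
Proof.
apply: (ae_imp _ (ess_sup_ge leb (EFin \o ((fun t => `|f t|) \_ (D `&` `[x, +oo[))))).
move=> t /= + Dt xt; rewrite patchE mem_set//; split=> //=.
by rewrite in_itv/= andbT.
Qed.

Lemma tilde_ge0 x : (0 <= F x)%E.
Proof.
apply: ess_sup_gee; first exact: lebesgue_measureT_gt0.
by apply: nearW => t /=; rewrite patchE; case: ifP => // _; rewrite lee_fin.
Qed.

Lemma tilde_anti x y : x <= y -> (F y <= F x)%E.
Proof.
move=> xy; apply: tilde_le; first exact: tilde_ge0.
by apply: (ae_imp _ (le_tilde x)) => t le Dt yt; apply: le => //; exact: le_trans yt.
Qed.

Lemma measurable_tilde (E : set R) : measurable E ->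
  measurable_fun (E : set RT) F.
Proof.
move=> mE; apply: measurable_funTS.
apply: (measurability _ (ErealGenOInfty.measurableE R)).
move=> _ [_ [r ->] <-]; rewrite setTI; apply: is_interval_measurable.
move=> x y; rewrite /= !in_itv/= !andbT => _ ry z /andP[_ zy].
by rewrite in_itv/= andbT (lt_le_trans ry)// tilde_anti.
Qed.

(** The inequality is known for almost every [t >= x] with [x] fixed, and is
    needed on the diagonal.  A violation at [t] puts [t] in some [Bq q], with
    [q] rational between [F t] and [|f t|].  Unless [t] is the infimum of
    [Bq q], this set has an element [s < t], and for a rational [r] in [[s, t]]
    one gets [|f t| <= F r <= F s <= q < |f t|].  So only countably many null
    sets have to be removed. *)
Lemma abs_le_tilde : has_lbound D -> \forall x \ae leb, D x -> (`|(f x)%:E| <= F x)%E.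
Proof.
move=> [m lbm]; pose Bq (q : rat) := [set t | [/\ D t, (F t <= (ratr q)%:E)%E & ratr q < `|f t|]].
have ae1 := ae_rat (fun q => ae_neq (inf (Bq q))).
have ae2 := ae_rat (fun r : rat => le_tilde (ratr r)).
apply: (ae_imp2 _ ae1 ae2) => t tinf tle Dt.
rewrite leNgt; apply/negP => Ft.
have finF : F t \is a fin_num.
  by rewrite ge0_fin_numE ?tilde_ge0// (lt_trans Ft)// ltry.
have [q] : exists q : rat, ratr q \in `]fine (F t), `|f t|[.
  by apply: rat_in_itvoo; rewrite -lte_fin fineK.
rewrite in_itv/= => /andP[Fq qf].
have Bt : Bq q t by split=> //; rewrite -(fineK finF) lee_fin ltW.
have lbB : has_lbound (Bq q).
  by exists m => s [Ds _ _]; exact: lbm.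
have /inf_lt : inf (Bq q) < t by rewrite lt_neqAle eq_sym tinf ge_inf.
case=> [|s [Ds Fs _] st]; first by exists t.
have [r] : exists r : rat, ratr r \in `]s, t[ by exact: rat_in_itvoo.
rewrite in_itv/= => /andP[sr rt].
have := tle r Dt (ltW rt); rewrite leNgt => /negP; apply.
rewrite (@le_lt_trans _ _ (ratr q)%:E) ?lte_fin//.
by rewrite (le_trans _ Fs)// tilde_anti// ltW.
Qed.

End essential_tail_supremum.

(** * Constants in spaces on the unit interval *)
Section symmetric.
Context (R : realType).
Local Notation leb := (@lebesgue_measure R).
Local Notation RT := (measurableTypeR R).
Local Notation D := (unit_interval R).
Local Notation C := (@cesaro_op R).
Local Notation Cs := (copson_op D).
Local Notation L1 := (Lp_space leb D 1%:E).
Local Notation int1 f := (\int[leb]_(t in D) `|(f t)%:E|)%E.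
Let mD := @measurable_unit_interval R.
Let D_ge0 := @unit_interval_ge0 R.
Let D_down := @unit_interval_down R.
Let D1 : D 1. Proof. by rewrite unit_intervalE ler01 lexx. Qed.

Variable X : fspace leb D.
Hypothesis bX : banach_ideal_space (X : @fspace _ RT R leb D).
Let nX := banach_normed_ideal bX.

Lemma fnorm1_gt0 : X (cst 1) -> 0 < fnorm X (cst 1).
Proof.
move=> X1; rewrite lt0r (fnorm_ge0 nX X1) andbT; apply/eqP => n1.
have [x /andP[x0 x1] /(_ _)] := ae_exists ltr01 (bis_norm_eq0 bX X1 n1).
rewrite unit_intervalE !ltW// => /(_ isT) /eqP.
by rewrite oner_eq0.
Qed.

(** The [L^1] norm of [f], seen as a constant function, is the average over
    [[0, 1]] and so lies below [C |f| + C* |f|] everywhere. *)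
Lemma cesaro_copson_int1 : X (cst 1) -> forall f : R -> R, measurable_fun (D : set RT) f ->
  emem X (C (fun x => `|f x|)) -> emem X (Cs (fun x => `|f x|)) ->
  (int1 f <= ((fnorm X (cst 1))^-1 * (fnorm X (fine \o C (fun x => `|f x|)) +
     fnorm X (fine \o Cs (fun x => `|f x|))))%:E)%E.
Proof.
move=> X1 f mf eC eCs.
have mnf : measurable_fun (D : set RT) (fun x => `|f x|) by exact: measurableT_comp.
have [|[fin XI] le] := emem_domD nX (@measurable_cst _ _ RT _ D (int1 f)) eC eCs.
  apply: (ae_imp _ (ae_neq 0)) => x x0 Dx; rewrite integral_ge0//= -cesaro_at1.
  have mEf : measurable_fun (D : set RT) (EFin \o (fun x => `|f x|)).
    exact/measurable_EFinP.
  apply: (cav_le_cavD_cop mD D_ge0 D_down mEf _ D1) => [t _|].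
    by rewrite lee_fin.
  by move: Dx; rewrite unit_intervalE => /andP[x0' ->]; rewrite lt0r x0 x0'.
have [x /andP[x0 x1] finx] := ae_exists ltr01 fin.
have {}finx : int1 f \is a fin_num by apply: finx; rewrite unit_intervalE !ltW.
rewrite -(fineK finx) lee_fin mulrC ler_pdivlMr ?fnorm1_gt0//.
apply: le_trans le.
have [_ ] := ni_scale nX (fine (int1 f)) X1.
rewrite ger0_norm ?fine_ge0 ?integral_ge0// => <-.
suff -> : (fun x : RT => fine (int1 f) * cst 1 x) = fine \o cst (int1 f) by [].
by apply/funext => y /=; rewrite mulr1.
Qed.

(** The positive weight exceeds some [1 / (n + 1)] on a set of positive measure
    [d], whose indicator is thus in [X].  By symmetry so is the indicator of
    every interval of length [d], and finitely many of them cover [[0, 1]]. *)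
Lemma symmetric_cst1 : symmetric_space X -> X (cst 1).
Proof.
move=> [_ sX]; have [w Xw w0] := bis_weight bX.
have mw := ni_measurable nX Xw.
pose E n := D `&` [set x | n.+1%:R^-1 < w x].
have mE n : measurable (E n : set RT).
  rewrite /E -preimage_itvoy; exact: mw.
have DE : D `<=` \bigcup_n E n.
  move=> x Dx; exists (Num.truncn (w x)^-1) => //; split=> //=.
  by rewrite invf_plt ?posrE ?w0//; exact: truncnS_gt.
have leD : leb D = 1%E.
  by rewrite [LHS](@lebesgue_measure_itv R `[0, 1])/= lte01 oppr0 adde0.
have [n En] : exists n, (0 < leb (E n))%E.
  apply: contrapT => noE; suff : leb D = 0%E by rewrite leD => /eqP; rewrite onee_eq0.
  apply: (@subset_measure0 _ _ _ leb _ (\bigcup_n E n)) => //.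
    exact: bigcup_measurable.
  apply/eqP; rewrite eq_le measure_ge0 andbT.
  apply: le_trans (measure_sigma_subadditive _ _ _ (fun x h => h)) _ => //.
    exact: bigcup_measurable.
  rewrite eseries0// => i _ _; apply/eqP; rewrite eq_le measure_ge0 andbT leNgt.
  by apply/negP => Ei; apply: noE; exists i.
have leE : (leb (E n) <= 1)%E.
  by rewrite -leD; apply: le_measure; rewrite ?inE//; exact: subIsetl.
pose d := fine (leb (E n)).
have dE : leb (E n) = d%:E.
  by rewrite fineK// ge0_fin_numE// (le_lt_trans leE)// ltry.
have d0 : 0 < d by rewrite -lte_fin -dE.
have d1 : d <= 1 by rewrite -lee_fin -dE.
have XE : X \1_(E n).
  have [Xnw _] := ni_scale nX n.+1%:R Xw.
  apply: (proj1 (ni_ideal nX _ _ Xnw)); first exact: measurable_indic.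
  apply: nearW => x Dx; rewrite indicE.
  case: (boolP (x \in E n)) => [/set_mem[_ /=]|_]; last by rewrite normr0.
  rewrite normr1 ger0_norm ?mulr_ge0 ?(ltW (w0 _ _))// => lew.
  by rewrite mulrC -ler_pdivrMr// mul1r ltW.
have indE (A : set R) : measurable (A : set RT) -> A `<=` D -> leb A = d%:E ->
    X (\1_A).
  move=> mA AD leA; apply: (proj1 (sX _ _ XE _ _)); first exact: measurable_indic.
  have lev (B : set R) : B `<=` D -> forall l : R, 0 <= l ->
      [set x | D x /\ l < `|\1_B x : R|] = if l < 1 then B else set0.
    move=> BD l l0; apply/seteqP; split=> x /=.
      rewrite indicE => -[Dx]; case: (boolP (x \in B)) => [/set_mem Bx|_].
        by rewrite normr1 => ->.
      by rewrite normr0 ltNge l0.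
    case: ifPn => // l1 Bx; split; first exact: BD.
    by rewrite indicE mem_set// normr1.
  move=> l l0; rewrite !lev//; last exact: subIsetl.
  by case: ifP => //; rewrite leA dE.
have XJ a : 0 <= a -> a + d <= 1 -> X \1_`[a, a + d].
  move=> a0 ad1; apply: indE; first exact: measurable_itv.
    move=> x /=; rewrite unit_intervalE in_itv/= => /andP[ax xad].
    by rewrite (le_trans a0 ax) (le_trans xad ad1).
  rewrite [LHS](@lebesgue_measure_itv R `[a, a + d])/= lte_fin ltrDl d0.
  by rewrite -EFinB addrAC subrr add0r.
have XI k : X \1_`[0, Num.min 1 (d *+ k)].
  elim: k => [|k IH].
    have XJ0 : X \1_`[0, 0 + d] by apply: XJ; rewrite ?add0r.
    apply: (proj1 (ni_ideal nX _ _ XJ0)).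
      by apply: measurable_indic; exact: measurable_itv.
    apply: nearW => x _; rewrite mulr0n !indicE !mem_setE !in_itv/=.
    case: (boolP (0 <= x <= _)) => [/andP[x0 xm]|_]; last by rewrite normr0.
    rewrite x0 (le_trans xm)//.
    by rewrite ge_min add0r (ltW d0) orbT.
  (* The next interval of length [d] is pushed back into [[0, 1]] if it would
     stick out. *)
  pose a := Num.min (d *+ k) (1 - d).
  have dk0 : 0 <= d *+ k by rewrite mulrn_wge0// ltW.
  have a0 : 0 <= a by rewrite le_min dk0 subr_ge0.
  have ad1 : a + d <= 1 by rewrite -lerBrDr ge_min lexx orbT.
  have [XS _] := ni_add nX IH (XJ _ a0 ad1).
  apply: (proj1 (ni_ideal nX _ _ XS)).
    by apply: measurable_indic; exact: measurable_itv.
  apply: nearW => x _ /=; rewrite !indicE !mem_setE !in_itv/=.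
  case: (boolP (0 <= x <= Num.min 1 (d *+ k.+1))) => [/andP[x0]|_]; last by rewrite normr0.
  rewrite le_min mulrS => /andP[x1 xdk].
  rewrite normr1 ger0_norm ?addr_ge0 ?ler0n// x0/= le_min x1/=.
  have [_|kx] := leP x (d *+ k); first by rewrite lerDl ler0n.
  have -> : a <= x <= a + d.
    apply/andP; split; first by rewrite ge_min (ltW kx).
    by rewrite -lerBlDr le_min lerBlDl xdk lerB.
  by rewrite lerDr.
have [k dk] : exists k, 1 <= d *+ k.
  exists (Num.truncn d^-1).+1; rewrite -mulr_natl -ler_pdivrMr// mul1r.
  by apply/ltW; exact: truncnS_gt.
apply: (proj1 (ni_ideal nX _ _ (XI k))) => //.
apply: nearW => x; rewrite unit_intervalE => x01.
rewrite indicE mem_setE in_itv/=; have /min_idPl -> := dk.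
by rewrite x01.
Qed.
End symmetric.

(** * The Cesaro space of the Tandori space *)
Section cesaro_tandori.
Context (R : realType).
Local Notation leb := (@lebesgue_measure R).
Local Notation RT := (measurableTypeR R).
Local Notation D := (unit_interval R).
Local Notation C := (@cesaro_op R).
Local Notation Cs := (copson_op D).
Local Notation L1 := (Lp_space leb D 1%:E).
Local Notation int1 f := (\int[leb]_(t in D) `|(f t)%:E|)%E.
Let mD := @measurable_unit_interval R.
Let D_ge0 := @unit_interval_ge0 R.
Let D_down := @unit_interval_down R.

Lemma unit_lbound : has_lbound D.
Proof. by exists 0 => x /D_ge0. Qed.

Variable X : fspace leb D.
Hypothesis bX : banach_ideal_space (X : @fspace _ RT R leb D).
Let nX := banach_normed_ideal bX.

(** The tail supremum of [C |f|] at [x] is at most [C |f| (x) + C* |f| (x)]. *)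
Lemma inter_embeds_cesaro_tandori :
  embeds (inter_space (cesaro_space X) L1) (copson_space X) ->
  embeds (inter_space (cesaro_space X) L1) (cesaro_space (tandori_space X)).
Proof.
move=> [K K0 KP]; exists (1 + K); first by rewrite ltr_wpDl.
move=> f If; have [[mf eCs] leK] := KP _ If; have [[_ eC] Lf] := If.
have mnf : measurable_fun (D : set RT) (fun x => `|f x|) by exact: measurableT_comp.
have mEf : measurable_fun (D : set RT) (EFin \o (fun x => `|f x|)).
  exact/measurable_EFinP.
set h := fine \o C (fun x => `|f x|).
have mh : measurable_fun (D : set RT) h by exact: (ni_measurable nX eC.2).
have [|eT leT] := emem_domD nX (measurable_tilde D h mD) eC eCs.
  apply: (ae_imp _ (ae_neq 0)) => x x0 Dx; rewrite tilde_ge0/=.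
  have {}x0 : 0 < x by rewrite lt0r x0 D_ge0.
  have nf0 y : (0 <= `|f y|) by [].
  apply: tilde_le; first by rewrite adde_ge0 ?(cesaro_ge0 D_ge0 D_down)// (copson_ge0 D_ge0).
  apply: nearW => t Dt xt; rewrite /h/=.
  have C0 := cesaro_ge0 D_ge0 D_down nf0 Dt.
  apply: (@le_trans _ _ (C (fun x => `|f x|) t)).
    by rewrite ger0_norm ?fine_ge0//; move: C0; case: (C _ t) => [r _|_|//] /=;
      rewrite ?lexx ?leey.
  apply: (cav_le_cavD_cop mD D_ge0 D_down mEf _ Dt); last by rewrite x0.
  by move=> s _; rewrite lee_fin.
split; first by split=> //; split; [exact: eC.1|split].
apply: le_trans leT _; rewrite mulrDl mul1r; apply: lerD => //.
by rewrite /= le_max lexx.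
Qed.

(** The tail supremum of [C |f|] dominates [C |f|] and also the [L^1] norm of
    [f], the limit of [C |f|] at 1. *)
Lemma cesaro_tandori_embeds_inter : X (cst 1) ->
  embeds (cesaro_space (tandori_space X)) (inter_space (cesaro_space X) L1).
Proof.
move=> X1; have n1 := fnorm1_gt0 bX X1.
apply: (@embeds_withW _ _ _ _ _ (1 + (fnorm X (cst 1))^-1)).
  by move=> f [_ [_ [_ [_ Xf]]]]; exact: fnorm_ge0 Xf.
move=> f [mf [finC [mh eT]]].
set h := fine \o C (fun x => `|f x|) in mh eT.
have mnf : measurable_fun (D : set RT) (fun x => `|f x|) by exact: measurableT_comp.
have mEf : measurable_fun (D : set RT) (EFin \o (fun x => `|f x|)).
  exact/measurable_EFinP.
have nf0 y : (0 <= `|f y|) by [].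
have C0 t : D t -> (0 <= C (fun x => `|f x|%R) t)%E.
  exact: (cesaro_ge0 D_ge0 D_down nf0).
have [|eC leC] := emem_domZ nX ler01 (measurable_cesaro mD D_ge0 D_down mnf nf0) eT.
  apply: (ae_imp2 _ (abs_le_tilde h unit_lbound) finC) => x le fin Dx.
  rewrite C0//= mul1e (le_trans _ (le Dx))// /h/=.
  by rewrite -{1}[C _ x]fineK ?fin// lee_fin ler_norm.
(* The value at the single point 1 does not count for an essential supremum,
   so 1 is approached by [y n]. *)
have intle x : D x -> x < 1 -> (int1 f <= tilde_op D h x)%E.
  move=> Dx x1; have x0 := D_ge0 Dx.
  have key y : x <= y < 1 -> (\int[leb]_(t in `[0%R, y]) `|(f t)%:E| <= tilde_op D h x)%E.
    move=> /andP[xy y1].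
    have := ae_exists y1 (ae_imp2 (fun t A B => conj A B) (le_tilde D h x) finC).
    move=> [t /andP[yt t1] [le fin]].
    have Dt : D t by rewrite unit_intervalE (ltW t1) (le_trans x0)// (le_trans xy)// ltW.
    have xt : x <= t by rewrite (le_trans xy)// ltW.
    have t0 : 0 < t by rewrite (le_lt_trans _ yt)// (le_trans x0).
    apply: le_trans (le Dt xt); rewrite /h/=.
    apply: (@le_trans _ _ (C (fun x => `|f x|) t)); last first.
      by rewrite -{1}[C _ t]fineK ?fin// lee_fin ler_norm.
    apply: le_trans (int_head_le mD D_down mEf _ Dt (ltW yt)) _; first by move=> s _; rewrite lee_fin.
    rewrite -[leLHS]mul1e; apply: lee_wpmul2r.
      by apply: integral_ge0 => s _; rewrite lee_fin.
    by rewrite lee_fin -invr1 lef_pV2// ?posrE// ltW.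
  pose y n : R := 1 - (1 - x) / n.+1%:R.
  have xy n : x <= y n < 1.
    rewrite /y; apply/andP; split.
      rewrite lerBrDr addrC -lerBrDr ler_pdivrMr ?ltr0n//.
      by rewrite ler_peMr ?ler1n// subr_ge0 ltW.
    by rewrite ltrBlDr ltrDl divr_gt0 ?subr_gt0.
  have y_up n m : (n <= m)%N -> y n <= y m.
    move=> nm; rewrite lerB// ler_wpM2l ?subr_ge0 ?(ltW x1)// lef_pV2 ?posrE ?ltr0n//.
    by rewrite ler_nat.
  have UE : \bigcup_n `[0, y n]%classic = `[0, 1[%classic :> set R.
    apply/seteqP; split=> s /=.
      move=> [n _] /=; rewrite !in_itv/= => /andP[-> sy].
      by rewrite (le_lt_trans sy)//; have /andP[] := xy n.
    rewrite in_itv/= => /andP[s0 s1]; exists (Num.truncn ((1 - x) / (1 - s))) => //=.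
    rewrite in_itv/= s0/= /y lerBrDr addrC -lerBrDr.
    rewrite ler_pdivrMr ?ltr0n// mulrC -ler_pdivrMr ?subr_gt0//.
    by apply/ltW; exact: truncnS_gt.
  have mabs : measurable_fun (D : set RT) (fun t => `|(f t)%:E|)%E by exact: mEf.
  have sub n : `[0, y n]%classic `<=` D.
    by move=> s /=; rewrite in_itv/= unit_intervalE => /andP[-> sy]; rewrite (le_trans sy)// ltW; have /andP[] := xy n.
  have cvg := @ge0_nondecreasing_set_cvg_integral _ RT R (fun n => `[0, y n]%classic)
    (fun t => `|(f t)%:E|)%E leb.
  have sub1 : `[0, 1[%classic `<=` D.
    by move=> s /=; rewrite in_itv/= unit_intervalE => /andP[-> /ltW].
  rewrite -(@integral_itv_bndo_bndc R (BLeft 0) 1); last first.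
    exact: measurable_funS mD sub1 mabs.
  rewrite -UE; apply: (cvge_to_le (cvg _ _ _ _)) => //.
  - move=> n m nm; apply/subsetPset => s /=; rewrite !in_itv/= => /andP[-> sy].
    by rewrite (le_trans sy)// y_up.
  - by move=> n; apply: measurable_funS mD (sub n) mabs.
  - by near=> n; exact: key.
have [|[_ XI] leI] := emem_domZ nX ler01 (@measurable_cst _ _ RT _ D (int1 f)) eT.
  apply: (ae_imp _ (ae_neq 1)) => x x1 Dx; rewrite integral_ge0//= mul1e intle//.
  by move: Dx; rewrite unit_intervalE lt_neqAle x1 => /andP[].
have fin1 : int1 f \is a fin_num.
  have [x /andP[x0 x1] finx] := ae_exists ltr01 eT.1.
  have Dx : D x by rewrite unit_intervalE !ltW.
  rewrite ge0_fin_numE ?integral_ge0// (le_lt_trans (intle x Dx x1))//.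
  by have := finx Dx; rewrite ge0_fin_numE// tilde_ge0.
have Lf : L1 f by apply/(L1P mf); rewrite -ge0_fin_numE// integral_ge0.
split; first by split; [split|].
rewrite mul1r in leC leI.
have T0 := fnorm_ge0 nX eT.2.
rewrite /= ge_max; apply/andP; split.
  by rewrite (le_trans leC)// mulrDl mul1r lerDl mulr_ge0// invr_ge0 ltW.
rewrite L1_normE mulrDl mul1r ler_wpDl// mulrC ler_pdivlMr//.
apply: le_trans leI.
have [_] := ni_scale nX (fine (int1 f)) X1.
rewrite ger0_norm ?fine_ge0 ?integral_ge0// => <-.
suff -> : (fun x : RT => fine (int1 f) * cst 1 x) = fine \o cst (int1 f) by [].
by apply/funext => s /=; rewrite mulr1.
Unshelve. all: by end_near. Qed.

End cesaro_tandori.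

(** * Transport of mass to the right *)
Section transport.
Context (R : realType).
Local Notation leb := (@lebesgue_measure R).
Local Notation RT := (measurableTypeR R).
Local Open Scope ereal_scope.

Variables (f g theta : R -> R).
Hypotheses (mf : measurable_fun [set: RT] f) (mg : measurable_fun [set: RT] g).
Hypothesis mtheta : measurable_fun [set: RT] theta.
Hypotheses (g0 : forall t, (0 <= g t)%R) (theta0 : forall t, (0 <= theta t)%R).
Hypothesis f0 : forall s, ~ unit_interval R s -> f s = 0%R.

(** The mass [g t dt] is spread uniformly over the set of [s] reached from
    [t], and [transport] is the density of the result.  Mass with nowhere to
    go disappears, the inverse of a zero [reach_mass] being 0. *)
Definition reach (t s : R) : bool := (t <= s)%R && (theta t < `|f s|)%R.
Definition reach_mass (t : R) : \bar R := \int[leb]_s (if reach t s then 1 else 0).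
Definition transport (s : R) : \bar R :=
  \int[leb]_t (if reach t s then (g t / fine (reach_mass t))%:E else 0).

Let mfst : measurable_fun [set: RT * RT] (fun p => p.1) := @measurable_fst _ _ RT RT.
Let msnd : measurable_fun [set: RT * RT] (fun p => p.2) := @measurable_snd _ _ RT RT.

Let mreach : measurable_fun [set: RT * RT] (fun p => reach p.1 p.2).
Proof.
apply: measurable_and; first exact: measurable_fun_ler.
apply: measurable_fun_ltr; first exact: (measurableT_comp mtheta mfst).
by apply: measurableT_comp => //; exact: (measurableT_comp mf msnd).
Qed.

Let mreach' : measurable_fun [set: RT * RT] (fun p => reach p.2 p.1).
Proof. exact: (measurableT_comp mreach (@measurable_swap _ _ RT RT)). Qed.

Lemma reach_mass_ge0 t : 0 <= reach_mass t.
Proof. by apply: integral_ge0 => s _; case: ifP. Qed.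

Lemma reach_mass_le1 t : reach_mass t <= 1.
Proof.
apply: (@le_trans _ _ (\int[leb]_(s in `[0%R, 1%R]) 1)); last first.
  by rewrite integral_cst_itv// mul1e subr0.
rewrite integral_if; apply: ge0_le_integral => //.
- by move=> s _; case: ifP.
- exact: (measurable_kernel_row (b := reach) (h := fun _ _ => 1)).
- apply: measurable_fun_ifT => //; exact: measurable_mem.
move=> s _; case: (boolP (reach t s)) => [/andP[_ fs]|_]; last by case: ifP.
rewrite mem_set//.
apply: contrapT => nDs; move: fs; rewrite f0// normr0.
by rewrite ltNge theta0.
Qed.

Lemma reach_mass_fin t : (fine (reach_mass t))%:E = reach_mass t.
Proof.
rewrite fineK// ge0_fin_numE ?reach_mass_ge0//.
by rewrite (le_lt_trans (reach_mass_le1 t))// ltry.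
Qed.

Let m0 t : (0 <= fine (reach_mass t))%R.
Proof. by rewrite fine_ge0// reach_mass_ge0. Qed.

Lemma measurable_reach_mass : measurable_fun [set: RT] reach_mass.
Proof. exact: (measurable_int_kernel (b := reach) (h := fun _ _ => 1)). Qed.

Let mmass := measurable_reach_mass.

Let mw : measurable_fun [set: RT] (fun t => (g t / fine (reach_mass t))%:E).
Proof.
apply/measurable_EFinP; apply: measurable_funM => //.
apply: (measurableT_comp (@measurable_inv R)).
exact: measurableT_comp.
Qed.

Let w0 t : 0 <= (g t / fine (reach_mass t))%:E.
Proof. by rewrite lee_fin divr_ge0. Qed.

Lemma transport_ge0 s : 0 <= transport s.
Proof. by apply: integral_ge0 => t _; case: ifP. Qed.

Lemma measurable_transport : measurable_fun [set: RT] transport.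
Proof.
apply: (measurable_int_kernel (b := fun s t => reach t s)
  (h := fun s t => (g t / fine (reach_mass t))%:E)) => //.
exact: (measurableT_comp mw msnd).
Qed.

Lemma integral_transport (phi : R -> \bar R) : measurable_fun [set: RT] phi ->
  (forall s, 0 <= phi s) ->
  \int[leb]_s (phi s * transport s) =
  \int[leb]_t ((g t / fine (reach_mass t))%:E *
     \int[leb]_s (if reach t s then phi s else 0)).
Proof.
move=> mphi phi0.
pose h t s := (g t / fine (reach_mass t))%:E * phi s.
have h0 t s : 0 <= h t s by rewrite mule_ge0.
have mh : measurable_fun [set: RT * RT] (fun p => h p.1 p.2).
  by apply: emeasurable_funM; [exact: (measurableT_comp mw mfst)|
    exact: (measurableT_comp mphi msnd)].
transitivity (\int[leb]_s \int[leb]_t (if reach t s then h t s else 0)).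
  apply: eq_integral => s _; rewrite /transport -ge0_integralZl//.
  - by apply: eq_integral => t _; rewrite /h; case: ifP; rewrite ?mule0// muleC.
  - apply: (measurable_kernel_col (b := reach)
      (h := fun t s => (g t / fine (reach_mass t))%:E)) => //.
    exact: (measurableT_comp mw mfst).
  - by move=> t _; case: ifP.
rewrite -(tonelli_kernel mreach mh h0); apply: eq_integral => t _.
rewrite -ge0_integralZl//.
- by apply: eq_integral => s _; rewrite /h; case: ifP; rewrite ?mule0.
- apply: (measurable_kernel_row (b := reach) (h := fun t s => phi s)) => //.
  exact: (measurableT_comp mphi msnd).
- by move=> s _; case: ifP.
Qed.

Let int_reach_ge0 (phi : R -> \bar R) t : (forall s, 0 <= phi s) ->
  0 <= \int[leb]_s (if reach t s then phi s else 0).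
Proof. by move=> phi0; apply: integral_ge0 => s _; case: ifP. Qed.

Let mint_reach (phi : R -> \bar R) : measurable_fun [set: RT] phi ->
  (forall s, 0 <= phi s) ->
  measurable_fun [set: RT] (fun t => \int[leb]_s (if reach t s then phi s else 0)).
Proof.
move=> mphi phi0; apply: (measurable_int_kernel (b := reach) (h := fun t s => phi s)) => //.
exact: (measurableT_comp mphi msnd).
Qed.

Let mrow (phi : R -> \bar R) t : measurable_fun [set: RT] phi ->
  measurable_fun [set: RT] (fun s => if reach t s then phi s else 0).
Proof.
move=> mphi; apply: (measurable_kernel_row (b := reach) (h := fun t s => phi s)) => //.
exact: (measurableT_comp mphi msnd).
Qed.

Let cst_reach (c : R) t : (0 <= c)%R ->
  \int[leb]_s (if reach t s then c%:E else 0) = c%:E * reach_mass t.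
Proof.
move=> c0; rewrite /reach_mass -ge0_integralZl//.
- by apply: eq_integral => s _; case: ifP; rewrite ?mule1 ?mule0.
- exact: (mrow (phi := fun=> 1)).
- by move=> s _; case: ifP.
Qed.

(** The mass starting at [t] meets values of [phi] at most [c t] and does not
    grow. *)
Lemma integral_transport_le (phi : R -> \bar R) (c : R -> R) :
  measurable_fun [set: RT] phi -> (forall s, 0 <= phi s) ->
  measurable_fun [set: RT] c -> (forall t, 0 <= c t)%R ->
  (forall t s, reach t s -> phi s <= (c t)%:E) ->
  \int[leb]_s (phi s * transport s) <= \int[leb]_t (g t * c t)%:E.
Proof.
move=> mphi phi0 mc c0 phic; rewrite integral_transport//.
apply: ge0_le_integral => //.
- by move=> t _; rewrite mule_ge0// int_reach_ge0.
- by apply: emeasurable_funM => //; exact: mint_reach.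
- by apply/measurable_EFinP; exact: measurable_funM.
move=> t _; apply: (@le_trans _ _ ((g t / fine (reach_mass t))%:E *
    \int[leb]_s (if reach t s then (c t)%:E else 0))).
  apply: lee_wpmul2l => //; apply: ge0_le_integral => //.
  - by move=> s _; case: ifP.
  - exact: mrow.
  - exact: (mrow (phi := fun=> (c t)%:E)).
  by move=> s _; case: ifP => // /phic.
rewrite cst_reach// -reach_mass_fin -!EFinM lee_fin mulrCA mulrC.
rewrite ler_wpM2r// -mulrA ler_piMr//.
by have [->|m1] := eqVneq (fine (reach_mass t)) 0%R; rewrite ?mulr0 ?mulVf.
Qed.

(** The mass starting at [t] ends where [|f|] exceeds [theta t]. *)
Lemma integral_abs_transport_ge :
  \int[leb]_t (if 0 < reach_mass t then (theta t * g t)%:E else 0) <=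
  \int[leb]_s (`|(f s)%:E| * transport s).
Proof.
rewrite integral_transport//; last by apply/measurable_EFinP; exact: measurableT_comp.
apply: ge0_le_integral => //.
- by move=> t _; case: ifP => // _; rewrite lee_fin mulr_ge0.
- apply: measurable_fun_ifT => //.
    by apply: measurable_fun_lte.
  by apply/measurable_EFinP; exact: measurable_funM.
- apply: emeasurable_funM => //; apply: mint_reach => //.
  by apply/measurable_EFinP; exact: measurableT_comp.
move=> t _; case: ifPn => [mt|_]; last by rewrite mule_ge0// int_reach_ge0.
apply: (@le_trans _ _ ((g t / fine (reach_mass t))%:E *
    \int[leb]_s (if reach t s then (theta t)%:E else 0))).
  rewrite cst_reach// -reach_mass_fin -!EFinM lee_fin.
  have mn0 : (fine (reach_mass t) != 0)%R.
    by rewrite gt_eqF// -lte_fin reach_mass_fin.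
  by rewrite mulrCA -mulrA mulVf// mulr1.
apply: lee_wpmul2l => //; apply: ge0_le_integral => //.
- by move=> s _; case: ifP => // _; rewrite lee_fin.
- exact: (mrow (phi := fun=> (theta t)%:E)).
- by apply: mrow; apply/measurable_EFinP; exact: measurableT_comp.
by move=> s _; case: ifP => // /andP[_ /ltW]; rewrite lee_fin.
Qed.

End transport.

(** * The Koethe dual of the Copson space *)
Section antitone_copson.
Context (R : realType).
Local Notation leb := (@lebesgue_measure R).
Local Notation RT := (measurableTypeR R).
Variable D : set R.
Hypothesis mD : measurable D.
Hypothesis D_ge0 : forall x, D x -> 0 <= x.
Hypothesis D_down : forall x y, D y -> 0 <= x -> x <= y -> D x.
Local Open Scope ereal_scope.

(** By Tonelli the right-hand side pairs [g t] with the average of [F] over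
    [[0, t]], which is at least [F t] as [F] decreases. *)
Lemma integral_antitone_copson (F g : R -> \bar R) :
  measurable_fun [set: RT] F -> (forall x, 0 <= F x) ->
  (forall x y, (x <= y)%R -> F y <= F x) ->
  measurable_fun (D : set RT) g -> (forall x, D x -> 0 <= g x) ->
  \int[leb]_(x in D) (F x * g x) <= \int[leb]_(x in D) (F x * cop D g x).
Proof.
move=> mF F0 Fanti mg g0.
set g' := g \_ D.
have mg' : measurable_fun [set: RT] g' by exact/(measurable_restrictT _ _).1.
have g'0 x : 0 <= g' x by rewrite /g' patchE; case: ifPn => // /set_mem/g0.
have mV : measurable_fun [set: RT] (fun t : R => (t^-1)%:E).
  by apply/measurable_EFinP; exact: measurable_inv.
have g'V0 t : 0 <= g' t * (t^-1)%:E.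
  rewrite /g' patchE; case: ifPn => [/set_mem Dt|]; last by rewrite mul0e.
  by apply: mule_ge0; [exact: g0|rewrite lee_fin invr_ge0; exact: D_ge0].
pose b x t := (x \in D) && (x <= t)%R.
pose h x t := F x * (g' t * (t^-1)%:E).
have mb : measurable_fun [set: RT * RT] (fun p => b p.1 p.2).
  apply: measurable_and; last exact: measurable_fun_ler.
  exact: (measurableT_comp (measurable_mem mD) (@measurable_fst _ _ RT RT)).
have mh : measurable_fun [set: RT * RT] (fun p => h p.1 p.2).
  apply: emeasurable_funM; first exact: (measurableT_comp mF (@measurable_fst _ _ RT RT)).
  apply: emeasurable_funM; first exact: (measurableT_comp mg' (@measurable_snd _ _ RT RT)).
  exact: (measurableT_comp mV (@measurable_snd _ _ RT RT)).
have h0 x t : 0 <= h x t by rewrite mule_ge0.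
have -> : \int[leb]_(x in D) (F x * cop D g x) =
    \int[leb]_x \int[leb]_t (if b x t then h x t else 0).
  rewrite integral_if; apply: eq_integral => x _.
  rewrite copE /b; case: (x \in D) => /=; last by rewrite integral0.
  rewrite -ge0_integralZl//.
  - by apply: eq_integral => t _; case: ifP; rewrite ?mule0.
  - apply: measurable_fun_ifT => //; first exact: measurable_fun_ler.
    exact: emeasurable_funM.
  - by move=> t _; case: ifP.
rewrite (tonelli_kernel mb mh h0) integral_if.
apply: ae_ge0_le_integral => //.
- by move=> x _; case: ifPn => // /set_mem Dx; apply: mule_ge0 => //; exact: g0.
- apply: (eq_measurable_fun (fun x => F x * g' x)); last exact: emeasurable_funM.
  by move=> x _; rewrite /g' patchE; case: ifP; rewrite ?mule0.
- by move=> t _; apply: integral_ge0 => x _; case: ifP.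
- apply: (measurable_int_kernel (b := fun t x => b x t) (h := fun t x => h x t)) => //.
    exact: (measurableT_comp mb (@measurable_swap _ _ RT RT)).
  exact: (measurableT_comp mh (@measurable_swap _ _ RT RT)).
apply: (ae_imp _ (ae_neq 0%R)) => t t0 _; case: ifPn => [/set_mem Dt|_]; last first.
  by apply: integral_ge0 => x _; case: ifP.
have {}t0 : (0 < t)%R by rewrite lt0r t0; exact: D_ge0.
apply: (@le_trans _ _ (\int[leb]_(x in `[0%R, t]) (F t * (g t * (t^-1)%:E)))).
  rewrite integral_cst_itv ?(ltW t0)// subr0 -!muleA -EFinM mulVf ?gt_eqF//.
  by rewrite mule1.
rewrite integral_if; apply: ge0_le_integral => //.
- move=> x _; case: ifP => // _; apply: mule_ge0 => //.
  by apply: mule_ge0; [exact: g0|rewrite lee_fin invr_ge0 ltW].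
- apply: measurable_fun_ifT => //; apply: measurable_mem; exact: measurable_itv.
- exact: (measurable_kernel_col (b := b) (h := h)).
move=> x _; rewrite mem_setE in_itv/=; case: ifPn => [/andP[x0 xt]|_]; last by case: ifP.
have Dx := D_down Dt x0 xt.
rewrite /b mem_set// xt /= /h /g' patchE mem_set//.
apply: lee_wpmul2r; last exact: Fanti.
by apply: mule_ge0; [exact: g0|rewrite lee_fin invr_ge0 ltW].
Qed.
End antitone_copson.

Section kothe.
Context (R : realType).
Local Notation leb := (@lebesgue_measure R).
Local Notation RT := (measurableTypeR R).
Local Notation D := (unit_interval R).
Local Notation C := (@cesaro_op R).
Local Notation Cs := (copson_op D).
Local Notation int1 f := (\int[leb]_(t in D) `|(f t)%:E|)%E.
Let mD := @measurable_unit_interval R.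
Let D_ge0 := @unit_interval_ge0 R.
Let D_down := @unit_interval_down R.

Variable X : fspace leb D.
Hypothesis bX : banach_ideal_space (X : @fspace _ RT R leb D).
Let nX := banach_normed_ideal bX.

Lemma le_kothe (Y : fspace leb D) (f g : R -> R) : Y g -> fnorm Y g <= 1 ->
  (\int[leb]_(x in D) `|f x * g x|%:E <= kothe_dual_norm Y f)%E.
Proof. by move=> Yg ng; apply: ereal_sup_ubound; exists g. Qed.

Lemma kothe_le (Y : fspace leb D) (f : R -> R) (c : \bar R) :
  (forall g, Y g -> fnorm Y g <= 1 ->
    (\int[leb]_(x in D) `|f x * g x|%:E <= c)%E) -> (kothe_dual_norm Y f <= c)%E.
Proof. by move=> H; apply: ge_ereal_sup => _ [g [Yg ng] <-]; exact: H. Qed.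

Lemma kothe_ge0 (Y : fspace leb D) (f g : R -> R) : Y g -> fnorm Y g <= 1 ->
  (0 <= kothe_dual_norm Y f)%E.
Proof.
by move=> Yg ng; apply: le_trans (le_kothe f Yg ng); exact: integral_ge0.
Qed.

Lemma cst0_unit_ball : X (cst 0) /\ fnorm X (cst 0) <= 1.
Proof.
have [w Xw _] := bis_weight bX; have [X0 n0] := ni_scale nX 0 Xw.
have -> : cst 0 = (fun x : R => 0 * w x) by apply/funext => x; rewrite mul0r.
by split=> //; rewrite n0 normr0 mul0r ler01.
Qed.

Lemma tandori_embeds_kothe :
  embeds_with 1 (tandori_space (kothe_dual X)) (kothe_dual (copson_space X)).
Proof.
move=> f [mf [finF [mF NF]]]; set F := tilde_op D f in finF mF NF.
have key : (kothe_dual_norm (copson_space X) f <= kothe_dual_norm X (fine \o F))%E.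
  apply: kothe_le => g [mg [fing Xg]] ng.
  have mng : measurable_fun (D : set RT) (fun x => `|g x|) by exact: measurableT_comp.
  apply: le_trans (le_kothe (fine \o F) Xg ng).
  have mFT : measurable_fun [set: RT] F by exact: measurable_tilde.
  have mG : measurable_fun (D : set RT) (EFin \o (fun x => `|g x|)).
    exact/measurable_EFinP.
  have mCs := measurable_copson mD D_ge0 mng (fun x => normr_ge0 (g x)).
  have le1 : (\int[leb]_(x in D) `|f x * g x|%:E <=
      \int[leb]_(x in D) (F x * (EFin \o (fun x => `|g x|%R)) x))%E.
    apply: ae_ge0_le_integral => //.
    - by apply/measurable_EFinP; apply: measurableT_comp => //; exact: measurable_funM.
    - by move=> x _; rewrite mule_ge0 ?tilde_ge0// lee_fin.
    - by apply: emeasurable_funM => //; exact: measurable_funTS.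
    apply: (ae_imp _ (abs_le_tilde f (@unit_lbound R))) => x le Dx.
    by rewrite normrM EFinM lee_wpmul2r ?lee_fin ?le.
  apply: (le_trans le1).
  apply: le_trans (integral_antitone_copson mD D_ge0 D_down mFT _ _ mG _) _.
  - by move=> x; exact: tilde_ge0.
  - by move=> x y; exact: tilde_anti.
  - by move=> x _; rewrite lee_fin.
  apply: ae_ge0_le_integral => //.
  - by move=> x Dx; rewrite mule_ge0 ?tilde_ge0// (copson_ge0 D_ge0 (fun x => normr_ge0 (g x))).
  - by apply: emeasurable_funM => //; exact: measurable_funTS.
  - apply/measurable_EFinP; apply: measurableT_comp => //; apply: measurable_funM => //.
    exact: measurableT_comp.
  apply: (ae_imp2 _ finF fing) => x finFx fingx Dx.
  rewrite -(fineK (finFx Dx)) -[cop _ _ _](fineK (fingx Dx)) -EFinM lee_fin.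
  exact: ler_norm.
have [X0 n0] := cst0_unit_ball; have N0 := kothe_ge0 (fine \o F) X0 n0.
have E0 : Cs (fun x => `|cst (0 : R) x|) = (fun=> 0%E).
  by rewrite funeqE => x; apply: integral0_eq => t _; rewrite normr0 mul0r.
have CX0 : copson_space X (cst 0).
  by split=> //; rewrite E0; split=> //; exact: nearW.
have n1 : fnorm (copson_space X) (cst 0) <= 1 by rewrite /= E0.
have M0 := kothe_ge0 f CX0 n1.
split; first by split=> //; rewrite (le_lt_trans key).
rewrite mul1r /= fine_le// ge0_fin_numE//; exact: le_lt_trans key NF.
Qed.

End kothe.

Section kothe_converse.
Context (R : realType).
Local Notation leb := (@lebesgue_measure R).
Local Notation RT := (measurableTypeR R).
Local Notation D := (unit_interval R).
Local Notation C := (@cesaro_op R).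
Local Notation Cs := (copson_op D).
Local Notation int1 f := (\int[leb]_(t in D) `|(f t)%:E|)%E.
Let mD := @measurable_unit_interval R.
Let D_ge0 := @unit_interval_ge0 R.
Let D_down := @unit_interval_down R.

Variable X : fspace leb D.
Hypothesis bX : banach_ideal_space (X : @fspace _ RT R leb D).
Let nX := banach_normed_ideal bX.
Variables A B K1 : R.
Hypotheses (bC : nonneg_bound A X C) (bCs : nonneg_bound B X Cs).
Hypothesis XL1 : forall f, X f -> (int1 f <= (K1 * fnorm X f)%:E)%E.

Let zero_ext (f : R -> R) := f \_ D.

Let mzero_ext (f : R -> R) : measurable_fun (D : set RT) f ->
  measurable_fun [set: RT] (zero_ext f).
Proof. by move=> mf; exact/(measurable_restrictT _ _).1. Qed.

(** [C* u (x)] is the integral of [u] against [1 / s] on [s >= x].  Mass starting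
    at [t] arrives at some [s >= t], so it is weighted by at most [1 / x] when
    [t <= x] and [1 / t] otherwise: these are the weights of [C g + C* g]. *)
Lemma copson_transport (f theta g : R -> R) x :
  measurable_fun (D : set RT) f -> measurable_fun [set: RT] theta ->
  (forall t, 0 <= theta t) ->
  measurable_fun (D : set RT) g -> (forall t, 0 <= g t) -> D x -> 0 < x ->
  (cop D (transport (zero_ext f) (zero_ext g) theta) x <= C g x + Cs g x)%E.
Proof.
move=> mf mth th0 mg g0 Dx x0.
set u := transport _ _ _.
have g'0 t : 0 <= zero_ext g t by rewrite /zero_ext patchE; case: ifP.
have f'0 s : ~ D s -> zero_ext f s = 0.
  by move=> nDs; rewrite /zero_ext patchE memNset.
have mg' := mzero_ext mg; have mf' := mzero_ext mf.
have u0 s : (0 <= u s)%E by exact: transport_ge0.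
have mu_ : measurable_fun [set: RT] u by exact: measurable_transport.
have V0 t : x <= t -> 0 <= t^-1 by move=> xt; rewrite invr_ge0 (le_trans (ltW x0)).
pose phi s := if x <= s then (s^-1)%:E else 0%E.
pose c t := if t <= x then x^-1 else t^-1.
have mV : measurable_fun [set: RT] (fun t : R => t^-1) by exact: measurable_inv.
have mphi : measurable_fun [set: RT] phi.
  by apply: measurable_fun_ifT => //; [exact: measurable_fun_ler|exact/measurable_EFinP].
have phi0 s : (0 <= phi s)%E by rewrite /phi; case: ifP => // xs; rewrite lee_fin V0.
have mc : measurable_fun [set: RT] c.
  by apply: measurable_fun_ifT => //; exact: measurable_fun_ler.
have c0 t : 0 <= c t.
  rewrite /c; case: (leP t x) => [_|xt]; first by rewrite invr_ge0 ltW.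
  exact/V0/ltW.
have phic t s : reach (zero_ext f) theta t s -> (phi s <= (c t)%:E)%E.
  move=> /andP[ts _]; rewrite /phi; case: ifPn => xs; last by rewrite lee_fin.
  have s0 := lt_le_trans x0 xs.
  rewrite lee_fin /c; case: (leP t x) => tx; rewrite lef_pV2// posrE.
  exact: lt_trans tx.
apply: (@le_trans _ _ (\int[leb]_s (phi s * u s)))%E.
  rewrite /cop integral_if; apply: ge0_le_integral => //.
  - move=> s _; case: ifPn => // /set_mem[Ds _].
    by apply: mule_ge0 => //; rewrite lee_fin invr_ge0; exact: D_ge0.
  - apply: measurable_fun_ifT => //; first by apply: measurable_mem; exact: measurableI.
    by apply: emeasurable_funM => //; exact/measurable_EFinP.
  - exact: emeasurable_funM.
  move=> s _; case: ifPn => [/set_mem[Ds /=]|_]; last exact: mule_ge0.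
  by rewrite in_itv/= andbT /phi => ->; rewrite muleC.
apply: (le_trans (integral_transport_le mf' mg' mth g'0 th0 f'0 mphi phi0 mc c0 phic)).
have mEg : measurable_fun (D : set RT) (EFin \o g) by exact/measurable_EFinP.
have Eg0 t : D t -> (0 <= (EFin \o g) t)%E by move=> _; rewrite lee_fin.
rewrite -[C g x]/(cav (EFin \o g) x) -[Cs g x]/(cop D (EFin \o g) x).
rewrite /cav (int_head D_ge0 D_down _ Dx) copE.
set g' := (EFin \o g) \_ D.
have g'E t : g' t = (zero_ext g t)%:E.
  by rewrite /g' /zero_ext !patchE; case: ifP.
have mEg' : measurable_fun [set: RT] g'.
  by rewrite (funext g'E); exact/measurable_EFinP.
have g'ge0 t : (0 <= g' t)%E by rewrite g'E lee_fin.
have mhead : measurable_fun [set: RT] (fun t => if t <= x then g' t else 0%E).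
  by apply: measurable_fun_ifT => //; exact: measurable_fun_ler.
have mtail : measurable_fun [set: RT]
    (fun t => if x <= t then (g' t * (t^-1)%:E)%E else 0%E).
  apply: measurable_fun_ifT => //; first exact: measurable_fun_ler.
  by apply: emeasurable_funM => //; exact/measurable_EFinP.
have tail0 t : (0 <= if (x <= t)%R then (g' t * (t^-1)%:E)%E else 0)%E.
  by case: ifP => // xt; rewrite mule_ge0// lee_fin V0.
have head0 t : (0 <= (x^-1)%:E * (if (t <= x)%R then g' t else 0))%E.
  by rewrite mule_ge0 ?lee_fin ?invr_ge0 ?(ltW x0)//; case: ifP.
have -> : ((x^-1)%:E * \int[leb]_t (if (t <= x)%R then g' t else 0) =
    \int[leb]_t ((x^-1)%:E * (if (t <= x)%R then g' t else 0)))%E.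
  apply/esym/ge0_integralZl => //; first by move=> t _; case: ifP.
  by rewrite lee_fin invr_ge0 ltW.
rewrite -(@ge0_integralD _ RT R leb setT)//; last exact: measurable_funeM.
apply: ge0_le_integral => //.
- by move=> t _; rewrite lee_fin mulr_ge0.
- by apply/measurable_EFinP; exact: measurable_funM.
- by apply: emeasurable_funD => //; exact: measurable_funeM.
move=> t _; rewrite /c; case: (leP t x) => tx.
  by rewrite mulrC EFinM -g'E leeDl.
by rewrite mule0 add0e (ltW tx) EFinM g'E.
Qed.

(** The transported mass is an admissible test function for the Koethe dual
    norm of [f], and testing [f] against it is as good as testing [theta]
    against [g].  The condition on [reach_mass] says that no mass is lost where
    it matters. *)
Lemma kothe_truncated (f theta g : R -> R) :
  kothe_dual (copson_space X) f ->
  measurable_fun [set: RT] theta -> (forall t, 0 <= theta t) ->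
  (forall t, D t -> reach_mass (zero_ext f) theta t = 0%E -> theta t = 0) ->
  X g -> (forall t, 0 <= g t) -> (A + B) * fnorm X g <= 1 ->
  (\int[leb]_(t in D) (theta t * g t)%:E <= kothe_dual_norm (copson_space X) f)%E.
Proof.
move=> [mf Nf] mth th0 thM Xg g0 ng.
have mg := ni_measurable nX Xg.
have g'0 t : 0 <= zero_ext g t by rewrite /zero_ext patchE; case: ifP.
have f'0 s : ~ D s -> zero_ext f s = 0.
  by move=> nDs; rewrite /zero_ext patchE memNset.
have mg' := mzero_ext mg; have mf' := mzero_ext mf.
set u := transport (zero_ext f) (zero_ext g) theta.
have u0 s : (0 <= u s)%E by exact: transport_ge0.
have mu_ : measurable_fun [set: RT] u by exact: measurable_transport.
have uint : (\int[leb]_s u s < +oo)%E.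
  have := @integral_transport_le R _ _ _ mf' mg' mth g'0 th0 f'0 (fun=> 1%E) (fun=> 1).
  under eq_integral do rewrite mul1e.
  move/(_ _ _ _ _ _)/le_lt_trans; apply => //.
  apply: (@le_lt_trans _ _ (int1 g)); last first.
    by rewrite (le_lt_trans (XL1 Xg)) ?ltry.
  rewrite [leRHS]integral_mkcond; apply: ge0_le_integral => //.
  - by move=> t _; rewrite mulr1 lee_fin.
  - by apply/measurable_EFinP; apply: measurable_funM.
  - apply/(measurable_restrictT _ _).1 => //.
    by apply/measurable_EFinP; exact: measurableT_comp.
  move=> t _; rewrite mulr1 /zero_ext !patchE; case: ifP => // _.
  by rewrite lee_fin ler_norm.
have finu : \forall s \ae leb, u s \is a fin_num.
  have iu : leb.-integrable setT u.
    by apply/integrableP; split=> //; under eq_integral do rewrite gee0_abs//.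
  by apply: (ae_imp _ (integrable_ae measurableT iu)) => s; apply.
pose v := fine \o u.
have v0 s : 0 <= v s by rewrite fine_ge0.
have mv : measurable_fun [set: RT] v by exact: measurableT_comp.
have mvD : measurable_fun (D : set RT) v by exact: measurable_funTS.
have leCs x : D x -> 0 < x -> (Cs (fun s => `|v s|%R) x <= C g x + Cs g x)%E.
  move=> Dx x0; apply: le_trans (copson_transport mf mth th0 mg g0 Dx x0).
  apply: (@cop_ae_le R D mD D_ge0 (EFin \o (fun s => `|v s|)) u) => //.
  - by apply/measurable_EFinP; apply: measurableT_comp.
  - by apply: measurable_funTS.
  - by move=> t _; rewrite lee_fin.
  by apply: (ae_imp _ finu) => s fs _; rewrite /= (ger0_norm (v0 s)) /v /= fineK.
have mnv : measurable_fun (D : set RT) (fun s => `|v s|) by exact: measurableT_comp.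
have mCs := measurable_copson mD D_ge0 mnv (fun s => normr_ge0 (v s)).
have [eCg leCg] := bC g0 Xg; have [eCsg leCsg] := bCs g0 Xg.
have [|eCv leCv] := emem_domD nX mCs eCg eCsg.
  apply: (ae_imp _ (ae_neq 0)) => x x0 Dx.
  rewrite (copson_ge0 D_ge0 (fun s => normr_ge0 (v s)))/= leCs// lt0r x0.
  exact: D_ge0.
have Cv : copson_space X v by [].
have nv : fnorm (copson_space X) v <= 1.
  by rewrite (le_trans leCv)// (le_trans _ ng)// mulrDl lerD.
apply: le_trans (le_kothe f Cv nv).
apply: (@le_trans _ _ (\int[leb]_t (if (0 < reach_mass (zero_ext f) theta t)%E
    then (theta t * zero_ext g t)%:E else 0)))%E.
  rewrite integral_mkcond; apply: ge0_le_integral => //.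
  - by move=> t _; rewrite patchE; case: ifP => // _; rewrite lee_fin mulr_ge0.
  - apply/(measurable_restrictT _ _).1 => //; apply/measurable_EFinP.
    by apply: measurable_funM => //; exact: measurable_funTS.
  - apply: measurable_fun_ifT => //.
      by apply: measurable_fun_lte => //; exact: measurable_reach_mass.
    by apply/measurable_EFinP; exact: measurable_funM.
  move=> t _; rewrite patchE; case: ifPn => [/set_mem Dt|_]; last by case: ifP => // _; rewrite lee_fin mulr_ge0.
  have [M0|M0] := eqVneq (reach_mass (zero_ext f) theta t) 0%E.
    by rewrite (thM _ Dt M0) mul0r; case: ifP => //; rewrite mul0r.
  by rewrite lt0e M0 reach_mass_ge0 /zero_ext patchE mem_set.
apply: (le_trans (integral_abs_transport_ge mf' mg' mth g'0 th0 f'0)).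
rewrite [leRHS]integral_mkcond; apply: ae_ge0_le_integral => //.
- by move=> s _; apply: mule_ge0.
- by apply: emeasurable_funM => //; apply/measurable_EFinP; exact: measurableT_comp.
- by move=> s _; rewrite patchE; case: ifP => // _; rewrite lee_fin.
- apply/(measurable_restrictT _ _).1 => //; apply/measurable_EFinP.
  by apply: measurableT_comp => //; exact: measurable_funM.
apply: (ae_imp _ finu) => s fs _; rewrite /zero_ext !patchE.
case: ifPn => Ds; last by rewrite /= normr0 mul0e.
by rewrite normrM EFinM (ger0_norm (v0 s)) /v/= fineK.
Qed.

End kothe_converse.

Lemma limn_truncated (R : realType) (F : \bar R) (g : R) : (0 <= F)%E -> 0 <= g ->
  limn (fun n : nat => (fine (Order.min F n%:R%:E) * g)%:E) = (F * g%:E)%E.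
Proof.
case: F => [r| |]//.
  move=> r0 g0; apply/cvg_lim => //; apply: cvg_near_cst.
  near=> n; have -> : Order.min r%:E n%:R%:E = r%:E.
    by apply/min_idPl; rewrite lee_fin; near: n; exact: nbhs_infty_ger.
  by rewrite EFinM.
move=> _; rewrite le_eqVlt => /predU1P[<-|g0].
  by under eq_fun do rewrite mulr0; rewrite lim_cst ?mule0.
rewrite gt0_mulye ?lte_fin//; apply/cvg_lim => //; apply/cvgeyPge => A.
near=> n; rewrite min_r ?leey//= lee_fin -ler_pdivrMr//.
by near: n; exact: nbhs_infty_ger.
Unshelve. all: by end_near. Qed.

Section kothe_converse_limit.
Context (R : realType).
Local Notation leb := (@lebesgue_measure R).
Local Notation RT := (measurableTypeR R).
Local Notation D := (unit_interval R).
Local Notation C := (@cesaro_op R).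
Local Notation Cs := (copson_op D).
Local Notation int1 f := (\int[leb]_(t in D) `|(f t)%:E|)%E.
Let mD := @measurable_unit_interval R.
Let D_ge0 := @unit_interval_ge0 R.

Variable X : fspace leb D.
Hypothesis bX : banach_ideal_space (X : @fspace _ RT R leb D).
Let nX := banach_normed_ideal bX.
Variables A B K1 : R.
Hypotheses (A0 : 0 < A) (B0 : 0 < B).
Hypotheses (bC : nonneg_bound A X C) (bCs : nonneg_bound B X Cs).
Hypothesis XL1 : forall f, X f -> (int1 f <= (K1 * fnorm X f)%:E)%E.

(** Nothing reached from [t] means that [|f|] is almost everywhere at most
    [theta t] to the right of [t]. *)
Lemma tilde_le_reach (f theta : R -> R) t : measurable_fun (D : set RT) f ->
  measurable_fun [set: RT] theta -> 0 <= theta t ->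
  reach_mass (f \_ D) theta t = 0%E -> (tilde_op D f t <= (theta t)%:E)%E.
Proof.
move=> mf mth th0 M0; apply: tilde_le => //.
have mf' : measurable_fun [set: RT] (f \_ D) by exact/(measurable_restrictT _ _).1.
have mh : measurable_fun [set: RT]
    (fun s => if reach (f \_ D) theta t s then 1%E else 0%E : \bar R).
  apply: measurable_fun_ifT => //; apply: measurable_and.
    exact: measurable_fun_ler.
  by apply: measurable_fun_ltr => //; exact: measurableT_comp.
have : ae_eq leb setT
    (fun s => if reach (f \_ D) theta t s then 1%E else 0%E : \bar R) (cst 0%E).
  apply/(ae_eq_integral_abs leb measurableT mh); rewrite -[RHS]M0.
  by apply: eq_integral => s _; case: ifP; rewrite ?abse1 ?abse0.
apply: ae_imp => s /(_ I) h Ds ts; rewrite leNgt; apply/negP => fs.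
move: h; rewrite /reach ts patchE mem_set//= -lte_fin fs => /eqP.
by rewrite onee_eq0.
Qed.

Variable f : R -> R.
Hypothesis Xf : kothe_dual (copson_space X) f.
Let N := kothe_dual_norm (copson_space X) f.
Let F := tilde_op D f.

(** The thresholds are [min(F, n) / 2]: finite because of the truncation, and
    strictly below [F] wherever they do not vanish, so that every such point
    reaches a set of positive measure.  Halving costs the factor 2, and the
    truncation is removed by monotone convergence. *)
Lemma integral_tilde_small (g : R -> R) : X g -> (forall t, 0 <= g t) ->
  (A + B) * fnorm X g <= 1 ->
  (\int[leb]_(t in D) (F t * (g t)%:E) <= 2%:E * N)%E.
Proof.
move=> Xg g0 ng; have [mf _] := Xf.
have mg := ni_measurable nX Xg.
pose m (n : nat) t := fine (Order.min (F t) n%:R%:E).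
have n0 (n : nat) : (0 <= n%:R%:E :> \bar R)%E by rewrite lee_fin.
have min0 (n : nat) t : (0 <= Order.min (F t) n%:R%:E)%E by rewrite le_min tilde_ge0 n0.
have minfin (n : nat) t : Order.min (F t) n%:R%:E \is a fin_num.
  rewrite ge0_fin_numE// (@le_lt_trans _ _ n%:R%:E) ?ltry//.
  by rewrite ge_min lexx orbT.
have m0 n t : 0 <= m n t by rewrite fine_ge0.
have mm n : measurable_fun [set: RT] (m n).
  apply: measurableT_comp => //; apply: measurable_mine => //.
  exact: measurable_tilde.
have step n : (\int[leb]_(t in D) (m n t * g t)%:E <= 2%:E * N)%E.
  have -> : (\int[leb]_(t in D) (m n t * g t)%:E =
      2%:E * \int[leb]_(t in D) (m n t / 2 * g t)%:E)%E.
    rewrite -ge0_integralZl//.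
    - by apply: eq_integral => t _; rewrite -EFinM; congr (_%:E); field.
    - apply/measurable_EFinP; apply: measurable_funM => //.
      by apply: measurable_funM => //; exact: measurable_funTS.
    - by move=> t _; rewrite lee_fin mulr_ge0// divr_ge0.
  apply: lee_wpmul2l => //.
  apply: (kothe_truncated bX bC bCs XL1 Xf) => //.
  - exact: measurable_funM.
  - by move=> t; rewrite divr_ge0.
  move=> t _ M0.
  have mth : measurable_fun [set: RT] (fun t => m n t / 2) by exact: measurable_funM.
  have := tilde_le_reach mf mth (divr_ge0 (m0 n t) (ler0n _ 2)) M0; rewrite -/F => le.
  have : m n t <= m n t / 2.
    rewrite -lee_fin (le_trans _ le)// /m fineK// ge_min lexx//.
  move=> le2; apply/eqP; rewrite mulf_eq0 invr_eq0 (pnatr_eq0 _ 2) orbF eq_le m0 andbT.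
  lra.
have -> : (\int[leb]_(t in D) (F t * (g t)%:E) =
    \int[leb]_(t in D) limn (fun n => (m n t * g t)%:E))%E.
  by apply: eq_integral => t _; rewrite /m limn_truncated ?tilde_ge0.
rewrite (@monotone_convergence _ RT R leb D mD (fun n t => (m n t * g t)%:E)).
- apply: lime_le; last by near=> n; exact: step.
  apply: ereal_nondecreasing_is_cvgn => i j ij; apply: ge0_le_integral => //.
  + by move=> t _; rewrite lee_fin mulr_ge0.
  + by apply/measurable_EFinP; apply: measurable_funM => //; exact: measurable_funTS.
  + by apply/measurable_EFinP; apply: measurable_funM => //; exact: measurable_funTS.
  move=> t _; rewrite lee_fin ler_wpM2r// /m fine_le//.
  by rewrite le_min ge_min lexx/= ge_min lee_fin ler_nat ij orbT.
- by move=> n; apply/measurable_EFinP; apply: measurable_funM => //; exact: measurable_funTS.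
- by move=> n t _; rewrite lee_fin mulr_ge0.
- move=> t _ i j ij; rewrite lee_fin ler_wpM2r// /m fine_le//.
  by rewrite le_min ge_min lexx/= ge_min lee_fin ler_nat ij orbT.
Unshelve. all: by end_near. Qed.

Lemma integral_tilde_bound (g : R -> R) : X g -> (forall t, 0 <= g t) ->
  fnorm X g <= 1 -> (\int[leb]_(t in D) (F t * (g t)%:E) <= (2 * (A + B))%:E * N)%E.
Proof.
move=> Xg g0 ng; set K := A + B; have K0 : 0 < K by rewrite addr_gt0.
have [XKg nKg] := ni_scale nX K^-1 Xg.
have small : (A + B) * fnorm X (fun x => K^-1 * g x) <= 1.
  by rewrite nKg gtr0_norm ?invr_gt0// mulrA divff ?mul1r// gt_eqF.
have Kg0 t : 0 <= K^-1 * g t by rewrite mulr_ge0// invr_ge0 ltW.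
have le := integral_tilde_small XKg Kg0 small.
have -> : (\int[leb]_(t in D) (F t * (g t)%:E) =
    K%:E * \int[leb]_(t in D) (F t * (K^-1 * g t)%:E))%E.
  rewrite -ge0_integralZl//.
  - apply: eq_integral => t _; rewrite muleCA -EFinM.
    by rewrite mulrA divff ?mul1r// gt_eqF.
  - apply: emeasurable_funM; first exact: measurable_tilde.
    apply/measurable_EFinP; apply: measurable_funM => //.
    exact: (ni_measurable nX Xg).
  - by move=> t _; rewrite mule_ge0 ?tilde_ge0// lee_fin mulr_ge0// invr_ge0 ltW.
  - by rewrite lee_fin ltW.
rewrite (mulrC 2) EFinM -muleA; apply: lee_wpmul2l => //.
by rewrite lee_fin ltW.
Qed.

Lemma kothe_tandori : tandori_space (kothe_dual X) f /\
  fnorm (tandori_space (kothe_dual X)) f <=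
    2 * (A + B) * fnorm (kothe_dual (copson_space X)) f.
Proof.
have [mf Nfin] := Xf.
have K0 : 0 < 2 * (A + B) by rewrite mulr_gt0// addr_gt0.
have mF : measurable_fun (D : set RT) F by exact: measurable_tilde.
have Nf : ((2 * (A + B))%:E * N < +oo)%E by rewrite lte_mul_pinfty// lee_fin ltW.
(* [F] times a multiple of the weight is integrable, and the weight does not
   vanish. *)
have finF : \forall x \ae leb, D x -> F x \is a fin_num.
  have [w Xw w0] := bis_weight bX.
  have [Xnw nnw] := mem_abs nX Xw.
  have n0 := fnorm_ge0 nX Xw.
  pose c := (fnorm X w + 1)^-1; have c0 : 0 < c by rewrite invr_gt0 ltr_wpDl.
  have [Xcw ncw] := ni_scale nX c Xnw.
  have ncw1 : fnorm X (fun x => c * `|w x|) <= 1.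
    by rewrite ncw nnw gtr0_norm// mulrC ler_pdivrMr ?mul1r ?lerDl ?ler01// ltr_wpDl.
  have cw0 t : 0 <= c * `|w t| by rewrite mulr_ge0// ltW.
  have le := integral_tilde_bound Xcw cw0 ncw1.
  have mFw : measurable_fun (D : set RT) (fun t => F t * (c * `|w t|)%:E)%E.
    apply: emeasurable_funM => //; apply/measurable_EFinP.
    exact: (ni_measurable nX Xcw).
  have iFw : leb.-integrable D (fun t => F t * (c * `|w t|)%:E)%E.
    apply/integrableP; split=> //; apply: le_lt_trans Nf; apply: le_trans le.
    apply: ge0_le_integral => //.
    - exact: measurableT_comp.
    - by move=> t _; rewrite gee0_abs// mule_ge0 ?tilde_ge0// lee_fin.
  apply: (ae_imp _ (integrable_ae mD iFw)) => t fin Dt.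
  have {fin} := fin Dt; have ct : 0 < c * `|w t| by rewrite mulr_gt0// normr_gt0 gt_eqF ?w0.
  have := tilde_ge0 D f t; rewrite -/F; case: (F t) => [r| |]//.
  by rewrite gt0_mulye ?lte_fin.
have key : (kothe_dual_norm X (fine \o F) <= (2 * (A + B))%:E * N)%E.
  apply: kothe_le => g Xg ng; have [Xng nng] := mem_abs nX Xg.
  rewrite -nng in ng; apply: le_trans (integral_tilde_bound Xng _ ng) => //.
  have mg := ni_measurable nX Xg.
  apply: ae_ge0_le_integral => //.
  - apply/measurable_EFinP; apply: measurableT_comp => //; apply: measurable_funM => //.
    exact: measurableT_comp.
  - by move=> t _; rewrite mule_ge0 ?tilde_ge0// lee_fin.
  - by apply: emeasurable_funM => //; apply/measurable_EFinP; exact: measurableT_comp.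
  apply: (ae_imp _ finF) => t fin Dt.
  by rewrite normrM EFinM lee_wpmul2r ?lee_fin// /= ger0_norm ?fine_ge0 ?tilde_ge0// fineK ?fin.
have [X0 n0] := cst0_unit_ball bX; have N0 := kothe_ge0 (fine \o F) X0 n0.
have keyfin := le_lt_trans key Nf.
split; first by split=> //; split=> //; split=> //; exact: measurableT_comp.
have N0' : (0 <= N)%E.
  by rewrite -(@pmule_rge0 _ (2 * (A + B))%:E)// (le_trans N0).
rewrite /= -lee_fin EFinM fineK ?ge0_fin_numE// fineK// ge0_fin_numE//.
Qed.

End kothe_converse_limit.

(** * Hardy's inequality *)
Section power_integrals.
Context (R : realType).
Local Notation leb := (@lebesgue_measure R).
Local Notation RT := (measurableTypeR R).

Lemma is_derive_affine_powR (c d r t : R) : 0 < c + d * t ->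
  is_derive t 1 (fun t => (c + d * t) `^ r) (r * (c + d * t) `^ (r - 1) * d).
Proof.
move=> pos; have H := @is_derive1_powR R r _ pos.
have K : is_derive t 1 (fun t : R => c + d * t) d.
  rewrite -[X in is_derive _ _ _ X]add0r; apply: is_deriveD.
  by have := is_deriveZ d (is_derive_id t 1); rewrite /GRing.scale /= mulr1.
exact: (@is_derive1_comp R (fun a => a `^ r) (fun t => c + d * t) t _ _ H K).
Qed.

Lemma integral_affine_powR (c d r a b : R) : r != 0 -> d != 0 -> a < b ->
  (forall t, a <= t <= b -> 0 < c + d * t) ->
  (\int[leb]_(t in `[a, b]) ((c + d * t) `^ (r - 1))%:E =
   (((c + d * b) `^ r - (c + d * a) `^ r) / (r * d))%:E)%E.
Proof.
move=> r0 d0 ab pos.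
pose F t := (c + d * t) `^ r / (r * d).
have dF t : a <= t <= b -> is_derive t 1 F ((c + d * t) `^ (r - 1)).
  move=> /pos/(is_derive_affine_powR r) H.
  have -> : (c + d * t) `^ (r - 1) =
      (r * d)^-1 *: (r * (c + d * t) `^ (r - 1) * d).
    by rewrite /GRing.scale/=; field; rewrite r0 d0.
  have -> : F = (r * d)^-1 \*: (fun t => (c + d * t) `^ r).
    by apply/funext => s; rewrite /F mulrC.
  exact: is_deriveZ.
have cF t : a <= t <= b -> F x @[x --> t] --> F t.
  move=> /dF[+ _] => /derivable1_diffP/differentiable_continuous; exact.
rewrite (@continuous_FTC2 R _ F a b ab).
- by rewrite -EFinB /F -mulrBl.
- apply: derivable_within_continuous => t; rewrite in_itv/= => /pos.
  by move=> /(is_derive_affine_powR (r - 1))[].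
- split.
  + by move=> t; rewrite in_itv/= => /andP[/ltW at_ /ltW tb];
      have [] := dF t; rewrite ?at_ ?tb.
  + by apply: cvg_at_right_filter; apply: cF; rewrite lexx ltW.
  + by apply: cvg_at_left_filter; apply: cF; rewrite lexx ltW.
- move=> t; rewrite in_itv/= => /andP[/ltW at_ /ltW tb].
  by rewrite derive1E; have [|_ ->] := dF t; rewrite ?at_ ?tb.
Qed.

Lemma integral_powR_le (r x : R) : 0 < r -> 0 < x ->
  (\int[leb]_(t in `[0%R, x]) (t `^ (r - 1))%:E <= (x `^ r / r)%:E)%E.
Proof.
move=> r0 x0.
have mpow (E : set R) : measurable_fun (E : set RT) (fun t => (t `^ (r - 1))%:E).
  by apply/measurable_EFinP; apply: measurable_funTS; exact: measurable_powR.
rewrite -(@integral_itv_obnd_cbnd R 0 (BRight x)); last exact: mpow.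
have key a : 0 < a < x ->
    (\int[leb]_(t in `[a, x]) (t `^ (r - 1))%:E <= (x `^ r / r)%:E)%E.
  move=> /andP[a0 ax].
  have := @integral_affine_powR 0 1 r a x (lt0r_neq0 r0) (oner_neq0 _) ax.
  under eq_integral do rewrite add0r mul1r.
  move=> -> => [|t /andP[at_ _]]; last by rewrite add0r mul1r (lt_le_trans a0).
  rewrite !add0r !mul1r mulr1 lee_fin ler_pM2r ?invr_gt0//.
  by rewrite gerBl powR_ge0.
pose a n : R := x / n.+2%:R.
have an n : 0 < a n < x.
  by rewrite divr_gt0//= ltr_pdivrMr// ltr_pMr// ltr1n.
have UE : \bigcup_n `[a n, x]%classic = `]0, x]%classic :> set R.
  apply/seteqP; split=> s /=.
    move=> [n _] /=; rewrite !in_itv/= => /andP[ans ->]; rewrite andbT.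
    by rewrite (lt_le_trans _ ans)//; have /andP[] := an n.
  rewrite !in_itv/= => /andP[s0 sx]; exists (Num.truncn (x / s)) => //=.
  rewrite in_itv/= sx andbT ler_pdivrMr// mulrC -ler_pdivrMr//.
  apply/ltW; apply: lt_trans (truncnS_gt _) _.
  by rewrite ltr_nat.
have cvg := @ge0_nondecreasing_set_cvg_integral _ RT R (fun n => `[a n, x]%classic)
  (fun t => (t `^ (r - 1))%:E)%E leb.
rewrite -UE; apply: (cvge_to_le (cvg _ _ _ _)) => //.
- move=> n m nm; apply/subsetPset => s /=; rewrite !in_itv/= => /andP[ans ->].
  rewrite andbT (le_trans _ ans)// ler_wpM2l ?(ltW x0)//.
  by rewrite lef_pV2 ?posrE// ler_nat.
- by move=> n s _; rewrite lee_fin powR_ge0.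
- by near=> n; exact: key.
Unshelve. all: by end_near. Qed.

End power_integrals.

Section Lp.
Context (R : realType).
Local Notation leb := (@lebesgue_measure R).
Local Notation RT := (measurableTypeR R).
Local Notation D := (unit_interval R).
Local Notation C := (@cesaro_op R).
Let mD := @measurable_unit_interval R.
Let D_ge0 := @unit_interval_ge0 R.
Let D_down := @unit_interval_down R.

Lemma measurable_cesaro_signed (f : R -> R) : measurable_fun (D : set RT) f ->
  measurable_fun (D : set RT) (C f).
Proof.
move=> mf; have mEf : measurable_fun (D : set RT) (EFin \o f) by exact/measurable_EFinP.
apply: emeasurable_funM.
  by apply/measurable_EFinP; apply: measurable_funTS; exact: measurable_inv.
under eq_fun do rewrite integralE.
apply: emeasurable_funB.
  apply: (measurable_int_head mD D_ge0 D_down).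
    exact: measurable_funepos.
  by move=> x _; exact: funepos_ge0.
apply: (measurable_int_head mD D_ge0 D_down).
  exact: measurable_funeneg.
by move=> x _; exact: funeneg_ge0.
Qed.

Variable p : R.
Hypothesis p1 : 1 < p.
Let p0 : 0 < p. Proof. exact: lt_trans p1. Qed.
Let pn0 : p != 0. Proof. by rewrite gt_eqF. Qed.
Local Notation L := (Lp_space leb D p%:E).
Local Notation Np f := ('N[leb]_p%:E[EFin \o (f \_ D)])%E.
Local Notation intp f := (\int[leb]_(t in D) (`|f t| `^ p)%:E)%E.

Lemma NpE (f : R -> R) : Np f = ((intp f) `^ p^-1)%E.
Proof.
rewrite unlock; congr (_ `^ _)%E; rewrite [RHS]integral_mkcond.
apply: eq_integral => t _; rewrite /= !patchE; case: ifP => // _.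
by rewrite normr0 powR0.
Qed.

Lemma Np_ge0 (f : R -> R) : (0 <= Np f)%E. Proof. exact: Lnorm_ge0. Qed.

Lemma LpP (f : R -> R) : measurable_fun (D : set RT) f ->
  (L f <-> (Np f < +oo)%E).
Proof.
move=> mf.
have mf' : measurable_fun [set: RT] (f \_ D) by exact/(measurable_restrictT _ _).1.
split=> [/andP[_ /set_mem]//|fin].
by apply/andP; split; apply/mem_set.
Qed.

Lemma Lp_measurable (f : R -> R) : L f -> measurable_fun (D : set RT) f.
Proof. by move=> /andP[/set_mem mf _]; exact/(measurable_restrictT _ _).2. Qed.

Lemma Lp_fin (f : R -> R) : L f -> (fnorm L f)%:E = Np f.
Proof.
move=> Lf; rewrite /= fineK// ge0_fin_numE ?Np_ge0//.
by apply/(LpP _).1 => //; exact: Lp_measurable.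
Qed.

Lemma measurable_norm_powR (f : R -> R) : measurable_fun (D : set RT) f ->
  measurable_fun (D : set RT) (fun t => (`|f t| `^ p)%:E).
Proof.
move=> mf; apply/measurable_EFinP.
apply: (measurableT_comp (measurable_powR p)).
exact: measurableT_comp.
Qed.

Lemma intp_ge0 (f : R -> R) : (0 <= intp f)%E.
Proof. by apply: integral_ge0 => t _; rewrite lee_fin powR_ge0. Qed.

Lemma Np_le (f g : R -> R) (K : R) : 0 <= K -> (intp f <= K%:E * intp g)%E ->
  (Np f <= (K `^ p^-1)%:E * Np g)%E.
Proof.
move=> K0 le; rewrite !NpE -poweR_EFin -poweRM ?intp_ge0//.
apply: gt0_ler_poweR => //; rewrite ?invr_ge0 ?(ltW p0)//.
  by rewrite in_itv/= intp_ge0 leey.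
by rewrite in_itv/= leey andbT mule_ge0 ?intp_ge0.
Qed.

Lemma Lp_normed_ideal : normed_ideal (L : @fspace _ RT R leb D).
Proof.
split.
- exact: Lp_measurable.
- move=> f g Lf Lg.
  have mf := Lp_measurable Lf; have mg := Lp_measurable Lg.
  have E : (f \+ g) \_ D = (f \_ D) \+ (g \_ D).
    by apply/funext => t; rewrite /= !patchE; case: ifP; rewrite ?addr0.
  have le : (Np (f \+ g)%R <= Np f + Np g)%E.
    rewrite E; apply: eminkowski; rewrite ?lee_fin ?(ltW p1)//;
      by apply/(measurable_restrictT _ _).1.
  have mfg : measurable_fun (D : set RT) (f \+ g) by exact: measurable_funD.
  have Lfg : L (f \+ g).
    apply/(LpP mfg); apply: (le_lt_trans le).
    by rewrite -!Lp_fin// ltry.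
  by split=> //; rewrite -lee_fin EFinD !Lp_fin.
- move=> c f Lf; have mf := Lp_measurable Lf.
  have mcf : measurable_fun (D : set RT) (fun x => c * f x) by exact: measurable_funM.
  have E : (Np (fun x => c * f x)%R = `|c|%:E * Np f)%E.
    rewrite !NpE.
    have -> : (intp (fun x => c * f x)%R = (`|c| `^ p)%:E * intp f)%E.
      have f0 t : D t -> (0 <= (`|f t| `^ p)%:E)%E by rewrite lee_fin powR_ge0.
      have c0 : (0 <= (`|c| `^ p)%:E)%E by rewrite lee_fin powR_ge0.
      rewrite -(@ge0_integralZl _ RT R leb D mD _ (measurable_norm_powR mf) _ f0 c0).
      by apply: eq_integral => t _; rewrite normrM powRM// EFinM.
    rewrite poweRM ?intp_ge0 ?lee_fin ?powR_ge0// poweR_EFin -powRrM divff//.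
    by rewrite powRr1.
  have Lcf : L (fun x => c * f x).
    by apply/(LpP mcf); rewrite E -Lp_fin// -EFinM ltry.
  by split=> //; apply: EFin_inj; rewrite EFinM !Lp_fin.
- move=> f g mf fg Lg; have mg := Lp_measurable Lg.
  have le : (Np f <= Np g)%E.
    suff le1 : (intp f <= 1%:E * intp g)%E.
      by have := Np_le ler01 le1; rewrite powR1 mul1e.
    have pow0 (h : R -> R) t : D t -> (0 <= (`|h t| `^ p)%:E)%E.
      by rewrite lee_fin powR_ge0.
    rewrite mul1e; apply: (ae_ge0_le_integral mD (pow0 f)
      (measurable_norm_powR mf) (pow0 g) (measurable_norm_powR mg)).
    apply: (ae_imp _ fg) => t fgt Dt; rewrite lee_fin ge0_ler_powR ?nnegrE//.
      exact: ltW.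
    exact: fgt.
  have Lf : L f by apply/(LpP mf); rewrite (le_lt_trans le)// -Lp_fin// ltry.
  by split=> //; rewrite -lee_fin !Lp_fin.
Qed.

End Lp.

Section hardy.
Context (R : realType).
Local Notation leb := (@lebesgue_measure R).
Local Notation RT := (measurableTypeR R).
Local Notation D := (unit_interval R).
Local Notation C := (@cesaro_op R).
Let mD := @measurable_unit_interval R.
Let D_ge0 := @unit_interval_ge0 R.
Let D_down := @unit_interval_down R.

Variable p : R.
Hypothesis p1 : 1 < p.
Let p0 : 0 < p. Proof. exact: lt_trans p1. Qed.
Let pn0 : p != 0. Proof. by rewrite gt_eqF. Qed.
Let r := 1 - p^-1.
Let r0 : 0 < r. Proof. by rewrite subr_gt0 invf_lt1. Qed.
Let r1 : r < 1. Proof. by rewrite gtrBl invr_gt0. Qed.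
Let rp : (1 - r) * p = 1. Proof. by rewrite /r opprB addrC subrK mulVf. Qed.

Section nonneg.
Variable f : R -> R.
Hypotheses (mf : measurable_fun (D : set RT) f) (f0 : forall t, 0 <= f t).

Let J x := (\int[leb]_(t in `[0%R, x]) (f t `^ p * t `^ r)%:E)%E.

(** Hoelder's inequality for [f = (f t^a) t^(-a)] with [a = r (1 - r)] and
    [r = 1 - 1 / p], the inverse of the conjugate exponent.  This [a] makes the
    powers come out as [(t^a)^p = t^r] and [(t^(-a))^(1 / r) = t^(r - 1)],
    which is integrable at 0. *)
Lemma hardy_hoelder x : D x -> 0 < x ->
  ((\int[leb]_(t in `[0%R, x]) (f t)%:E) `^ p <=
   J x * ((x `^ r / r) `^ (r * p))%:E)%E.
Proof.
move=> Dx x0; set I : set R := `[0%R, x]%classic.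
have sub : I `<=` D := itv_subD D_down Dx.
have mI : measurable I by exact: measurable_itv.
have mfI : measurable_fun (I : set RT) f by exact: measurable_funS mD sub mf.
pose a := r * (1 - r).
have a0 : 0 < a by rewrite mulr_gt0// subr_gt0.
pose u : R -> R := (fun t => f t * t `^ a) \_ I.
pose v : R -> R := (fun t => t `^ (- a)) \_ I.
have mpow b (A : set R) : measurable_fun (A : set RT) (fun t => t `^ b).
  by apply: measurable_funTS; exact: measurable_powR.
have mu_ : measurable_fun [set: RT] u.
  by apply/(measurable_restrictT _ _).1 => //; exact: measurable_funM.
have mv : measurable_fun [set: RT] v.
  by apply/(measurable_restrictT _ _).1 => //.
have q0 : 0 < r^-1 by rewrite invr_gt0.
have pq : p^-1 + (r^-1)^-1 = 1 by rewrite invrK /r addrC subrK.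
have H := hoelder leb mu_ mv p0 q0 pq.
have E1 : (\int[leb]_(t in I) (f t)%:E = 'N[leb]_1[EFin \o (u \* v)%R])%E.
  rewrite Lnorm1 [LHS]integral_mkcond; apply: ge0_ae_eq_integral => //.
  - apply/(measurable_restrictT _ _).1 => //; exact/measurable_EFinP.
  - by apply: measurableT_comp => //; apply/measurable_EFinP; exact: measurable_funM.
  - by move=> t _; rewrite patchE; case: ifP => // _; rewrite lee_fin.
  apply: (ae_imp _ (ae_neq 0)) => t t0 _ /=; rewrite /u /v !patchE.
  case: ifPn => [/set_mem|_]; last by rewrite mulr0 normr0.
  rewrite /I/= in_itv/= => /andP[t0' _].
  rewrite -mulrA -powRD; last by rewrite subrr eqxx.
  by rewrite subrr powRr0 mulr1 ger0_norm.
have E2 : ('N[leb]_p%:E[EFin \o u] = J x `^ p^-1)%E.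
  rewrite unlock; congr (_ `^ _)%E; rewrite /J [RHS]integral_mkcond.
  apply: eq_integral => t _; rewrite /= /u !patchE; case: ifPn => [/set_mem|_].
    rewrite /I/= in_itv/= => /andP[t0 _].
    rewrite ger0_norm ?mulr_ge0 ?powR_ge0// powRM ?powR_ge0//.
    by rewrite -powRrM /a -mulrA rp mulr1.
  by rewrite normr0 powR0.
have E3 : ('N[leb]_(r^-1)%:E[EFin \o v] =
    (\int[leb]_(t in I) (t `^ (r - 1))%:E) `^ r)%E.
  rewrite unlock invrK; congr (_ `^ _)%E; rewrite [RHS]integral_mkcond.
  apply: eq_integral => t _; rewrite /= /v !patchE; case: ifPn => [/set_mem|_].
    have ar : - a * r^-1 = r - 1 by rewrite /a; field; rewrite gt_eqF.
    by rewrite ger0_norm ?powR_ge0// -powRrM ar.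
  by rewrite normr0 powR0// gt_eqF.
have J0 : (0 <= J x)%E.
  by apply: integral_ge0 => t _; rewrite lee_fin mulr_ge0 ?powR_ge0.
have I0 : (0 <= \int[leb]_(t in I) (f t)%:E)%E.
  by apply: integral_ge0 => t _; rewrite lee_fin.
have V0 : (0 <= \int[leb]_(t in I) (t `^ (r - 1))%:E)%E.
  by apply: integral_ge0 => t _; rewrite lee_fin powR_ge0.
have xr0 : 0 <= x `^ r / r by rewrite divr_ge0 ?powR_ge0// ltW.
have le : (\int[leb]_(t in I) (f t)%:E <= J x `^ p^-1 * ((x `^ r / r) `^ r)%:E)%E.
  rewrite E1 (le_trans H)// E2 E3 lee_wpmul2l ?poweR_ge0// -poweR_EFin.
  apply: gt0_ler_poweR; rewrite ?(ltW r0)// ?in_itv/= ?V0 ?leey ?lee_fin//.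
    by rewrite xr0.
  exact: integral_powR_le.
apply: (@le_trans _ _ ((J x `^ p^-1 * ((x `^ r / r) `^ r)%:E) `^ p)%E).
  apply: gt0_ler_poweR; rewrite ?(ltW p0)// ?in_itv/= ?I0 ?leey//.
  by rewrite mule_ge0 ?poweR_ge0// lee_fin powR_ge0.
rewrite poweRM ?poweR_ge0 ?lee_fin ?powR_ge0//.
by rewrite -poweRrM mulVf// poweRe1// poweR_EFin -powRrM.
Qed.

Let k := (r^-1) `^ (r * p).

Lemma hardy_pointwise x : D x -> 0 < x ->
  ((C f x) `^ p <= (k * x `^ (- r - 1))%:E * J x)%E.
Proof.
move=> Dx x0.
have I0 : (0 <= \int[leb]_(t in `[0%R, x]) (f t)%:E)%E.
  by apply: integral_ge0 => t _; rewrite lee_fin.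
rewrite /cesaro_op poweRM// ?lee_fin ?invr_ge0 ?(ltW x0)// poweR_EFin.
apply: (@le_trans _ _ ((x^-1 `^ p)%:E * (J x * ((x `^ r / r) `^ (r * p))%:E))%E).
  by rewrite lee_wpmul2l ?lee_fin ?powR_ge0// hardy_hoelder.
rewrite muleCA muleC -EFinM.
suff -> : x^-1 `^ p * (x `^ r / r) `^ (r * p) = k * x `^ (- r - 1) by [].
rewrite powRM ?powR_ge0 ?invr_ge0 ?(ltW r0)// mulrA mulrC /k; congr (_ * _).
rewrite -powR_inv1 ?(ltW x0)// -!powRrM -powRD; last by rewrite (gt_eqF x0) implybT.
congr (_ `^ _); move: rp; rewrite mulrBl mul1r => rp'.
have -> : r * (r * p) = r * (p - 1) by rewrite -rp'; ring.
have -> : r * (p - 1) = r * p - r by ring.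
have -> : r * p = p - 1 by rewrite -rp'; ring.
by ring.
Qed.

(** Integrate [hardy_pointwise] and exchange the integrals: [f t ^ p * t ^ r]
    gets the factor [k] times the integral of [x ^ (- r - 1)] over
    [[t, 1]], which is at most [t ^ (- r) / r]. *)
Lemma hardy_integral :
  (\int[leb]_(x in D) ((C f x) `^ p) <=
   (k / r)%:E * \int[leb]_(t in D) (f t `^ p)%:E)%E.
Proof.
pose g t := if t \in D then f t `^ p * t `^ r else 0.
have mpow b (A : set R) : measurable_fun (A : set RT) (fun t => t `^ b).
  by apply: measurable_funTS; exact: measurable_powR.
have mfp : measurable_fun (D : set RT) (fun t => f t `^ p).
  exact: (measurableT_comp (measurable_powR p)).
have g0 t : 0 <= g t by rewrite /g; case: ifP => // _; rewrite mulr_ge0 ?powR_ge0.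
have mg : measurable_fun [set: RT] g.
  by apply/(measurable_restrictT _ _).1 => //; exact: measurable_funM.
pose b x t := (x \in D) && (t <= x).
pose h x t := ((k * x `^ (- r - 1)) * g t)%:E.
have k0 : 0 <= k by exact: powR_ge0.
have h0 x t : (0 <= h x t)%E by rewrite lee_fin !mulr_ge0 ?powR_ge0.
have mb : measurable_fun [set: RT * RT] (fun q => b q.1 q.2).
  apply: measurable_and; last exact: measurable_fun_ler.
  exact: (measurableT_comp (measurable_mem mD) (@measurable_fst _ _ RT RT)).
have mh : measurable_fun [set: RT * RT] (fun q => h q.1 q.2).
  apply/measurable_EFinP; apply: measurable_funM; last first.
    exact: (measurableT_comp mg (@measurable_snd _ _ RT RT)).
  apply: measurable_funM => //.
  exact: (measurableT_comp (mpow (- r - 1) setT) (@measurable_fst _ _ RT RT)).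
apply: (@le_trans _ _ (\int[leb]_x \int[leb]_t (if b x t then h x t else 0))%E).
  rewrite integral_mkcond; apply: ae_ge0_le_integral => //.
  - by move=> x _; rewrite patchE; case: ifP => // _; rewrite poweR_ge0.
  - apply/(measurable_restrictT _ _).1 => //.
    apply: (measurableT_comp (measurable_poweR p)).
    exact: measurable_cesaro_signed.
  - by move=> x _; apply: integral_ge0 => t _; case: ifP.
  - exact: measurable_int_kernel.
  apply: (ae_imp _ (ae_neq 0)) => x x0 _; rewrite patchE.
  case: ifPn => [Dx|_]; last by apply: integral_ge0 => t _; case: ifP.
  have {}x0 : 0 < x by rewrite lt0r x0; exact/D_ge0/set_mem.
  apply: (le_trans (hardy_pointwise (set_mem Dx) x0)).
  rewrite /J integral_mkcond -ge0_integralZl//; last 3 first.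
  - apply/(measurable_restrictT _ _).1 => //; apply/measurable_EFinP.
    apply: measurable_funM => //.
    exact: measurable_funS mD (itv_subD D_down (set_mem Dx)) mfp.
  - by move=> t _; rewrite patchE; case: ifP => // _; rewrite lee_fin mulr_ge0 ?powR_ge0.
  - by rewrite lee_fin mulr_ge0 ?powR_ge0.
  apply: ge0_le_integral => //.
  - move=> t _; rewrite mule_ge0 ?lee_fin ?mulr_ge0 ?powR_ge0//.
    by rewrite patchE; case: ifP => // _; rewrite lee_fin mulr_ge0 ?powR_ge0.
  - apply: measurable_funeM; apply/(measurable_restrictT _ _).1 => //.
    apply/measurable_EFinP; apply: measurable_funM => //.
    exact: measurable_funS mD (itv_subD D_down (set_mem Dx)) mfp.
  - exact: (measurable_kernel_row (b := b) (h := h)).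
  move=> t _; rewrite patchE; case: ifPn => [|_]; last first.
    by rewrite mule0; case: ifP.
  rewrite mem_setE in_itv/= => /andP[t0 tx].
  rewrite /b Dx tx/= /h /g mem_set ?EFinM//.
  exact: D_down (set_mem Dx) t0 tx.
rewrite (tonelli_kernel mb mh h0) -ge0_integralZl//; last 3 first.
- exact/measurable_EFinP.
- by move=> t _; rewrite lee_fin powR_ge0.
- by rewrite lee_fin divr_ge0 ?(ltW r0).
rewrite [leRHS]integral_mkcond; apply: ae_ge0_le_integral => //.
- by move=> t _; apply: integral_ge0 => x _; case: ifP.
- apply: (measurable_int_kernel (b := fun t x => b x t) (h := fun t x => h x t)) => //.
    exact: (measurableT_comp mb (@measurable_swap _ _ RT RT)).
  exact: (measurableT_comp mh (@measurable_swap _ _ RT RT)).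
- move=> t _; rewrite patchE; case: ifP => // _.
  by rewrite -EFinM lee_fin mulr_ge0 ?powR_ge0// divr_ge0// ltW.
- apply/(measurable_restrictT _ _).1 => //; apply: measurable_funeM.
  exact/measurable_EFinP.
apply: (ae_imp2 _ (ae_neq 0) (ae_neq 1)) => t t0 t1 _; rewrite patchE.
case: ifPn => [Dt|nDt]; last first.
  rewrite integral0_eq// => x _; case: ifP => // _.
  by rewrite /h /g (negPf nDt) mulr0.
have := set_mem Dt; rewrite unit_intervalE => /andP[t0' t1'].
have {t0 t0'} t0 : 0 < t by rewrite lt0r t0.
have {t1 t1'} t1 : t < 1 by rewrite lt_neqAle t1.
have -> : (\int[leb]_x (if b x t then h x t else 0) =
   \int[leb]_(x in `[t, 1%R]) ((k * g t)%:E * (x `^ (- r - 1))%:E))%E.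
  rewrite [RHS]integral_if; apply: eq_integral => x _.
  have -> : b x t = (x \in `[t, 1]%classic).
    rewrite /b; apply/andP/idP.
      move=> [/set_mem]; rewrite unit_intervalE => /andP[_ x1] tx.
      by apply/mem_set; rewrite /= in_itv/= tx.
    move=> /set_mem; rewrite /= in_itv/= => /andP[tx x1]; split=> //.
    by apply/mem_set; rewrite unit_intervalE x1 (le_trans (ltW t0) tx).
  by case: ifP => // _; rewrite -EFinM /h mulrAC.
rewrite ge0_integralZl//; last 3 first.
- by apply/measurable_EFinP.
- by move=> x _; rewrite lee_fin powR_ge0.
- by rewrite lee_fin mulr_ge0.
have rn0 : - r != 0 by rewrite oppr_eq0 gt_eqF.
have -> : (\int[leb]_(x in `[t, 1%R]) (x `^ (- r - 1))%:E =
    ((1 - t `^ (- r)) / - r)%:E)%E.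
  have := @integral_affine_powR R 0 1 (- r) t 1 rn0 (oner_neq0 _) t1.
  under eq_integral do rewrite add0r mul1r.
  rewrite !add0r !mul1r mulr1 powR1 => -> // x /andP[tx _].
  by rewrite add0r mul1r (lt_le_trans t0).
rewrite -!EFinM lee_fin /g Dt.
rewrite [leLHS](_ : _ = k / r * (f t `^ p * (t `^ r * (t `^ (- r) - 1)))); last first.
  by field; rewrite gt_eqF.
rewrite ler_wpM2l ?divr_ge0 ?(ltW r0)// ler_piMr ?powR_ge0//.
rewrite mulrBr mulr1 -powRD; last by rewrite (gt_eqF t0) implybT.
rewrite subrr powRr0.
by rewrite gerBl powR_ge0.
Qed.

End nonneg.

Lemma hardy_inequality : exists2 K : R, 0 <= K &
  forall f : R -> R, measurable_fun (D : set RT) f -> (forall t, 0 <= f t) ->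
  (\int[leb]_(x in D) ((C f x) `^ p) <=
   K%:E * \int[leb]_(t in D) (f t `^ p)%:E)%E.
Proof.
exists (r^-1 `^ (r * p) / r); first by rewrite divr_ge0 ?powR_ge0// ltW.
exact: hardy_integral.
Qed.
End hardy.

(** * Cesaro and Copson spaces over [L^p] *)
Section Lp_cesaro.
Context (R : realType).
Local Notation leb := (@lebesgue_measure R).
Local Notation RT := (measurableTypeR R).
Local Notation D := (unit_interval R).
Local Notation C := (@cesaro_op R).
Local Notation Cs := (copson_op D).
Let mD := @measurable_unit_interval R.
Let D_ge0 := @unit_interval_ge0 R.
Let D_down := @unit_interval_down R.

Variable p : R.
Hypothesis p1 : 1 < p.
Let p0 : 0 < p. Proof. exact: lt_trans p1. Qed.
Local Notation L := (Lp_space leb D p%:E).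
Local Notation Np f := ('N[leb]_p%:E[EFin \o (f \_ D)])%E.
Local Notation intp f := (\int[leb]_(t in D) (`|f t| `^ p)%:E)%E.

Lemma Lp_intp (f : R -> R) : L f -> (intp f < +oo)%E.
Proof.
move=> Lf; have : (Np f < +oo)%E by rewrite -(Lp_fin Lf) ltry.
rewrite (NpE p1); apply: lty_poweRy.
by rewrite invr_eq0 gt_eqF.
Qed.

Lemma Lp_cesaro_bounded : bounded_on L C.
Proof.
have [K K0 hardy] := hardy_inequality p1.
exists (K `^ p^-1) => f Lf; have mf := Lp_measurable Lf.
have mnf : measurable_fun (D : set RT) (fun x => `|f x|) by exact: measurableT_comp.
have nf0 x : 0 <= `|f x| by [].
have le := hardy _ mnf nf0.
have lt : (\int[leb]_(x in D) ((C (fun x => `|f x|%R) x) `^ p) < +oo)%E.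
  by rewrite (le_lt_trans le)// lte_mul_pinfty ?lee_fin// Lp_intp.
have mCp : measurable_fun (D : set RT) (fun x => C (fun x => `|f x|%R) x `^ p)%E.
  by apply: (measurableT_comp (measurable_poweR p)); exact: measurable_cesaro_signed.
have finp : \forall x \ae leb, D x -> C (fun x => `|f x|) x \is a fin_num.
  have ip : leb.-integrable D (fun x => C (fun x => `|f x|%R) x `^ p)%E.
    apply/integrableP; split=> //.
    by under eq_integral do rewrite gee0_abs ?poweR_ge0//.
  apply: (ae_imp _ (integrable_ae mD ip)) => x fin Dx.
  have := fin Dx; have := cesaro_ge0 D_ge0 D_down nf0 Dx.
  case: (C _ x) => [r| |]//.
  by rewrite poweRyr ?gt_eqF.
have dom : \forall x \ae leb, D x -> (`|C f x| <= C (fun x => `|f x|%R) x)%E.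
  apply: nearW => x Dx; have x0 := D_ge0 Dx.
  rewrite /cesaro_op abseM gee0_abs ?lee_fin ?invr_ge0//.
  apply: lee_wpmul2l; first by rewrite lee_fin invr_ge0.
  apply: le_abse_integral => //.
  by apply/measurable_EFinP; exact: measurable_funS mD (itv_subD D_down Dx) mf.
have finC : \forall x \ae leb, D x -> C f x \is a fin_num.
  apply: (ae_imp2 _ finp dom) => x fin le1 Dx.
  rewrite fin_num_abs (le_lt_trans (le1 Dx))//.
  by rewrite -ge0_fin_numE ?fin// (cesaro_ge0 D_ge0 D_down).
have mC : measurable_fun (D : set RT) (fine \o C f).
  by apply: measurableT_comp => //; exact: measurable_cesaro_signed.
have lep : (intp (fine \o C f) <= K%:E * intp f)%E.
  have P0 x : D x -> (0 <= (`|(fine \o C f) x| `^ p)%:E)%E by rewrite lee_fin powR_ge0.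
  have Q0 x : D x -> (0 <= C (fun x => `|f x|%R) x `^ p)%E by rewrite poweR_ge0.
  apply: le_trans le.
  apply: (ae_ge0_le_integral mD P0 (measurable_norm_powR p mC) Q0 mCp).
  apply: (ae_imp3 _ finp dom finC) => x fin le1 fin1 Dx.
  rewrite -(fineK (fin Dx)) poweR_EFin lee_fin ge0_ler_powR ?nnegrE ?(ltW p0)//.
    by rewrite fine_ge0// (cesaro_ge0 D_ge0 D_down).
  rewrite -lee_fin fineK ?fin// (le_trans _ (le1 Dx))//.
  by rewrite -[in leRHS](fineK (fin1 Dx)).
have leN := Np_le p1 K0 lep.
have LC : L (fine \o C f).
  apply/(LpP p mC); rewrite (le_lt_trans leN)// -(Lp_fin Lf) -EFinM ltry//.
split; first by split.
by rewrite -lee_fin EFinM (Lp_fin LC) (Lp_fin Lf).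
Qed.

Let e := (2 * p)^-1.
Let e0 : 0 < e. Proof. by rewrite invr_gt0 mulr_gt0. Qed.
Let ei0 : 0 <= e^-1. Proof. by rewrite ltW// invr_gt0. Qed.
(** Dividing by [t] in [C*] leaves a pure power of [1 - t], whose exponent
    [- e - 1] makes the integral diverge at 1.  The averages behave like
    [(1 - x)^(-e)], whose [p]-th power is [(1 - x)^(-1 / 2)] by the choice
    of [e]. *)
Let w (t : R) := t * (1 - t) `^ (- e - 1).

Let mpow b (A : set R) : measurable_fun (A : set RT) (fun t => (1 - t) `^ b).
Proof.
apply: measurable_funTS; apply: (measurableT_comp (measurable_powR b)).
exact: measurable_funB.
Qed.

Let mw (A : set R) : measurable_fun (A : set RT) w.
Proof. by apply: measurable_funM. Qed.

Let int_reflect (r a b : R) : r != 0 -> a < b -> b < 1 ->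
  (\int[leb]_(t in `[a, b]) ((1 - t) `^ (r - 1))%:E =
   (((1 - a) `^ r - (1 - b) `^ r) / r)%:E)%E.
Proof.
move=> r0 ab b1.
have d0 : -1 != 0 :> R by rewrite oppr_eq0 oner_neq0.
have := @integral_affine_powR R 1 (-1) r a b r0 d0 ab.
under eq_integral do rewrite mulN1r.
rewrite !mulN1r => -> => [|t /andP[_ tb]].
  by congr (_%:E); field; rewrite r0.
by rewrite mulN1r subr_gt0 (le_lt_trans tb).
Qed.

Let cesaro_w x : 0 < x < 1 ->
  (C (fun t => `|w t|%R) x <= (e^-1 * (1 - x) `^ (- e))%:E)%E.
Proof.
move=> /andP[x0 x1]; rewrite /cesaro_op -lee_pdivlMl ?invr_gt0// invrK.
have en0 : - e != 0 by rewrite oppr_eq0 gt_eqF.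
apply: (@le_trans _ _ (\int[leb]_(t in `[0%R, x]) (x%:E * ((1 - t) `^ (- e - 1))%:E))%E).
  apply: ge0_le_integral => //.
  - by apply/measurable_EFinP; apply: measurableT_comp.
  - by apply/measurable_EFinP; apply: measurable_funM.
  move=> t /=; rewrite in_itv/= => /andP[t0 tx].
  by rewrite -EFinM lee_fin ger0_norm ?mulr_ge0 ?powR_ge0// ler_wpM2r ?powR_ge0.
rewrite ge0_integralZl//; last 3 first.
- exact/measurable_EFinP.
- by move=> t _; rewrite lee_fin powR_ge0.
- by rewrite lee_fin ltW.
rewrite int_reflect// subr0 powR1 -!EFinM lee_fin ler_wpM2l ?(ltW x0)//.
rewrite (_ : (1 - _) / - e = e^-1 * ((1 - x) `^ (- e) - 1)); last first.
  by field; rewrite gt_eqF.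
by rewrite ler_wpM2l// gerBl.
Qed.

Let int_sqrt : (\int[leb]_(x in D) ((1 - x) `^ (2^-1 - 1))%:E <= 2%:E)%E.
Proof.
have mp (A : set R) : measurable_fun (A : set RT) (fun t => ((1 - t) `^ (2^-1 - 1))%:E).
  by apply/measurable_EFinP.
rewrite /unit_interval -(@integral_itv_bndo_bndc R (BLeft 0) 1); last exact: mp.
pose y n : R := 1 - n.+2%:R^-1.
have y01 n : 0 < y n < 1.
  by rewrite subr_gt0 invf_lt1 ?ltr1n ?ltr0n//= gtrBl.
have UE : \bigcup_n `[0, y n]%classic = `[0, 1[%classic :> set R.
  apply/seteqP; split=> s /=.
    move=> [n _] /=; rewrite !in_itv/= => /andP[-> sy].
    by rewrite (le_lt_trans sy)//; have /andP[] := y01 n.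
  rewrite in_itv/= => /andP[s0 s1]; exists (Num.truncn (1 - s)^-1) => //=.
  rewrite in_itv/= s0/= /y lerBrDr addrC -lerBrDr.
  rewrite invf_ple ?posrE ?subr_gt0// ltW// (lt_trans (truncnS_gt _))//.
  by rewrite ltr_nat.
have cvg := @ge0_nondecreasing_set_cvg_integral _ RT R (fun n => `[0, y n]%classic)
  (fun t => ((1 - t) `^ (2^-1 - 1))%:E)%E leb.
rewrite -UE; apply: (cvge_to_le (cvg _ _ _ _)) => //.
- move=> n m nm; apply/subsetPset => s /=; rewrite !in_itv/= => /andP[-> sy].
  rewrite (le_trans sy)// lerB// lef_pV2 ?posrE//.
  by rewrite ler_nat.
- by move=> n s _; rewrite lee_fin powR_ge0.
near=> n; have /andP[y0 y1] := y01 n.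
rewrite int_reflect// subr0 powR1 lee_fin invrK ler_piMl// gerBl.
by rewrite powR_ge0.
Unshelve. all: by end_near. Qed.

Lemma Lp_cesaro_not_copson : exists2 f, cesaro_space L f & ~ copson_space L f.
Proof.
exists w.
  have mnw : measurable_fun (D : set RT) (fun x => `|w x|) by exact: measurableT_comp.
  have nw0 x : 0 <= `|w x| by [].
  have bnd : \forall x \ae leb, D x ->
      (C (fun t => `|w t|%R) x <= (e^-1 * (1 - x) `^ (- e))%:E)%E.
    apply: (ae_imp2 _ (ae_neq 0) (ae_neq 1)) => x x0 x1.
    rewrite unit_intervalE => /andP[x0' x1']; apply: cesaro_w.
    by rewrite lt0r x0 x0' lt_neqAle x1 x1'.
  have fin : \forall x \ae leb, D x -> C (fun t => `|w t|) x \is a fin_num.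
    apply: (ae_imp _ bnd) => x le Dx.
    by rewrite ge0_fin_numE ?(cesaro_ge0 D_ge0 D_down)// (le_lt_trans (le Dx))// ltry.
  have mC := measurable_cesaro mD D_ge0 D_down mnw nw0.
  have mCf : measurable_fun (D : set RT) (fine \o C (fun t => `|w t|)).
    exact: measurableT_comp.
  split=> //; split=> //.
  apply/(LpP p mCf); rewrite (NpE p1); apply: poweR_lty.
  apply: (@le_lt_trans _ _ ((e^-1 `^ p)%:E * 2%:E)%E); last by rewrite -EFinM ltry.
  apply: (@le_trans _ _ (\int[leb]_(x in D) ((e^-1 `^ p)%:E * ((1 - x) `^ (2^-1 - 1))%:E))%E).
    have r0 (x : R) : D x -> (0 <= (e^-1 `^ p)%:E * ((1 - x) `^ (2^-1 - 1))%:E)%E.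
      by rewrite -EFinM lee_fin mulr_ge0 ?powR_ge0.
    have l0 x : D x -> (0 <= (`|(fine \o C (fun t => `|w t|%R)) x| `^ p)%:E)%E.
      by rewrite lee_fin powR_ge0.
    have mr : measurable_fun (D : set RT)
        (fun x => (e^-1 `^ p)%:E * ((1 - x) `^ (2^-1 - 1))%:E)%E.
      by apply/measurable_EFinP; apply: measurable_funM.
    apply: (ae_ge0_le_integral mD l0 (measurable_norm_powR p mCf) r0 mr).
    apply: (ae_imp2 _ bnd fin) => x le fx Dx.
    have C0 := cesaro_ge0 D_ge0 D_down nw0 Dx.
    rewrite -EFinM lee_fin /= ger0_norm ?fine_ge0//.
    have -> : 2^-1 - 1 = - e * p by rewrite /e; field; rewrite gt_eqF.
    rewrite powRrM -powRM ?powR_ge0 ?ei0//.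
    rewrite ge0_ler_powR ?nnegrE ?(ltW p0) ?fine_ge0//.
      by rewrite mulr_ge0 ?powR_ge0 ?ei0.
    by rewrite -lee_fin fineK ?fx ?le.
  rewrite ge0_integralZl//; last 3 first.
  - exact/measurable_EFinP.
  - by move=> x _; rewrite lee_fin powR_ge0.
  - by rewrite lee_fin powR_ge0.
  by rewrite lee_wpmul2l ?int_sqrt// lee_fin powR_ge0.
move=> [_ [fin _]].
have [x /andP[x0 x1] finx] := ae_exists ltr01 fin.
have Dx : D x by rewrite unit_intervalE !ltW.
have {}finx := finx Dx; pose v := fine (Cs (fun t => `|w t|) x).
have v0 : 0 <= v by rewrite fine_ge0// (copson_ge0 D_ge0).
(* If [C* w] were finite at [x], the powers [(1 - b)^(-e)] would stay bounded
   as [b] tends to 1. *)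
have key b : x < b < 1 -> (1 - b) `^ (- e) <= e * v + (1 - x) `^ (- e).
  move=> /andP[xb b1].
  have : (\int[leb]_(t in `[x, b]) ((1 - t) `^ (- e - 1))%:E <= v%:E)%E.
    rewrite fineK//.
    have sub : `[x, b]%classic `<=` D `&` `[x, +oo[%classic.
      move=> t /=; rewrite in_itv/= => /andP[xt tb]; rewrite in_itv/= xt; split=> //.
      by rewrite unit_intervalE (le_trans (ltW x0) xt) (le_trans tb (ltW b1)).
    have mI : measurable (D `&` `[x, +oo[) by exact: measurableI.
    have mwV : measurable_fun (D `&` `[x, +oo[ : set RT) (fun t => (`|w t| / t)%:E).
      apply/measurable_EFinP; apply: measurable_funM; first exact: measurableT_comp.
      by apply: measurable_funTS; exact: measurable_inv.
    apply: le_trans (ge0_subset_integral leb _ mI mwV _ sub) => //.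
      apply: ge0_le_integral => //.
      - by move=> t _; rewrite lee_fin powR_ge0.
      - exact/measurable_EFinP.
      - exact: measurable_funS mI sub mwV.
      move=> t /=; rewrite in_itv/= => /andP[xt tb].
      have t0 := lt_le_trans x0 xt.
      rewrite lee_fin ger0_norm ?mulr_ge0 ?powR_ge0 ?(ltW t0)// /w mulrAC divff ?mul1r//.
      by rewrite gt_eqF.
    by move=> t [Dt _]; rewrite lee_fin divr_ge0//; exact: D_ge0.
  rewrite int_reflect//; last by rewrite oppr_eq0 gt_eqF.
  rewrite lee_fin invrN mulrN -mulNr opprB ler_pdivrMr// (mulrC v).
  by rewrite lerBlDr.
set M := e * v + _ in key.
have M0 : 0 <= M by rewrite addr_ge0 ?mulr_ge0 ?powR_ge0 ?(ltW e0).
(* At [b = 1 - y] the power [(1 - b)^(-e)] is [M + 1], more than the bound; [z]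
   moreover keeps [b] to the right of [x]. *)
pose y := (M + 1) `^ (- e^-1).
have M1 : 0 < M + 1 by rewrite ltr_wpDl.
have y0 : 0 < y by exact: powR_gt0.
pose z := Num.min y ((1 - x) / 2).
have z0 : 0 < z by rewrite lt_min y0 divr_gt0// subr_gt0.
have zx : z < 1 - x.
  by rewrite gt_min ltr_pdivrMr ?ltr_pMr ?subr_gt0 ?ltr1n ?orbT.
have := key (1 - z); rewrite ltrBrDl -ltrBrDr zx gtrBl z0 => /(_ isT).
rewrite subKr leNgt => /negP; apply.
apply: (@lt_le_trans _ _ (M + 1)); first by rewrite ltrDl.
have -> : M + 1 = y `^ (- e).
  by rewrite /y -powRrM mulrNN mulVf ?(gt_eqF e0)// powRr1// addr_ge0.
rewrite !powRN lef_pV2 ?posrE ?powR_gt0//.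
by rewrite ge0_ler_powR ?nnegrE ?(ltW e0) ?(ltW z0) ?(ltW y0)// ge_min lexx.
Qed.

End Lp_cesaro.

(** * Sequences *)
Section sequence_operators.
Context (R : realType).
Local Notation count := (@counting nat R).
Implicit Types a : nat -> R.

Lemma ae_countingP (P : nat -> Prop) :
  (\forall n \ae count, P n) -> forall n, P n.
Proof.
move=> [N [mN N0 sub]] n; apply: contrapT => nP.
have Nn : N n by exact: sub.
have : (count [set n] <= count N)%E.
  by apply: le_measure; rewrite ?inE// => _ ->.
rewrite N0 /counting asboolT; last exact: finite_set1.
by rewrite fset_set1 finmap.cardfs1 lee_fin ler10.
Qed.

Definition mean a (n : nat) : R := n.+1%:R^-1 * \sum_(0 <= k < n.+1) a k.

Lemma cesarod_mean a n : cesarod_op a n = (mean a n)%:E.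
Proof. by rewrite /cesarod_op /mean big_mkord. Qed.

Section nonneg.
Variable a : nat -> R.
Hypothesis a0 : forall k, 0 <= a k.

Lemma sum_nat_ge0 m n : 0 <= \sum_(m <= k < n) a k.
Proof. exact: sumr_ge0. Qed.

Lemma mean_ge0 n : 0 <= mean a n.
Proof. by rewrite mulr_ge0// sum_nat_ge0. Qed.

Lemma le_sum_nat m n k : (n <= k)%N -> \sum_(m <= i < n) a i <= \sum_(m <= i < k) a i.
Proof.
move=> nk; have [mn|/ltnW nm] := leqP m n; last by rewrite big_geq// sum_nat_ge0.
by rewrite (big_cat_nat mn nk)/= lerDl sum_nat_ge0.
Qed.

Let term0 k : (0 <= (a k / k.+1%:R)%:E)%E.
Proof. by rewrite lee_fin divr_ge0. Qed.

Lemma copsond_ge0 n : (0 <= copsond_op a n)%E.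
Proof. by apply: nneseries_ge0 => k _ _. Qed.

Lemma sum_le_copsond n N : ((\sum_(n <= k < N) (a k / k.+1%:R))%:E <= copsond_op a n)%E.
Proof. by rewrite -sumEFin; apply: nneseries_lim_ge => k _ _. Qed.

Lemma copsond_le n (c : \bar R) :
  (forall N, (n <= N)%N -> ((\sum_(n <= k < N) (a k / k.+1%:R))%:E <= c)%E) ->
  (copsond_op a n <= c)%E.
Proof.
move=> H; apply: lime_le; first by apply: is_cvg_nneseries => k _ _.
by near=> N; rewrite sumEFin; apply: H; near: N; exact: nbhs_infty_ge.
Unshelve. all: by end_near. Qed.

Lemma copsond_anti m n : (m <= n)%N -> (copsond_op a n <= copsond_op a m)%E.
Proof.
move=> mn; apply: copsond_le => N nN; apply: le_trans (sum_le_copsond m N).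
rewrite lee_fin (big_cat_nat mn nN)/= lerDr.
by apply: sumr_ge0 => k _; rewrite divr_ge0.
Qed.

(** The discrete form of [cav_dilate] with [a = 2]: the indices from [n + 1]
    to [2 n + 1] are half of those averaged, and there [mean a] is at least
    half of [mean a n]. *)
Lemma mean_le_mean_mean n : mean a n <= 4 * mean (mean a) n.*2.+1.
Proof.
set S := \sum_(0 <= k < n.+1) a k.
have S0 : 0 <= S by exact: sum_nat_ge0.
have n1 : 0 < n.+1%:R :> R by rewrite ltr0n.
have E2 : n.*2.+2%:R = 2 * n.+1%:R :> R by rewrite -natrM mul2n doubleS.
have n2 : 0 < n.*2.+2%:R :> R by rewrite ltr0n.
have le : \sum_(n.+1 <= k < n.*2.+2) (n.*2.+2%:R^-1 * S) <=
    \sum_(0 <= k < n.*2.+2) mean a k.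
  have nn : (n.+1 <= n.*2.+2)%N by rewrite -doubleS -addnn leq_addr.
  rewrite [leRHS](big_cat_nat (n := n.+1))//= ler_wpDl//.
    by apply: sumr_ge0 => k _; exact: mean_ge0.
  apply: ler_sum_nat => k /andP[nk kn]; rewrite /mean ler_pM ?invr_ge0//.
    by rewrite lef_pV2 ?posrE ?ltr0n// ler_nat.
  by apply: le_sum_nat; rewrite ltnW.
have card : (n.*2.+2 - n.+1)%N = n.+1 by rewrite -doubleS -addnn addnK.
rewrite sumr_const_nat card -[_ *+ _]mulr_natr in le.
rewrite {1}/mean -/S [X in 4 * X]/mean.
apply: (@le_trans _ _ (4 * (n.*2.+2%:R^-1 * (n.*2.+2%:R^-1 * S * n.+1%:R)))).
  rewrite E2; rewrite le_eqVlt; apply/orP; left; apply/eqP; field.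
  by rewrite gt_eqF.
by rewrite ler_wpM2l// ler_wpM2l// invr_ge0.
Qed.

Lemma sum_as_sum_of_tails N :
  \sum_(0 <= j < N) a j =
  \sum_(0 <= k < N) \sum_(k <= j < N) (a j / j.+1%:R).
Proof.
elim: N => [|N IH]; first by rewrite !big_geq.
rewrite big_nat_recr//= IH [RHS]big_nat_recr//= big_nat1.
under [in RHS]eq_big_nat => k /andP[_ kN].
  rewrite big_nat_recr/=; last exact: ltnW.
  over.
rewrite big_split/= sumr_const_nat subn0 -addrA; congr (_ + _).
by rewrite -mulrSr -[a N / _ *+ _]mulr_natr divfK// pnatr_eq0.
Qed.

Let T N := \sum_(0 <= j < N) a j.
Let P n N := \sum_(n <= k < N) (mean a k / k.+1%:R).

Let meanT k : mean a k / k.+1%:R = T k.+1 / k.+1%:R ^+ 2.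
Proof.
have : k.+1%:R != 0 :> R by rewrite pnatr_eq0.
by rewrite /mean -/(T k.+1); set z := k.+1%:R => z0; field.
Qed.

Let T0 N : 0 <= T N. Proof. exact: sum_nat_ge0. Qed.

(** Since [a j = T (j + 1) - T j], summation by parts moves the difference onto
    [1 / (j + 1)], and [1 / (j + 1) - 1 / (j + 2) <= 1 / (j + 1) ^ 2] is the
    weight of [T (j + 1)] in [mean a j / (j + 1)]. *)
Lemma sum_by_parts n N : (n <= N)%N ->
  \sum_(n <= j < N) (a j / j.+1%:R) <= P n N + T N / N.+1%:R.
Proof.
elim: N => [|N IH]; first by rewrite leqn0 => /eqP->; rewrite /P !big_geq// add0r divr_ge0.
rewrite leq_eqVlt => /predU1P[->|].
  by rewrite /P !big_geq// add0r divr_ge0.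
rewrite ltnS => nN; rewrite big_nat_recr//= /P big_nat_recr//= -/(P n N) meanT.
apply: (@le_trans _ _ (P n N + T N.+1 / N.+1%:R)).
  rewrite [T N.+1]/T big_nat_recr//= -/(T N) mulrDl addrA lerD2r.
  exact: IH.
rewrite -addrA lerD2l -mulrDr ler_wpM2l//.
have : 0 < N.+1%:R :> R by rewrite ltr0n.
have -> : N.+2%:R = N.+1%:R + 1 :> R by rewrite natr1.
set z := N.+1%:R => z0; rewrite -subr_ge0 (_ : _ - _ = (z ^+ 2 * (z + 1))^-1).
  by rewrite invr_ge0 mulr_ge0// ?sqr_ge0// addr_ge0// ltW.
by field; rewrite !gt_eqF// addr_gt0.
Qed.

(** The boundary term is absorbed by the block of the [N + 1] indices [N],
    ..., [2 N]: there [mean a k / (k + 1)] is at least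
    [T N / (2 (N + 1)) ^ 2], as [T] increases. *)
Lemma tail_by_doubling n N : (n <= N)%N -> T N / N.+1%:R <= 4 * (P n N.*2.+1 - P n N).
Proof.
move=> nN; have N1 : 0 < N.+1%:R :> R by rewrite ltr0n.
have NN : (N <= N.*2.+1)%N by rewrite -addnn -addnS leq_addr.
rewrite /P (big_cat_nat nN NN)/= addrC addrK.
have le : \sum_(N <= k < N.*2.+1) (T N / (2 * N.+1%:R) ^+ 2) <=
    \sum_(N <= k < N.*2.+1) (mean a k / k.+1%:R).
  apply: ler_sum_nat => k /andP[Nk kN]; rewrite meanT ler_pM ?invr_ge0//.
    by apply: le_sum_nat; exact: leqW.
  rewrite lef_pV2 ?posrE ?exprn_gt0 ?mulr_gt0 ?ltr0n// lerXn2r ?nnegrE ?mulr_ge0//.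
  by rewrite -natrM ler_nat mul2n doubleS leqW.
have card : (N.*2.+1 - N)%N = N.+1 by rewrite -addnn -addnS addKn.
rewrite sumr_const_nat card -[_ *+ _]mulr_natr in le.
apply: (@le_trans _ _ (4 * (T N / (2 * N.+1%:R) ^+ 2 * N.+1%:R))); last by rewrite ler_wpM2l.
by rewrite le_eqVlt; apply/orP; left; apply/eqP; field; rewrite gt_eqF.
Qed.

Lemma sum_le_mean n N : (n <= N)%N ->
  \sum_(n <= j < N) (a j / j.+1%:R) <= 4 * P n N.*2.+1.
Proof.
move=> nN; apply: (le_trans (sum_by_parts nN)).
apply: (@le_trans _ _ (P n N + 4 * (P n N.*2.+1 - P n N))).
  by rewrite lerD2l tail_by_doubling.
have P0 : 0 <= P n N by apply: sumr_ge0 => k _; rewrite divr_ge0// mean_ge0.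
lra.
Qed.

Lemma copsond_le_copsond_mean n :
  (copsond_op a n <= 4%:E * copsond_op (fun k => `|mean a k|%R) n)%E.
Proof.
apply: copsond_le => N nN.
apply: (@le_trans _ _ (4 * P n N.*2.+1)%:E); first by rewrite lee_fin sum_le_mean.
rewrite EFinM lee_wpmul2l// -sumEFin.
under eq_bigr => k _ do rewrite -[mean a k]ger0_norm ?mean_ge0//.
by apply: nneseries_lim_ge => k _ _; rewrite lee_fin divr_ge0.
Qed.

Section finite_copson.
Hypothesis fin : forall n, copsond_op a n \is a fin_num.
Let F n := fine (copsond_op a n).

Lemma mean_le_mean_copson n : mean a n <= mean (fun k => `|F k|) n.
Proof.
rewrite /mean ler_wpM2l ?invr_ge0// sum_as_sum_of_tails.
apply: ler_sum_nat => k _; apply: le_trans (ler_norm _).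
by rewrite -lee_fin /F fineK// sum_le_copsond.
Qed.

(** The discrete form of [cop_dilate] with [a = 1/2]: at least [(n + 1) / 2]
    indices lie between [n./2] and [n], and there both [F k] and
    [1 / (k + 1)] are at least their values at [n]. *)
Lemma copsond_half n : (copsond_op a n <= 2%:E * copsond_op (fun k => `|F k|%R) n./2)%E.
Proof.
have F0 k : 0 <= F k by rewrite fine_ge0// copsond_ge0.
have n1 : 0 < n.+1%:R :> R by rewrite ltr0n.
have hn : (n./2 <= n.+1)%N by rewrite leqW// -{2}(odd_double_half n) -addnn addnCA leq_addr.
apply: (@le_trans _ _ (2 * \sum_(n./2 <= k < n.+1) (`|F k| / k.+1%:R))%:E); last first.
  rewrite EFinM lee_wpmul2l// -sumEFin.
  by apply: nneseries_lim_ge => k _ _; rewrite lee_fin divr_ge0.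
rewrite -(fineK (fin n)) -/(F n) lee_fin.
apply: (@le_trans _ _ (2 * \sum_(n./2 <= k < n.+1) (F n / n.+1%:R))); last first.
  rewrite ler_wpM2l//; apply: ler_sum_nat => k /andP[_ kn].
  rewrite ler_pM ?invr_ge0//; last by rewrite lef_pV2 ?posrE ?ltr0n// ler_nat.
  by rewrite ger0_norm// fine_le// copsond_anti// -ltnS.
rewrite sumr_const_nat -[_ / _ *+ _]mulr_natr.
have le : n.+1%:R <= 2 * (n.+1 - n./2)%:R :> R.
  rewrite -natrM ler_nat mul2n -{1}[n]odd_double_half; lia.
rewrite [leRHS](_ : _ = F n * (2 * (n.+1 - n./2)%:R / n.+1%:R)); last by field; rewrite gt_eqF.
by rewrite ler_peMr// ler_pdivlMr// mul1r.
Qed.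
End finite_copson.
End nonneg.
End sequence_operators.

Section sequence_spaces.
Context (R : realType).
Local Notation count := (@counting nat R).
Local Notation Cd := (@cesarod_op R).
Local Notation Csd := (@copsond_op R).
Variable X : fspace count setT.
Hypothesis nX : normed_ideal X.

Lemma cesarod_iter : bounded_on X Cd -> bounded_on X (@sigma_half_op R) ->
  space_eq (cesarod_space X) (cesarod_space (cesarod_space X)).
Proof.
move=> /bounded_nonneg-/(_ nX)[A A0 bC] /bounded_nonneg-/(_ nX)[B B0 bS].
apply: space_eqI; first by exists A => //; exact: (op_space_embeds_iter nX).
(* 8 is 4 from [mean_le_mean_mean] times 2, as only the second of the two
   terms averaged by [sigma_half_op] is used. *)
exists (8 * B); first by rewrite mulr_gt0.
apply: (@embeds_op_space _ nat R count setT X nX (cesarod_space (cesarod_space X))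
  (fun f => Cd (fun y => `|fine (Cd (fun x => `|f x|) y)|)) Cd
  (@sigma_half_op R) 8 B) => //.
  by move=> f [_ [_ []]].
move=> f _; split=> //; apply: nearW => n _.
have E (h : nat -> R) : (forall k, 0 <= h k) -> (fun y => `|fine (Cd h y)|) = mean h.
  by move=> h0; apply: funext => k; rewrite cesarod_mean ger0_norm ?mean_ge0.
have g0 k : 0 <= `|f k| by [].
rewrite cesarod_mean lee_fin mean_ge0// andTb (E _ g0) (E _ (mean_ge0 g0)).
rewrite /sigma_half_op -EFinM lee_fin.
have m0 k : 0 <= mean (mean (fun k => `|f k|)) k.
  by apply: mean_ge0 => j; exact: mean_ge0.
have := mean_le_mean_mean g0 n; have := m0 n.*2; lra.
Qed.

Lemma copsond_iter : bounded_on X Csd -> bounded_on X (@sigma2_op R) ->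
  space_eq (copsond_space X) (copsond_space (copsond_space X)).
Proof.
move=> /bounded_nonneg-/(_ nX)[A A0 bC] /bounded_nonneg-/(_ nX)[B B0 bS].
apply: space_eqI; first by exists A => //; exact: (op_space_embeds_iter nX).
exists (2 * B); first by rewrite mulr_gt0.
apply: (@embeds_op_space _ nat R count setT X nX (copsond_space (copsond_space X))
  (fun f => Csd (fun y => `|fine (Csd (fun x => `|f x|) y)|)) Csd
  (@sigma2_op R) 2 B) => //.
  by move=> f [_ [_ []]].
move=> f [_ [fin [_ [fin2 _]]]]; split=> //; apply: nearW => n _.
rewrite copsond_ge0//=.
have g0 k : 0 <= `|f k| by [].
have fin' k := ae_countingP fin k I; have fin2' k := ae_countingP fin2 k I.
apply: (le_trans (copsond_half g0 fin' n)).
rewrite /sigma2_op lee_wpmul2l// -[leLHS]fineK ?fin2'//.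
by rewrite lee_fin ler_norm.
Qed.

Lemma cesarod_eq_copsond : bounded_on X Cd -> bounded_on X Csd ->
  space_eq (cesarod_space X) (copsond_space X).
Proof.
move=> /bounded_nonneg-/(_ nX)[A A0 bC] /bounded_nonneg-/(_ nX)[B B0 bS].
apply: space_eqI.
  exists (4 * B); first by rewrite mulr_gt0.
  apply: (@embeds_op_space _ nat R count setT X nX (cesarod_space X)
    (fun f => Cd (fun x => `|f x|)) Csd Csd 4 B) => //.
    by move=> f [].
  move=> f _; split=> //; apply: nearW => n _; rewrite copsond_ge0//=.
  have g0 k : 0 <= `|f k| by [].
  apply: (le_trans (copsond_le_copsond_mean g0 n)).
  suff -> : (fun k => `|fine (Cd (fun x => `|f x|) k)|) =
    (fun k => `|mean (fun x => `|f x|) k|) by [].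
  by apply: funext => k; rewrite cesarod_mean.
exists (1 * A); first by rewrite mul1r.
apply: (@embeds_op_space _ nat R count setT X nX (copsond_space X)
  (fun f => Csd (fun x => `|f x|)) Cd Cd 1 A) => //.
  by move=> f [].
move=> f [_ [fin _]]; split=> //; apply: nearW => n _.
have g0 k : 0 <= `|f k| by [].
have fin' k := ae_countingP fin k I.
rewrite !cesarod_mean lee_fin mean_ge0//= mul1e lee_fin.
exact: mean_le_mean_copson.
Qed.

End sequence_spaces.

(** * Embeddings and equalities of the spaces *)
Lemma cesaroZ (R : realType) (D : set R) :
  measurable D -> (forall x y, D y -> 0 <= x -> x <= y -> D x) ->
  forall (c : R) (f : R -> R), 0 < c -> (forall x, 0 <= f x) ->
  measurable_fun (D : set (measurableTypeR R)) f ->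
  forall x, D x -> cesaro_op (fun y => c * f y) x = (c%:E * cesaro_op f x)%E.
Proof.
move=> mD D_down c f c0 f0 mf x Dx; rewrite /cesaro_op muleCA; congr (_ * _)%E.
rewrite -ge0_integralZl//.
- by apply/measurable_EFinP; exact: measurable_funS mD (itv_subD D_down Dx) mf.
- by move=> t _; rewrite lee_fin.
- by rewrite lee_fin ltW.
Qed.

Lemma Loo_cst1 (R : realType) :
  Lp_space (@lebesgue_measure R) (unit_interval R) +oo%E (cst 1).
Proof.
apply/andP; split; apply/mem_set.
  by apply/(measurable_restrictT _ _).1 => //; exact: measurable_unit_interval.
rewrite /= /finite_norm unlock lebesgue_measureT_gt0.
apply: (@le_lt_trans _ _ 1%E); last exact: ltry.
apply/ess_supP; apply: nearW => t /=; rewrite patchE.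
by case: ifP => _; rewrite ?normr1 ?normr0 lee_fin.
Qed.

Theorem theorem1 (R : realType) :
  (* (a) *)
  (forall X : fspace (@lebesgue_measure R) (half_line R),
    banach_ideal_space X ->
    let C := @cesaro_op R in
    let Cs := copson_op (half_line R) in
    let sigma := dilation_op (half_line R) in
    [/\ (* (i) *)
        bounded_on X C ->
          embeds X (cesaro_space X) /\
          ((exists2 a : R, 1 < a & bounded_on X (sigma a^-1)) ->
           space_eq (cesaro_space X) (cesaro_space (cesaro_space X))),
        (* (ii) *)
        bounded_on X Cs ->
          embeds X (copson_space X) /\
          ((exists2 a : R, 0 < a < 1 & bounded_on X (sigma a^-1)) ->
           space_eq (copson_space X) (copson_space (copson_space X)))
      & (* (iii) *)
        bounded_on X C -> bounded_on X Cs ->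
          space_eq (cesaro_space X) (copson_space X)]) /\
  (* (b) *)
  ((forall X : fspace (@lebesgue_measure R) (unit_interval R),
    banach_ideal_space X ->
    let C := @cesaro_op R in
    let Cs := copson_op (unit_interval R) in
    let sigma := dilation_op (unit_interval R) in
    let L1 := Lp_space lebesgue_measure (unit_interval R) 1%:E in
    let Loo := Lp_space lebesgue_measure (unit_interval R) +oo%E in
    [/\ (* (iv), general X *)
        bounded_on X C ->
          embeds_with (opnorm X C) X (cesaro_space X) /\
          embeds_with (opnorm X C) (copson_space X) (cesaro_space X),
        (* (v) *)
        bounded_on X Cs ->
          embeds X (copson_space X) /\
          ((exists2 a : R, 0 < a < 1 & bounded_on X (sigma a^-1)) ->
           space_eq (copson_space X) (copson_space (copson_space X))),
        (* (vi) *)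
        bounded_on X Cs -> embeds Loo X ->
          embeds (inter_space (cesaro_space X) L1) (copson_space X) /\
          (bounded_on X C -> embeds X L1 ->
           space_eq (copson_space X) (inter_space (cesaro_space X) L1) /\
           space_eq (kothe_dual (copson_space X))
                    (tandori_space (kothe_dual X)))
      & (* (vii) *)
        bounded_on X C -> bounded_on X Cs -> symmetric_space X ->
          space_eq (copson_space X) (inter_space (cesaro_space X) L1) /\
          space_eq (inter_space (cesaro_space X) L1)
                   (cesaro_space (tandori_space X))]) /\
   (* (iv), strictness for L^p[0,1] *)
   (forall p : R, 1 < p ->
    let X := Lp_space lebesgue_measure (unit_interval R) p%:E in
    bounded_on X (@cesaro_op R) /\
    strictly_embeds_with (opnorm X (@cesaro_op R))
      (copson_space X) (cesaro_space X))) /\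
  (* (c) *)
  (forall X : fspace (@counting nat R) setT,
    banach_ideal_space X ->
    let Cd := @cesarod_op R in
    let Csd := @copsond_op R in
    [/\ (* (viii) *)
        bounded_on X Cd ->
          embeds X (cesarod_space X) /\
          (bounded_on X (@sigma_half_op R) ->
           space_eq (cesarod_space X) (cesarod_space (cesarod_space X))),
        (* (ix) *)
        bounded_on X Csd ->
          embeds X (copsond_space X) /\
          (bounded_on X (@sigma2_op R) ->
           space_eq (copsond_space X) (copsond_space (copsond_space X)))
      & (* (x) *)
        bounded_on X Cd -> bounded_on X Csd ->
        bounded_on X (@shift_op R) -> bounded_on X (@backshift_op R) ->
          space_eq (cesarod_space X) (copsond_space X)]).
Proof.
split; [|split; [split|]].
- move=> X /banach_normed_ideal nX C Cs sigma; split.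
  + move=> bC; split.
      have [A _ bA] := bounded_nonneg nX bC.
      exact: embeds_withW (fnorm_ge0 nX) (bounded_embeds nX bA).
    by move=> [a a1 bS]; exact: cesaro_iter nX a a1 bC bS.
  + move=> bCs; split.
      have [A _ bA] := bounded_nonneg nX bCs.
      exact: embeds_withW (fnorm_ge0 nX) (bounded_embeds nX bA).
    move=> [a a01 bS].
    exact: (copson_iter (@measurable_half_line R) (@half_line_ge0 R)
      (@half_line_down R) nX a01 bCs bS).
  + exact: cesaro_eq_copson.
- move=> X bX C Cs sigma L1 Loo; have nX := banach_normed_ideal bX.
  have embL1 : bounded_on X C -> bounded_on X Cs -> X (cst 1) ->
      exists2 B : R, 0 < B &
        forall f, X f -> (\int[lebesgue_measure]_(t in unit_interval R) `|(f t)%:E| <=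
          (B * fnorm X f)%:E)%E.
    move=> bC bCs X1; have n1 := fnorm1_gt0 bX X1.
    have [A A0 bA] := bounded_nonneg nX bC; have [B B0 bB] := bounded_nonneg nX bCs.
    exists ((fnorm X (cst 1))^-1 * (A + B)); first by rewrite mulr_gt0 ?invr_gt0// addr_gt0.
    move=> f Xf; have [Xnf nnf] := mem_abs nX Xf.
    have [//|eC leC] := bA _ _ Xnf; have [//|eCs leCs] := bB _ _ Xnf.
    apply: le_trans (cesaro_copson_int1 bX X1 (ni_measurable nX Xf) eC eCs) _.
    rewrite lee_fin -mulrA ler_wpM2l ?invr_ge0 ?(ltW n1)// mulrDl -nnf.
    exact: lerD.
  split.
  + move=> bC; have bA : nonneg_bound (opnorm X C) X C.
      apply: opnorm_bound => // c f c0 f0 Xf.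
      by apply: (cesaroZ (@measurable_unit_interval R)) => //;
        [exact: unit_interval_down|exact: (ni_measurable nX Xf)].
    split; first exact: (bounded_embeds nX bA).
    exact: (copson_embeds_cesaro (@measurable_unit_interval R) (@unit_interval_ge0 R)
      (@unit_interval_down R) nX bA).
  + move=> bCs; split.
      have [A _ bA] := bounded_nonneg nX bCs.
      exact: embeds_withW (fnorm_ge0 nX) (bounded_embeds nX bA).
    move=> [a a01 bS].
    exact: (copson_iter (@measurable_unit_interval R) (@unit_interval_ge0 R)
      (@unit_interval_down R) nX a01 bCs bS).
  + move=> bCs LX; have X1 : X (cst 1).
      by case: LX => K _ LX; exact: (proj1 (LX _ (@Loo_cst1 R))).
    have e2 := cesaro_L1_embeds_copson nX X1 bCs.
    split=> // bC XL; have [K K0 XK] := embeds_L1 XL.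
    split.
      by apply: space_eqI => //; exact: (copson_embeds_cesaro_L1 nX K0 XK bC).
    have [A A0 bA] := bounded_nonneg nX bC; have [B B0 bB] := bounded_nonneg nX bCs.
    apply: space_eqI.
      exists (2 * (A + B)); first by rewrite mulr_gt0// addr_gt0.
      by move=> f Xf; exact: (kothe_tandori bX A0 B0 bA bB XK Xf).
    by exists 1 => //; exact: tandori_embeds_kothe.
  + move=> bC bCs sX; have X1 := symmetric_cst1 bX sX.
    have [K K0 XK] := embL1 bC bCs X1.
    have e1 := copson_embeds_cesaro_L1 nX K0 XK bC.
    have e2 := cesaro_L1_embeds_copson nX X1 bCs.
    split; first exact: space_eqI.
    apply: space_eqI; first exact: inter_embeds_cesaro_tandori.
    exact: cesaro_tandori_embeds_inter.
- move=> p p1 X; have bC := Lp_cesaro_bounded p1; split=> //.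
  have nX := Lp_normed_ideal p1.
  split; last exact: Lp_cesaro_not_copson.
  apply: (copson_embeds_cesaro (@measurable_unit_interval R) (@unit_interval_ge0 R)
    (@unit_interval_down R) nX).
  apply: opnorm_bound => // c f c0 f0 Xf.
  by apply: (cesaroZ (@measurable_unit_interval R)) => //;
    [exact: unit_interval_down|exact: (ni_measurable nX Xf)].
- move=> X /banach_normed_ideal nX Cd Csd; split.
  + move=> bC; split; last exact: cesarod_iter.
    have [A _ bA] := bounded_nonneg nX bC.
    exact: embeds_withW (fnorm_ge0 nX) (bounded_embeds nX bA).
  + move=> bCs; split; last exact: copsond_iter.
    have [A _ bA] := bounded_nonneg nX bCs.
    exact: embeds_withW (fnorm_ge0 nX) (bounded_embeds nX bA).
  + by move=> bC bCs _ _; exact: cesarod_eq_copsond.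
Qed.
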